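(* Let $\Phi:\mathbb R\to\mathbb R$ be a $2\pi$-periodic bounded function. Suppose that $\Phi$ is differentiable a.e. Then for a.e. $\tau\in\mathbb R$ $$\lim_{z\to\xi}\ \mathbb V_{\Phi}(z)\ =\ \mathbb H_\Phi(\tau)\ =\ \frac{1}{2\pi}\int_{-\pi}^{\pi}\frac{d\Phi(t)}{\tan\frac{\tau-t}{2}},\qquad \xi:=e^{i\tau}\in\partial\mathbb D,$$ along all nontangential paths in $\mathbb D$ to the point $\xi$, where the singular integral on the right-hand side is understood in the sense of the Cauchy principal value (which exists and is finite for a.e. $\tau$).
   Context: $\mathbb D=\{z\in\mathbb C:|z|<1\}$. For arbitrary functions $g,f$ on a compact interval $[a,b]$, the Riemann--Stieltjes integral $\int_a^b g\,df$ is the limit, as $\delta:=\max_k|t_k-t_{k-1}|\to0$, of the sums $\sum_{k=1}^p g(\tau_k)\,(f(t_k)-f(t_{k-1}))$ over partitions $a=t_0\le t_1\le\dots\le t_p=b$ and points $\tau_k\in[t_{k-1},t_k]$, provided a finite limit exists, uniform with respect to the partitions and the intermediate points (no monotonicity or bounded variation is assumed). The conjugate Poisson kernel is $Q_r(\Theta)=\dfrac{2r\sin\Theta}{1-2r\cos\Theta+r^2}$, $0\le r<1$, $\Theta\in\mathbb R$. For a $2\pi$-periodic bounded $\Phi:\mathbb R\to\mathbb R$ whose set of discontinuities has measure zero, the conjugate Poisson--Stieltjes integral is $$\mathbb V_\Phi(z):=\frac1{2\pi}\int_{-\pi}^{\pi}Q_r(\vartheta-t)\,d\Phi(t),\qquad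 z=re^{i\vartheta},\ r<1 .$$ The Hilbert--Stieltjes integral of $\Phi$ at $\tau$ is the principal value $$\mathbb H_\Phi(\tau):=\frac1{2\pi}\lim_{\varepsilon\to+0}\int_{\varepsilon\le|\tau-t|\le\pi}\frac{d\Phi(t)}{\tan\frac{\tau-t}{2}},$$ where the integral is the sum of the Riemann--Stieltjes integrals over $[\tau-\pi,\tau-\varepsilon]$ and $[\tau+\varepsilon,\tau+\pi]$, and $1/\tan(\pm\pi/2)$ is read as $\cot(\pm\pi/2)=0$. A path in $\mathbb D$ terminating at $\zeta\in\partial\mathbb D$ is nontangential if its part in a neighborhood of $\zeta$ lies inside an angle in $\mathbb D$ with vertex at $\zeta$. *)

(* Defs.v *)
From mathcomp Require Export all_boot all_order all_algebra.
From mathcomp Require Export all_classical all_reals all_analysis.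
From mathcomp Require Export complex.
Export numFieldNormedType.Exports.
Import Order.TTheory GRing.Theory Num.Theory.

Set Implicit Arguments.
Unset Strict Implicit.
Unset Printing Implicit Defensive.

Local Open Scope classical_set_scope.
Local Open Scope complex_scope.
Local Open Scope ring_scope.

Section RiemannStieltjes.
Variable R : realType.
Implicit Types (g f : R -> R) (a b s I : R).

(* Tagged partitions are given by sequences of which only the nodes
   t 0, ..., t p and the tags tau 0, ..., tau p.-1 matter; the tag tau k lies
   in [t k, t k.+1]. Repeated nodes are allowed. *)
Definition tagged_partition a b (p : nat) (t tau : nat -> R) : Prop :=
  [/\ t 0%N = a, t p = b &
      forall k, (k < p)%N -> t k <= tau k <= t k.+1].

Definition RS_sum g f (p : nat) (t tau : nat -> R) : R :=
  \sum_(k < p) g (tau k) * (f (t k.+1) - f (t k)).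

Definition is_RS_integral g f a b I : Prop :=
  forall e, 0 < e -> exists2 d, 0 < d &
    forall p t tau, tagged_partition a b p t tau ->
      (forall k, (k < p)%N -> `|t k.+1 - t k| < d) ->
      `|RS_sum g f p t tau - I| < e.

Definition RS_integrable g f a b : Prop := exists I, is_RS_integral g f a b I.

(* Arbitrary when g is not Riemann-Stieltjes integrable with respect to f. *)
Definition RS_integral g f a b : R := get (is_RS_integral g f a b).

(* Principal value at s of the integral of g df over [a, b], where a < s < b. *)
Definition RS_pv_trunc g f a b s (eps : R) : R :=
  RS_integral g f a (s - eps) + RS_integral g f (s + eps) b.

Definition has_RS_pv g f a b s : Prop :=
  (\forall eps \near 0^'+,
     RS_integrable g f a (s - eps) /\ RS_integrable g f (s + eps) b) /\
  cvg (RS_pv_trunc g f a b s eps @[eps --> 0^'+]).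

Definition RS_pv g f a b s : R :=
  lim (RS_pv_trunc g f a b s eps @[eps --> 0^'+]).

End RiemannStieltjes.

Section Disc.
Variable R : realType.

(* The alias R[i]^o carries the topology of the complex modulus. *)
Definition unit_disc : set R[i]^o := [set z | `|z| < 1].

Definition expi (theta : R) : R[i]^o := cos theta +i* sin theta.

Definition cmod (z : R[i]^o) : R := complex.Re `|z|.

(* A choice of argument, determined modulo 2 pi when z != 0. *)
Definition carg (z : R[i]^o) : R :=
  get [set theta : R | z = (cmod z)%:C * expi theta].

Definition path_to (gamma : R -> R[i]^o) (zeta : R[i]^o) : Prop :=
  [/\ {within `[0, 1[, continuous gamma},
      (forall t, 0 <= t < 1 -> unit_disc (gamma t)) &
      gamma t @[t --> 1^'-] --> zeta].

(* The angle with vertex zeta and directions in ]alpha, beta[, truncated at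
   distance d from its vertex. *)
Definition angle (zeta : R[i]^o) (alpha beta d : R) : set R[i]^o :=
  [set z | exists rho phi : R,
     [/\ 0 < rho < d, alpha < phi < beta & z = zeta + rho%:C * expi phi]].

(* When `|zeta| = 1, the inclusion in the disc for some d > 0 forces the two
   sides of the angle to be transverse to the circle. *)
Definition nontangential_path (gamma : R -> R[i]^o) (zeta : R[i]^o) : Prop :=
  path_to gamma zeta /\
  exists alpha beta d : R,
    [/\ 0 < d, angle zeta alpha beta d `<=` unit_disc &
        forall t, 0 <= t < 1 -> `|gamma t - zeta| < d%:C ->
          angle zeta alpha beta d (gamma t)].

End Disc.

Section ConjugatePoissonHilbert.
Variable R : realType.
Implicit Types (Phi : R -> R) (r theta tau t : R).

Definition conj_poisson_kernel r theta : R :=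
  (2 * r * sin theta) / (1 - 2 * r * cos theta + r ^+ 2).

(* The choice of the argument is irrelevant, by periodicity of the kernel and
   because the kernel vanishes for r = 0. *)
Definition conj_poisson_stieltjes Phi (z : R[i]^o) : R :=
  (2 * pi)^-1 *
  RS_integral (fun t => conj_poisson_kernel (cmod z) (carg z - t))
    Phi (- pi) pi.

(* 1 / tan ((tau - t) / 2), with the value 0 at tau - t = pi and - pi. *)
Definition hilbert_kernel tau t : R :=
  cos ((tau - t) / 2) / sin ((tau - t) / 2).

Definition hilbert_stieltjes Phi tau : R :=
  (2 * pi)^-1 *
  RS_pv (hilbert_kernel tau) Phi (tau - pi) (tau + pi) tau.

End ConjugatePoissonHilbert.

(* Main.v *)
(* Let f be the upper semicontinuous envelope of Phi: it is Borel measurable, and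
   it agrees with Phi at every continuity point, hence almost everywhere. If g is
   C^1 on [a, b], then the integral of g dPhi exists and equals
   g b * Phi b - g a * Phi a - \int_a^b f g'; the Riemann-Stieltjes sums differ
   from this value by at most sup |g'| times the integral of the oscillation of
   Phi at the scale of the mesh, which tends to 0 by dominated convergence.
   So V_Phi is, up to 1 / (2 pi), the convolution of f with the derivative Q_r'
   of the conjugate Poisson kernel, and the truncations of H_Phi are, up to
   boundary terms, integrals of f against the derivative of cot (u / 2), set to 0
   for |u| < d.

   At a point tau where Phi is differentiable, Q_r' (phi - u) minus the derivative
   truncated at d = 1 - r is O(d / (d + |u|)^3) for |phi| = O(d). Subtracting from
   f its value and a multiple of sin, whose integrals are explicit, leaves
   o(|u|), so V_Phi minus the truncation of H_Phi at 1 - r tends to 0 in each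
   angle. Everything then follows from the existence of the radial limit of
   f * Q_r' at almost every tau.

   For that, almost every point lies in one of the sets
   E_n = {x | |f y - f x| <= n |y - x| for all y}. On E_n, f coincides with a
   periodic Lipschitz function G. By Bessel's inequality for the difference
   quotients of G, the Fourier coefficients of G' are square summable, so the
   conjugate function of G is the primitive of an integrable function; hence
   G * Q_r', which is the conjugate function convolved with the derivative of the
   Poisson kernel, converges at almost every point by Lebesgue's differentiation
   theorem. The remainder f - G is O(dist(t, E_n)), so by Marcinkiewicz' theorem
   (f - G) / (t - x)^2 is integrable for almost every x in E_n, and dominated
   convergence applies to (f - G) * Q_r'. *)
Require Import Defs.
From mathcomp Require Import measurable_realfun ring lra.

Set Implicit Arguments.
Unset Strict Implicit.
Unset Printing Implicit Defensive.

Import Order.TTheory GRing.Theory Num.Theory.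

Local Open Scope classical_set_scope.
Local Open Scope ring_scope.

(** * Lebesgue integrals over intervals *)

Section IntervalIntegral.
Variable R : realType.
Notation mu := (@lebesgue_measure R).
Implicit Types (f g : R -> R) (a b c : R).

(** [Phi] need not have bounded variation, so [dPhi] is not a measure and every integral must carry
    the derivative on the kernel. The price is that the derivative of the conjugate Poisson kernel
    has size (1 - r)^-2 and is no approximate identity: the value and the linear part of [Phi] at
    [tau] have to be removed exactly before the rest becomes small. The linear part is a multiple of
    sin rather than of u, since sin is periodic and pairs with the kernels by orthogonality.
    Differentiability at [tau] compares the two sides but makes neither converge, as o(|u|) / u^2
    need not be integrable at 0. This is why the limits exist only almost everywhere, and why both
    are deduced from the radial one. There the Lipschitz function has difference quotients bounded
    in L^2, so orthogonality of harmonics takes the place of a theory of the Hilbert transform. The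
    sets on which [Phi] is replaced ask for the Lipschitz inequality against all points y, not only
    those of the set: this is what bounds the remainder by the distance to the set. *)

Lemma measurable_inv (D : set R) : measurable_fun D (fun x : R => x^-1).
Proof.
apply: (@measurable_funTS _ _ _ _ D).
(* The power function is measurable and is applied to the nonnegative number [x ^+ 2]; at 0 both
   sides are 0, since the inverse of 0 is 0. *)
have -> : (fun x : R => x^-1) = (fun x => x * (x ^+ 2) `^ (-1)).
  apply/funext => x; rewrite powR_inv1 ?sqr_ge0//.
  by have [->|x0] := eqVneq x 0; [rewrite invr0 mul0r|field].
apply: measurable_funM => //.
apply: (measurableT_comp (measurable_powR _)) => //.
Qed.

Lemma integrable_itv_bounded a b f M : measurable_fun `[a, b] f ->
  {in `[a, b], forall x, `|f x| <= M} -> mu.-integrable `[a, b] (EFin \o f).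
Proof.
move=> mf fM; apply: measurable_bounded_integrable => //.
  by rewrite /= lebesgue_measure_itv; case: ifP => //= _; rewrite ltry.
by exists M; split; [exact: num_real|move=> x Mx y/= ay; exact: (le_trans (fM y ay) (ltW Mx))].
Qed.

Lemma le_int_itv a b f g : mu.-integrable `[a, b] (EFin \o f) ->
  mu.-integrable `[a, b] (EFin \o g) -> {in `[a, b], forall x, `|f x| <= g x} ->
  `|\int[mu]_(x in `[a, b]) f x| <= \int[mu]_(x in `[a, b]) g x.
Proof.
move=> fi gi fg; apply: (le_trans (le_normr_Rintegral _ _)) => //.
by apply: le_Rintegral => //; exact: integrable_norm.
Qed.

Lemma int_itv_cst a b c : a <= b -> \int[mu]_(x in `[a, b]) c = c * (b - a).
Proof.
move=> ab; rewrite Rintegral_cst//= lebesgue_measure_itv/= lte_fin.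
by case: ltgtP ab => // [->] _; rewrite subrr.
Qed.

Lemma int_itv_split a b c f : a <= b -> b <= c ->
  mu.-integrable `[a, c] (EFin \o f) ->
  \int[mu]_(x in `[a, c]) f x =
  \int[mu]_(x in `[a, b]) f x + \int[mu]_(x in `[b, c]) f x.
Proof.
move=> ab bc fi; apply/eqP; rewrite addrC -subr_eq; apply/eqP.
rewrite (@Rintegral_itvB _ f (BLeft a) (BRight c) b) ?bnd_simp//.
rewrite Rintegral_itv_obnd_cbnd//.
apply: integrableS fi => //; apply: subset_itvr; rewrite bnd_simp//.
Qed.

Lemma int_itvxx a f : \int[mu]_(x in `[a, a]) f x = 0.
Proof. by rewrite set_itv1 Rintegral_set1. Qed.

Lemma int_itv_deriv a b (f F : R -> R) : a <= b ->
  (forall x : R, x \in `[a, b] -> is_derive x (1 : R) F (f x)) ->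
  (forall x : R, x \in `[a, b] -> {for x, continuous f}) ->
  \int[mu]_(x in `[a, b]) f x = F b - F a.
Proof.
rewrite le_eqVlt => /predU1P[-> _ _|ab dF cf]; first by rewrite int_itvxx subrr.
have cF x : x \in `[a, b] -> {for x, continuous F}.
  move=> /dF [dFx _]; exact/differentiable_continuous/derivable1_diffP.
rewrite /Rintegral (@continuous_FTC2 _ f F a b ab)//.
- by apply: continuous_in_subspaceT => x; rewrite inE => /cf.
- split.
  + move=> x xab; apply: ex_derive; apply: dF.
    by apply: subset_itv_oo_cc.
  + apply: cvg_at_right_filter; apply: cF; by rewrite in_itv/= lexx ltW.
  + apply: cvg_at_left_filter; apply: cF; by rewrite in_itv/= lexx ltW.
- move=> x xab; rewrite derive1E; apply: derive_val; apply: dF.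
  exact: subset_itv_oo_cc.
Qed.

Lemma integrable_itv_cont a b f :
  (forall x : R, x \in `[a, b] -> {for x, continuous f}) ->
  mu.-integrable `[a, b] (EFin \o f).
Proof.
move=> cf; apply: continuous_compact_integrable; first exact: segment_compact.
by apply: continuous_in_subspaceT => x; rewrite inE => /cf.
Qed.

Lemma bounded_itv_cont a b f :
  (forall x : R, x \in `[a, b] -> {for x, continuous f}) ->
  exists2 C, 0 <= C & forall x, x \in `[a, b] -> `|f x| <= C.
Proof.
move=> cf; have [ab|ba] := leP a b; last first.
  by exists 0 => // x; rewrite in_itv/= => /andP[ax xb]; lra.
have [c cab cmax] : exists2 c, c \in `[a, b] &
    forall t, t \in `[a, b] -> `|f t| <= `|f c|.
  apply: EVT_max => //; apply: continuous_in_subspaceT => x.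
  rewrite inE => /cf cfx; apply: continuous_comp => //; exact: norm_continuous.
by exists `|f c|.
Qed.

Lemma integrable_itvW a b c d f : mu.-integrable `[a, b] (EFin \o f) ->
  a <= c -> d <= b -> mu.-integrable `[c, d] (EFin \o f).
Proof.
move=> fi ac db; apply: integrableS fi => //.
by apply: subset_itv; rewrite bnd_simp.
Qed.

Let mitv a b : measurable (`[a, b]%classic : set (measurableTypeR R)).
Proof. exact: measurable_itv. Qed.

Lemma integrable_itvZ a b c f : mu.-integrable `[a, b] (EFin \o f) ->
  mu.-integrable `[a, b] (EFin \o (fun x => c * f x)).
Proof.
move=> fi; have := integrableZl (@mitv a b) c fi.
by apply: eq_integrable => // x _ /=; rewrite EFinM.
Qed.

Lemma integrable_itvD a b f g : mu.-integrable `[a, b] (EFin \o f) ->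
  mu.-integrable `[a, b] (EFin \o g) ->
  mu.-integrable `[a, b] (EFin \o (fun x => f x + g x)).
Proof.
move=> fi gi; have := integrableD (@mitv a b) fi gi.
by apply: eq_integrable => // x _ /=; rewrite EFinD.
Qed.

Lemma integrable_itvB a b f g : mu.-integrable `[a, b] (EFin \o f) ->
  mu.-integrable `[a, b] (EFin \o g) ->
  mu.-integrable `[a, b] (EFin \o (fun x => f x - g x)).
Proof.
move=> fi gi; have := integrableB (@mitv a b) fi gi.
by apply: eq_integrable => // x _ /=; rewrite EFinB.
Qed.

Lemma integrable_itv_norm a b f : mu.-integrable `[a, b] (EFin \o f) ->
  mu.-integrable `[a, b] (EFin \o (fun x => `|f x|)).
Proof. by move=> fi; have := integrable_norm fi; exact: eq_integrable. Qed.

Lemma aeS (P Q : R -> Prop) : (forall x, P x -> Q x) ->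
  {ae mu, forall x, P x} -> {ae mu, forall x, Q x}.
Proof. by move=> PQ; apply: negligibleS => x /=; apply: contra_not => /PQ. Qed.

Lemma aeI (P Q : R -> Prop) : {ae mu, forall x, P x} ->
  {ae mu, forall x, Q x} -> {ae mu, forall x, P x /\ Q x}.
Proof.
move=> aP aQ; apply: negligibleS (negligibleU aP aQ) => x /= /not_andP.
by case; [left|right].
Qed.

End IntervalIntegral.

(** * Translation invariance and integrals over a period *)

Section Shift.
Variable R : realType.
Notation mu := (@lebesgue_measure R).
Implicit Types (f g : R -> R) (a b c : R).

(** A measure that agrees with Lebesgue measure on the half-open intervals is Lebesgue measure. *)
Lemma lebesgue_measure_shift c (A : set R) : measurable A ->
  pushforward mu ((fun x => x + c) : _ -> measurableTypeR R) A = mu A.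
Proof.
move=> mA; apply/esym.
have mc : measurable_fun setT
    ((fun x => x + c) : measurableTypeR R -> measurableTypeR R).
  exact: measurable_funD.
pose m mf : {measure set _ -> \bar R} :=
  @measure_function_pushforward__canonical__measure_function_Measure
    _ _ _ _ R mu ((fun x => x + c) : _ -> measurableTypeR R) mf.
apply: (@lebesgue_measure_unique R (m mc)) => //= _ [[a b]] _ <-.
rewrite /pushforward.
have -> : (fun x : R => x + c) @^-1` `]a, b] = `]a - c, b - c]%classic.
  by apply/seteqP; split=> x /=; rewrite !in_itv/= ltrBlDr lerBrDr.
rewrite /= !lebesgue_measure_itv/= !lte_fin ltrD2r; case: ifP => // _.
by rewrite -!EFinB opprB addrA subrK.
Qed.

Lemma int_itv_shift a b c f : measurable_fun setT f ->
  mu.-integrable `[a, b] (EFin \o (fun x => f (x + c))) ->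
  \int[mu]_(x in `[a + c, b + c]) f x = \int[mu]_(x in `[a, b]) f (x + c).
Proof.
move=> mf fi; rewrite /Rintegral; congr fine.
have abE : `[a, b]%classic =
    ((fun x => x + c) : _ -> measurableTypeR R) @^-1` `[a + c, b + c].
  by apply/seteqP; split=> x /=; rewrite !in_itv/= !lerD2r.
rewrite abE in fi *.
have mc : measurable_fun setT
    ((fun x => x + c) : measurableTypeR R -> measurableTypeR R).
  exact: measurable_funD.
have mf' : measurable_fun setT (EFin \o f : measurableTypeR R -> \bar R) by exact/measurable_EFinP.
have := integral_pushforward mc mf' fi (measurable_itv _).
move=> /= <-; apply: eq_measure_integral => //= A mA AS.
exact/esym/lebesgue_measure_shift.
Qed.

Lemma ae_shift c (P : R -> Prop) : {ae mu, forall x, P x} ->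
  {ae mu, forall x, P (x + c)}.
Proof.
move=> [A [mA A0 PA]]; exists ((fun x => x + c) @^-1` A); split.
- rewrite -[X in measurable X]setTI.
  have mc : measurable_fun [set: R] (fun x : R => x + c).
    exact: measurable_funD.
  exact: mc.
- by rewrite -A0; exact: lebesgue_measure_shift.
- by move=> x /= nPx; exact: PA.
Qed.

Lemma periodic_int f T (k : int) x : periodic f T -> f (x + T * k%:~R) = f x.
Proof.
move=> pf; have H n y : f (y + T * n%:R) = f y.
  elim: n y => [|n IH] y; first by rewrite mulr0 addr0.
  by rewrite -natr1 mulrDr mulr1 addrA pf.
case: k => n; first exact: H.
by rewrite NegzE mulrNz -(H n.+1 (x + _)) mulrN subrK.
Qed.

(** Moving the window by at most one period exchanges its initial piece for the translate of that
    piece by [T]; whole periods are removed beforehand with [Num.floor]. The bound [M] provides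
    integrability. *)
Lemma int_itv_periodic_shift f (M T c a : R) : 0 < T -> measurable_fun setT f ->
  (forall x, `|f x| <= M) -> periodic f T ->
  \int[mu]_(x in `[a, a + T]) f (x + c) = \int[mu]_(x in `[a, a + T]) f x.
Proof.
move=> T0 mf fM pf.
have mfc (d : R) : measurable_fun setT (fun x : R => f (x + d)).
  by apply: measurableT_comp => //; exact: measurable_funD.
have fi (a' b' d : R) : mu.-integrable `[a', b'] (EFin \o (fun x => f (x + d))).
  by apply: (@integrable_itv_bounded _ _ _ _ M) => // ; apply: measurable_funTS.
have fi' (a' b' : R) : mu.-integrable `[a', b'] (EFin \o f).
  by apply: (@integrable_itv_bounded _ _ _ _ M) => // ; apply: measurable_funTS.
pose J (a : R) := \int[mu]_(x in `[a, a + T]) f x.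
have Jz (d : R) (k : int) : J (d + T * k%:~R) = J d.
  rewrite /J addrAC int_itv_shift//.
  by apply: eq_Rintegral => x _; rewrite periodic_int.
have Jle (x y : R) : x <= y -> y <= x + T -> J x = J y.
  move=> xy yxT; rewrite /J (int_itv_split xy yxT)//.
  rewrite (@int_itv_split _ y (x + T) (y + T))// ?lerD2r// addrC; congr (_ + _).
  rewrite int_itv_shift//.
  by apply: eq_Rintegral => t _; rewrite pf.
rewrite -int_itv_shift// addrAC.
pose k := Num.floor (c / T).
have k1 : k%:~R * T <= c by rewrite -ler_pdivlMr// floor_le.
have k2 : c <= k%:~R * T + T.
  by rewrite -[X in _ + X]mul1r -mulrDl -ler_pdivrMr// -[1]/(1%:~R) -intrD ltW// floorD1_gt.
rewrite -/(J (a + c)) -/(J a) -(Jz a k); apply/esym/Jle.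
  by rewrite lerD2l mulrC.
by rewrite -addrA lerD2l mulrC.
Qed.

End Shift.

(** * Dominated convergence on intervals *)

Section DCT.
Variable R : realType.
Notation mu := (@lebesgue_measure R).

Lemma int_itv_dominated_cvg (a b : R) (f_ : nat -> R -> R) (f g : R -> R) :
  (forall n, measurable_fun `[a, b] (f_ n)) -> measurable_fun `[a, b] f ->
  {ae mu, forall x : R, x \in `[a, b] -> f_ n x @[n --> \oo] --> f x} ->
  mu.-integrable `[a, b] (EFin \o g) ->
  (forall n x, x \in `[a, b] -> `|f_ n x| <= g x) ->
  \int[mu]_(x in `[a, b]) f_ n x @[n --> \oo] --> \int[mu]_(x in `[a, b]) f x.
Proof.
move=> mf_ mf ff ig fg.
have [||||||fi _ H] := @dominated_convergence _ _ R mu `[a, b]%classic _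
  (fun n => EFin \o f_ n) (EFin \o f) (EFin \o g).
- by [].
- by move=> n; apply/measurable_EFinP; exact: mf_.
- by apply/measurable_EFinP; exact: mf.
- apply: aeS ff => x ffx abx; apply: cvg_EFin; last exact: ffx.
  by near=> n.
- exact: ig.
- by apply: aeW => x n abx /=; rewrite lee_fin fg.
- apply: (@fine_cvg _ _ _ _ (fun n => \int[mu]_(x in `[a, b]) (f_ n x)%:E)%E).
  rewrite /Rintegral fineK//; exact: integrable_fin_num.
Unshelve. all: by end_near. Qed.

End DCT.

(** * Integration by parts for Riemann-Stieltjes integrals *)

Section Envelope.
Variable R : realType.
Variables (Phi : R -> R) (M : R).
Hypothesis PhiM : forall x, `|Phi x| <= M.

Definition ball_sup (F : R -> R) (d s : R) : R := sup [set F y | y in ball s d].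
(** The second term is minus the infimum of [Phi] over the ball. *)
Definition ball_osc d s := ball_sup Phi d s + ball_sup (\- Phi) d s.

(* the upper semicontinuous envelope of Phi; Phi itself need not be Borel
   measurable *)
Definition envelope (s : R) : R :=
  inf [set ball_sup Phi n.+1%:R^-1 s | n in [set: nat]].

Lemma ball_sup_ge (F : R -> R) d s y : (forall x, `|F x| <= M) -> `|y - s| < d ->
  F y <= ball_sup F d s.
Proof.
move=> FM yd; apply: ub_le_sup.
  by exists M => _ [z _ <-]; exact: le_trans (ler_norm _) (FM z).
by exists y => //; rewrite /ball/= distrC.
Qed.

Lemma ball_sup_le (F : R -> R) d s c : 0 < d ->
  (forall y, `|y - s| < d -> F y <= c) -> ball_sup F d s <= c.
Proof.
move=> d0 Fc; apply: ge_sup.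
  by exists (F s), s => //; exact: ballxx.
by move=> _ [y sy <-]; apply: Fc; rewrite distrC.
Qed.

(** Whatever [F] is, a point where [F] exceeds c lies in the ball around every nearby centre, so the
    supremum over an open ball is lower semicontinuous. *)
Lemma measurable_ball_sup (F : R -> R) d : 0 < d -> (forall x, `|F x| <= M) ->
  measurable_fun setT (ball_sup F d).
Proof.
move=> d0 FM; apply/measurable_EFinP; apply: lower_semicontinuous_measurable => s c /=.
rewrite lte_fin => cs.
have [_ [y sy <-] cFy] : exists2 z, [set F y | y in ball s d] z & c < z.
  by apply: sup_gt cs; exists (F s), s => //; exact: ballxx.
exists (ball y d).
  by apply: open_nbhs_nbhs; split; [exact: ball_open|exact: ball_sym].
move=> t /= yt; rewrite lte_fin (lt_le_trans cFy)// ball_sup_ge//.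
Qed.

Lemma ball_supS (F : R -> R) d d' s : (forall x, `|F x| <= M) ->
  0 < d -> d <= d' -> ball_sup F d s <= ball_sup F d' s.
Proof.
move=> FM d0 dd'; apply: ball_sup_le => // y yd; apply: ball_sup_ge => //.
exact: lt_le_trans dd'.
Qed.

Let PhiNM x : `|(\- Phi) x| <= M. Proof. by rewrite normrN. Qed.

Lemma ball_osc_ge0 d s : 0 < d -> 0 <= ball_osc d s.
Proof.
move=> d0; rewrite -(subrr (Phi s)); apply: lerD.
  by apply: ball_sup_ge => //; rewrite subrr normr0.
by apply: (@ball_sup_ge (\- Phi)) => //; rewrite subrr normr0.
Qed.

Lemma ball_osc_le d s : 0 < d -> ball_osc d s <= 2 * M.
Proof.
move=> d0; rewrite mulr_natl mulr2n; apply: lerD.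
  by apply: ball_sup_le => // y _; exact: le_trans (ler_norm _) (PhiM y).
by apply: ball_sup_le => // y _; exact: le_trans (ler_norm _) (PhiNM y).
Qed.

Lemma measurable_ball_osc d : 0 < d -> measurable_fun setT (ball_osc d).
Proof. by move=> d0; apply: measurable_funD; apply: measurable_ball_sup. Qed.

Let lbound_ball_sup s :
  has_lbound [set ball_sup Phi n.+1%:R^-1 s | n in [set: nat]].
Proof.
exists (Phi s) => _ [n _ <-]; apply: ball_sup_ge => //.
by rewrite subrr normr0 invr_gt0.
Qed.

Lemma measurable_envelope : measurable_fun setT envelope.
Proof.
have -> : envelope = (fun s => infs (fun n => ball_sup Phi n.+1%:R^-1 s) 0).
  apply/funext => s; rewrite /envelope /infs; congr inf.
  by apply/seteqP; split=> [_ [n _ <-]|_ [n _ <-]]; exists n.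
apply: (@measurable_fun_infs _ _ _ _ (fun n => ball_sup Phi n.+1%:R^-1)).
  by move=> t _; exact: lbound_ball_sup.
by move=> n; apply: measurable_ball_sup => //; rewrite invr_gt0.
Qed.

Lemma ball_sup_ge_envelope d s : 0 < d -> envelope s <= ball_sup Phi d s.
Proof.
move=> d0; pose n := Num.truncn d^-1.
apply: (@le_trans _ _ (ball_sup Phi n.+1%:R^-1 s)).
  by apply: ge_inf; [exact: lbound_ball_sup|exists n].
apply: ball_supS => //; rewrite ?invr_gt0//.
rewrite -[leRHS]invrK lef_pV2 ?posrE ?invr_gt0 ?ltr0n//.
by apply/ltW/truncnS_gt.
Qed.

Lemma envelope_ge s : Phi s <= envelope s.
Proof.
apply: lb_le_inf; first by exists (ball_sup Phi 1%:R^-1 s), 0%N.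
by move=> _ [n _ <-]; apply: ball_sup_ge => //; rewrite subrr normr0 invr_gt0.
Qed.

(** Both values lie between the infimum and the supremum of [Phi] over the ball. *)
Lemma envelope_sub_le d s y : `|y - s| < d ->
  `|envelope s - Phi y| <= ball_osc d s.
Proof.
move=> yd; have d0 : 0 < d by exact: le_lt_trans yd.
have h1 := ball_sup_ge PhiM yd.
have h2 := ball_sup_ge PhiNM yd.
have h3 := ball_sup_ge_envelope s d0.
have h4 : Phi s <= envelope s by exact: envelope_ge.
have h5 : (\- Phi) s <= ball_sup (\- Phi) d s.
  by apply: ball_sup_ge => //; rewrite subrr normr0.
rewrite /ball_osc ler_norml /= in h1 h2 h3 h4 h5 *; lra.
Qed.

Lemma ball_osc_cvg0 s : {for s, continuous Phi} ->
  ball_osc n.+1%:R^-1 s @[n --> \oo] --> 0.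
Proof.
move=> cs; apply/cvgrPdist_le => e e0.
have /cvgrPdist_lt /(_ (e / 2)) := cs.
rewrite divr_gt0// => /(_ isT) /nbhs_ballP[d /= d0 sd].
near=> n.
have n0 : 0 < n.+1%:R^-1 :> R by rewrite invr_gt0.
have nd : n.+1%:R^-1 <= d.
  by near: n; have := near_infty_natSinv_lt (PosNum d0); apply: filterS => k /= /ltW.
rewrite sub0r normrN ger0_norm ?ball_osc_ge0//.
have -> : e = (Phi s + e / 2) + (- Phi s + e / 2) by lra.
apply: lerD; apply: ball_sup_le => // y yn /=.
  have /sd : ball s d y by rewrite /ball/= distrC (lt_le_trans yn).
  by rewrite ltr_norml => /andP[+ _]; lra.
have /sd : ball s d y by rewrite /ball/= distrC (lt_le_trans yn).
by rewrite ltr_norml => /andP[_]; lra.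
Unshelve. all: by end_near. Qed.

Lemma envelope_le s : `|envelope s| <= M.
Proof.
rewrite ler_norml; apply/andP; split.
  by apply: le_trans (envelope_ge s); move: (PhiM s); rewrite ler_norml => /andP[].
apply: (le_trans (ball_sup_ge_envelope s ltr01)); apply: ball_sup_le => // y _.
exact: le_trans (ler_norm _) (PhiM y).
Qed.

End Envelope.

(** * Stieltjes integrals of C^1 functions against an almost everywhere continuous function *)

Section RSParts.
Variable R : realType.
Notation mu := (@lebesgue_measure R).
Variables (Phi : R -> R) (M : R).
Hypothesis PhiM : forall x, `|Phi x| <= M.
Hypothesis Phi_cont : {ae mu, forall t, {for t, continuous Phi}}.

Lemma integrable_ball_osc d a b : 0 < d ->
  mu.-integrable `[a, b] (EFin \o ball_osc Phi d).
Proof.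
move=> d0; apply: (@integrable_itv_bounded _ _ _ _ (2 * M)).
  apply: measurable_funTS; exact: (measurable_ball_osc PhiM).
by move=> x _; rewrite ger0_norm ?(ball_osc_ge0 PhiM)// (ball_osc_le PhiM).
Qed.

(** Almost everywhere continuity enters the Riemann-Stieltjes theory here: the oscillations at radii
    1 / (n + 1) tend to 0 almost everywhere and are dominated by [2 * M]. *)
Lemma int_ball_osc_lt a b e : 0 < e ->
  exists2 d, 0 < d & \int[mu]_(s in `[a, b]) ball_osc Phi d s < e.
Proof.
move=> e0.
have i0 n : 0 < n.+1%:R^-1 :> R by rewrite invr_gt0.
have : \int[mu]_(s in `[a, b]) ball_osc Phi n.+1%:R^-1 s @[n --> \oo] -->
    \int[mu]_(s in `[a, b]) (fun _ : R => 0) s.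
  apply: (@int_itv_dominated_cvg _ _ _ _ _ (fun=> 2 * M)).
  - by move=> n; apply: measurable_funTS; exact: (measurable_ball_osc PhiM).
  - exact: measurable_cst.
  - by apply: aeS Phi_cont => x cx _; exact: (ball_osc_cvg0 PhiM).
  - by apply: (@integrable_itv_bounded _ _ _ _ `|2 * M|).
  - move=> n x _; rewrite ger0_norm ?(ball_osc_ge0 PhiM)//.
    exact: (ball_osc_le PhiM).
rewrite Rintegral_cst// mul0r => /cvgrPdist_lt /(_ e e0) [N _ /(_ N (leqnn N))].
rewrite sub0r normrN => H; exists N.+1%:R^-1 => //.
exact: le_lt_trans (ler_norm _) H.
Qed.

Let f := envelope Phi.

Section Parts.
Variables (a b : R) (g g' : R -> R).
Hypothesis dg : forall x : R, x \in `[a, b] -> is_derive x (1 : R) g (g' x).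
Hypothesis cg' : forall x : R, x \in `[a, b] -> {for x, continuous g'}.

Lemma integrable_envelopeM : mu.-integrable `[a, b] (EFin \o (fun s => f s * g' s)).
Proof.
have ig := integrable_itv_cont cg'.
have mg' : measurable_fun `[a, b] g'.
  by have /integrableP[/measurable_EFinP] := ig.
have [C C0 gC] := bounded_itv_cont cg'.
apply: (@integrable_itv_bounded _ _ _ _ (M * C)).
  apply: measurable_funM => //.
  apply: measurable_funTS; exact: (measurable_envelope PhiM).
by move=> x xab; rewrite normrM ler_pM// ?gC// (envelope_le PhiM).
Qed.

(** The tag cuts the cell in two. After summation by parts, [f] is compared with [Phi x] to the left
    of the tag and with [Phi y] to its right, and both comparisons are within the oscillation at
    scale [d]. *)
Lemma RS_cell d C x tau y : 0 <= C ->
  (forall x, x \in `[a, b] -> `|g' x| <= C) ->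
  a <= x -> y <= b -> x <= tau <= y -> `|y - x| < d ->
  `|g tau * (Phi y - Phi x) - (g y * Phi y - g x * Phi x -
      \int[mu]_(s in `[x, y]) (f s * g' s))|
    <= C * \int[mu]_(s in `[x, y]) ball_osc Phi d s.
Proof.
move=> C0 gC ax yb /andP[xt ty] yx.
have d0 : 0 < d by exact: le_lt_trans yx.
have half u v z : a <= u -> u <= v -> v <= b ->
    (forall s, s \in `[u, v] -> `|z - s| < d) ->
    `|\int[mu]_(s in `[u, v]) (f s * g' s) - Phi z * (g v - g u)|
    <= C * \int[mu]_(s in `[u, v]) ball_osc Phi d s.
  move=> au uv vb zd.
  have sub s : s \in `[u, v] -> s \in `[a, b].
    by rewrite !in_itv/= => /andP[us sv]; rewrite (le_trans au us) (le_trans sv vb).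
  have ifg : mu.-integrable `[u, v] (EFin \o (fun s => f s * g' s)).
    exact: integrable_itvW integrable_envelopeM au vb.
  have ig : mu.-integrable `[u, v] (EFin \o g').
    by apply: integrable_itv_cont => s /sub/cg'.
  rewrite -(int_itv_deriv uv (fun s suv => dg (sub s suv))
                             (fun s suv => cg' (sub s suv))).
  rewrite -RintegralZl// -RintegralB//; last first.
    exact: integrable_itvZ.
  rewrite -RintegralZl//; last exact: integrable_ball_osc.
  apply: le_int_itv.
  - by apply: integrable_itvB => //; exact: integrable_itvZ.
  - by apply: integrable_itvZ; exact: integrable_ball_osc.
  - move=> s suv; rewrite -mulrBl normrM mulrC ler_pM//.
      exact/gC/sub.
    by apply: (envelope_sub_le PhiM); exact: zd.
have := half x tau x ax xt (le_trans ty yb).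
have := half tau y y (le_trans ax xt) ty yb.
have -> : \int[mu]_(s in `[x, y]) (f s * g' s) =
    \int[mu]_(s in `[x, tau]) (f s * g' s) + \int[mu]_(s in `[tau, y]) (f s * g' s).
  by apply: int_itv_split => //; exact: integrable_itvW integrable_envelopeM ax yb.
have -> : \int[mu]_(s in `[x, y]) ball_osc Phi d s =
    \int[mu]_(s in `[x, tau]) ball_osc Phi d s + \int[mu]_(s in `[tau, y]) ball_osc Phi d s.
  by apply: int_itv_split => //; exact: integrable_ball_osc.
move=> h1 h2; rewrite [leRHS]mulrDr.
set A := \int[mu]_(s in `[x, tau]) (f s * g' s) in h1 h2 *.
set B := \int[mu]_(s in `[tau, y]) (f s * g' s) in h1 h2 *.
have -> : g tau * (Phi y - Phi x) - (g y * Phi y - g x * Phi x - (A + B)) =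
    (A - Phi x * (g tau - g x)) + (B - Phi y * (g y - g tau)) by ring.
apply: (le_trans (ler_normD _ _)); apply: lerD.
  apply: h2 => s; rewrite in_itv/= => /andP[xs st].
  rewrite distrC ger0_norm ?subr_ge0//; apply: le_lt_trans yx.
  by rewrite ger0_norm; lra.
apply: h1 => s; rewrite in_itv/= => /andP[ts sy].
rewrite ger0_norm ?subr_ge0//; apply: le_lt_trans yx.
by rewrite ger0_norm; lra.
Qed.

Lemma is_RS_integral_parts : a <= b ->
  is_RS_integral g Phi a b
    (g b * Phi b - g a * Phi a - \int[mu]_(s in `[a, b]) (f s * g' s)).
Proof.
move=> ab e e0.
have [C C0 gC] := bounded_itv_cont cg'.
(* Dividing by [C + 1] allows [C = 0]. *)
have [d d0 hd] := @int_ball_osc_lt a b (e / (C + 1)) ltac:(by rewrite divr_gt0// ltr_wpDl).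
exists d => // p t tau [t0 tp tt] td.
have tS k : (k < p)%N -> t k <= t k.+1.
  by move=> /tt/andP[]; exact: le_trans.
have ta k : (k <= p)%N -> a <= t k.
  elim: k => [|k IH] kp; first by rewrite t0.
  by rewrite (le_trans (IH (ltnW kp)))// tS.
have tb k : (k <= p)%N -> t k <= b.
  move=> kp; rewrite -(subKn kp); elim: (p - k)%N => [|m IH].
    by rewrite subn0 tp.
  have [pm|mp] := leqP p m.
    by move: IH; rewrite (eqP (pm : p - m == 0)%N) (eqP (leqW pm : p - m.+1 == 0)%N).
  apply: le_trans IH; rewrite -(subnSK mp); apply: tS.
  by rewrite subnSK// leq_subr.
(* The error over the first j cells is bounded by the integral of the oscillation over the same
   cells, so the cell errors add up without any count of the cells. *)
have main j : (j <= p)%N ->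
  `|RS_sum g Phi j t tau - (g (t j) * Phi (t j) - g a * Phi a -
     \int[mu]_(s in `[a, t j]) (f s * g' s))|
  <= C * \int[mu]_(s in `[a, t j]) ball_osc Phi d s.
  elim: j => [|j IH] jp.
    by rewrite t0 !int_itvxx /RS_sum big_ord0 subrr !subr0 normr0 mulr0.
  have := IH (ltnW jp).
  have := RS_cell C0 gC (ta _ (ltnW jp)) (tb _ jp) (tt _ jp) (td _ jp).
  rewrite /RS_sum big_ord_recr/=.
  rewrite (@int_itv_split _ a (t j) (t j.+1)) ?ta ?tS//; last 2 first.
  - exact: ltnW.
  - exact: integrable_itvW integrable_envelopeM (lexx _) (tb _ jp).
  rewrite (@int_itv_split _ a (t j) (t j.+1)) ?ta ?tS//; last 2 first.
  - exact: ltnW.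
  - exact: integrable_ball_osc.
  set A := \int[mu]_(s in `[a, t j]) (f s * g' s).
  set B := \int[mu]_(s in `[t j, t j.+1]) (f s * g' s).
  move: (\sum_(_ < _) _) => S h1 h2.
  have -> : S + g (tau j) * (Phi (t j.+1) - Phi (t j)) -
      (g (t j.+1) * Phi (t j.+1) - g a * Phi a - (A + B)) =
    (S - (g (t j) * Phi (t j) - g a * Phi a - A)) +
    (g (tau j) * (Phi (t j.+1) - Phi (t j)) -
      (g (t j.+1) * Phi (t j.+1) - g (t j) * Phi (t j) - B)) by ring.
  by rewrite [leRHS]mulrDr (le_trans (ler_normD _ _))// lerD.
have := main p (leqnn p); rewrite tp => /le_lt_trans; apply.
apply: (@le_lt_trans _ _ ((C + 1) * \int[mu]_(s in `[a, b]) ball_osc Phi d s)).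
  apply: ler_wpM2r; last lra.
  by apply: Rintegral_ge0 => s _; exact: (ball_osc_ge0 PhiM).
by rewrite mulrC -ltr_pdivlMr// ltr_wpDl.
Qed.

End Parts.
End RSParts.

(** * Uniqueness of the Riemann-Stieltjes integral *)

Section RSUnique.
Variable R : realType.
Implicit Types (a b I J : R) (g f : R -> R).

(** Two candidates can be compared as soon as one tagged partition of small mesh exists; the uniform
    one is built here, with its nodes as tags. *)
Lemma RS_integral_unique g f a b I J : a <= b ->
  is_RS_integral g f a b I -> is_RS_integral g f a b J -> I = J.
Proof.
move=> ab hI hJ; apply/eqP; rewrite -subr_eq0 -normr_eq0.
apply/eqP/le_anti; rewrite normr_ge0 andbT.
apply/ler_addgt0Pl => e e0; rewrite addr0.
have [d1 d10 h1] := hI (e / 2) ltac:(by rewrite divr_gt0).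
have [d2 d20 h2] := hJ (e / 2) ltac:(by rewrite divr_gt0).
pose d := Num.min d1 d2; have d0 : 0 < d by rewrite lt_min d10.
pose p := (Num.truncn ((b - a) / d)).+1.
pose t (k : nat) : R := a + (b - a) * k%:R / p%:R.
have p0 : 0 < p%:R :> R by rewrite ltr0n.
have dt k : t k.+1 - t k = (b - a) / p%:R.
  have H (q m : R) : q != 0 ->
    a + (b - a) * (m + 1) / q - (a + (b - a) * m / q) = (b - a) / q by move=> *; field.
  by rewrite /t -[k.+1%:R]natr1 H// lt0r_neq0.
have dtd k : `|t k.+1 - t k| < d.
  rewrite dt ger0_norm; last by rewrite divr_ge0// subr_ge0.
  by rewrite ltr_pdivrMr// mulrC -ltr_pdivrMr// truncnS_gt.
have tp : tagged_partition a b p t t.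
  split; first by rewrite /t mulr0 mul0r addr0.
    by rewrite /t mulfK ?lt0r_neq0// addrC subrK.
  move=> k kp; rewrite lexx/= -subr_ge0 dt divr_ge0//; by rewrite subr_ge0.
have dd1 : d <= d1 by rewrite ge_min lexx.
have dd2 : d <= d2 by rewrite ge_min lexx orbT.
have H1 := h1 p t t tp (fun k _ => lt_le_trans (dtd k) dd1).
have H2 := h2 p t t tp (fun k _ => lt_le_trans (dtd k) dd2).
move: H1 H2; rewrite !ltr_norml => /andP[? ?] /andP[? ?].
by rewrite ler_norml; apply/andP; split; lra.
Qed.

Lemma RS_integralE g f a b I : a <= b -> is_RS_integral g f a b I ->
  RS_integral g f a b = I.
Proof.
move=> ab hI; apply: (RS_integral_unique ab _ hI).
by rewrite /RS_integral; apply: getPex; exists I.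
Qed.

End RSUnique.

(** * First-order expansions and their transfer to the envelope *)

Section Slope.
Variable R : realType.
Implicit Types (F : R -> R) (x A : R).

(** Differentiability without a quotient: u = 0 needs no exception, and the inequality survives
    suprema over small balls. *)
Definition has_slope F x A := forall e, 0 < e ->
  exists2 d, 0 < d & forall u, `|u| < d -> `|F (x + u) - F x - A * u| <= e * `|u|.

Lemma is_derive_has_slope F x A : is_derive x (1 : R) F A -> has_slope F x A.
Proof.
move=> [/cvg_ex[/= B FB]]; rewrite /derive (cvg_lim _ FB)// => BA e e0.
rewrite {}BA in FB; move: FB => FA.
move/cvgrPdist_le : FA => /(_ e e0) [d /= d0 H]; exists d => // u ud.
have [->|u0] := eqVneq u 0; first by rewrite addr0 mulr0 !subrr normr0 mulr0.
have := H u; rewrite /= sub0r normrN => /(_ ud u0).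
have -> : F (x + u) - F x - A * u = - (u * (A - u^-1 * (F (u + x) - F x))).
  by rewrite mulrBr mulrA divff// mul1r [u + x]addrC; ring.
rewrite normrN normrM [e * _]mulrC /GRing.scale/= mulr1 => h.
by rewrite ler_wpM2l.
Qed.

Lemma derivable_has_slope F x : derivable F x 1 -> exists A, has_slope F x A.
Proof. by move=> dF; eexists; apply: is_derive_has_slope; exact: DeriveDef. Qed.

Lemma has_slope_continuous F x A : has_slope F x A -> {for x, continuous F}.
Proof.
move=> FA; apply/cvgrPdist_le => e e0.
have [d d0 H] := FA 1 ltr01.
have A1 : 0 < `|A| + 1 by rewrite ltr_wpDl.
near=> y.
have yd : `|y - x| < Num.min d (e / (`|A| + 1)).
  rewrite distrC; near: y; apply/nbhs_ballP.
  exists (Num.min d (e / (`|A| + 1))); last by [].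
  by rewrite /= lt_min d0 divr_gt0.
move: yd; rewrite lt_min => /andP[/H].
rewrite [x + _]addrC subrK mul1r ltr_pdivlMr// => h1 h2.
rewrite distrC; have -> : F y - F x = (F y - F x - A * (y - x)) + A * (y - x) by ring.
rewrite (le_trans (ler_normD _ _))// normrM.
by rewrite (le_trans (lerD h1 (lexx _)))// addrC -[X in _ + X]mul1r -mulrDl mulrC ltW.
Unshelve. all: by end_near. Qed.

Lemma envelope_eq (Phi : R -> R) M x : (forall x, `|Phi x| <= M) ->
  {for x, continuous Phi} -> envelope Phi x = Phi x.
Proof.
move=> PhiM cx; apply/eqP; rewrite -subr_eq0 -normr_eq0 eq_le normr_ge0 andbT.
apply/ler_addgt0Pl => z z0; rewrite addr0.
have /cvgrPdist_lt /(_ z z0)[n _ /(_ n (leqnn n))] := ball_osc_cvg0 PhiM cx.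
rewrite sub0r normrN => /ltW; apply: le_trans; apply: le_trans (ler_norm _).
by apply: (envelope_sub_le PhiM); rewrite subrr normr0 invr_gt0.
Qed.

(** The expansion of [Phi] at [x] bounds [Phi] at all points y close to x + u, even if [Phi] is
    discontinuous at x + u. So it bounds the supremum over a small ball around x + u, hence the
    envelope. *)
Lemma envelope_has_slope (Phi : R -> R) M x A : (forall x, `|Phi x| <= M) ->
  has_slope Phi x A -> has_slope (envelope Phi) x A.
Proof.
move=> PhiM PhiA e e0; have [d d0 H] := PhiA e e0.
exists d => // u ud; rewrite (envelope_eq PhiM (has_slope_continuous PhiA)).
have l1 := envelope_ge PhiM (x + u).
have := H u ud; rewrite !ler_norml => /andP[l2 l3]; apply/andP; split; first lra.
rewrite -subr_le0; apply/ler_addgt0Pl => z z0; rewrite addr0.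
(* The first term keeps the ball inside the range of the expansion; the second makes the extra
   error, c * (|A| + e), at most z. *)
pose c := Num.min (d - `|u|) (z / (`|A| + e)).
have Ae : 0 < `|A| + e by rewrite ltr_wpDl.
have c0 : 0 < c by rewrite lt_min subr_gt0 ud divr_gt0.
have cz : c * (`|A| + e) <= z by rewrite -ler_pdivlMr// ge_min lexx orbT.
have cd : c <= d - `|u| by rewrite ge_min lexx.
suff : envelope Phi (x + u) <= Phi x + A * u + e * `|u| + z by lra.
apply: (le_trans (ball_sup_ge_envelope PhiM _ c0)); apply: ball_sup_le => // y yc.
pose v := y - x.
have vu : `|v - u| < c by rewrite /v -addrA -opprD.
have vu' : `|v| <= `|u| + c.
  by rewrite -[v](subrK u) (le_trans (ler_normD _ _))// addrC lerD2l ltW.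
have := H v; rewrite /v (addrC x) subrK -/v => /(_ _)/(le_trans (ler_norm _)) h.
have vd : `|v| < d.
  rewrite -[v](subrK u) (le_lt_trans (ler_normD _ _))//.
  by rewrite addrC -ltrBrDl (lt_le_trans vu).
have {}h := h vd.
have Av : A * (v - u) <= `|A| * c.
  by rewrite (le_trans (ler_norm _))// normrM ler_wpM2l// ltW.
have ev : e * `|v| <= e * (`|u| + c) by rewrite ler_pM2l.
lra.
Qed.

Lemma periodic_envelope (Phi : R -> R) T : periodic Phi T -> periodic (envelope Phi) T.
Proof.
move=> pT s; rewrite /envelope; congr inf.
suff H d : ball_sup Phi d (s + T) = ball_sup Phi d s.
  by apply/seteqP; split=> _ [n _ <-]; exists n.
rewrite /ball_sup; congr sup; apply/seteqP; split=> _ [y /= sy <-].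
  exists (y - T); last by rewrite -pT subrK.
  by move: sy; rewrite /ball/= opprB addrA.
by exists (y + T) => //; move: sy; rewrite /ball/= opprD addrACA subrr addr0.
Qed.

End Slope.

(** * The conjugate Poisson kernel *)

Section Trig.
Variable R : realType.
Implicit Types (x y u v : R).

Lemma norm_sin_le x : `|sin x| <= `|x|.
Proof.
suff H y : 0 <= y -> `|sin y| <= y.
  have [x0|x0] := leP 0 x; first by rewrite (ger0_norm x0) H.
  by rewrite (ltr0_norm x0) -(normrN (sin x)) -sinN H// oppr_ge0 ltW.
rewrite le_eqVlt => /predU1P[<-|y0]; first by rewrite sin0 normr0.
have [c _] := MVT y0 (fun x _ => is_derive_sin x)
  (continuous_subspaceT (@continuous_sin R)).
rewrite sin0 !subr0 => ->; rewrite normrM (ger0_norm (ltW y0)).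
by rewrite ler_piMl ?(ltW y0)// cos_max.
Qed.

Lemma cos_subE u v : cos u - cos v = - (2 * sin ((u + v) / 2) * sin ((u - v) / 2)).
Proof.
have H a b : cos (a + b) - cos (a - b) = - (2 * sin a * sin b) :> R.
  by rewrite cosB cosD; ring.
by rewrite -H; congr (cos _ - cos _); lra.
Qed.

Lemma norm_cos_sub_le u v : 2 * `|cos u - cos v| <= `|u + v| * `|u - v|.
Proof.
rewrite cos_subE normrN !normrM ger0_norm//.
have := norm_sin_le ((u + v) / 2); have := norm_sin_le ((u - v) / 2).
rewrite !normrM ![`|2^-1|]ger0_norm ?invr_ge0// => h1 h2.
have := ler_pM (normr_ge0 _) (normr_ge0 _) h2 h1; lra.
Qed.

(** The bound must reach every b < pi, beyond the range of Jordan's inequality. Up to pi / 4 it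
    comes from the mean value theorem, and afterwards from the positive minimum of sin, divided by
    pi since x < pi. *)
Lemma sin_ge_linear (b : R) : 0 < b < pi ->
  exists2 c : R, 0 < c <= 1 & forall x, 0 <= x <= b -> c * x <= sin x.
Proof.
move=> /andP[b0 bpi].
have pi0 := pi_gt0 R.
pose q : R := pi / 4.
have q0 : 0 < q by rewrite divr_gt0.
have cq0 : 0 < cos q by apply: cos_gt0_pihalf; rewrite /q; lra.
have near0 x : 0 <= x <= q -> cos q * x <= sin x.
  move=> /andP[]; rewrite le_eqVlt => /predU1P[<- _|x0 xq].
    by rewrite sin0 mulr0.
  have [c cx] := MVT x0 (fun x _ => is_derive_sin x)
    (continuous_subspaceT (@continuous_sin R)).
  rewrite sin0 !subr0 => ->; rewrite ler_pM2r//.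
  move: cx; rewrite in_itv/= => /andP[c0 cx].
  have cq : c <= q by rewrite (le_trans (ltW cx)).
  rewrite leNgt ltr_cos ?in_itv/=; first by rewrite -leNgt.
    by apply/andP; split; rewrite /q in cq q0 *; lra.
  by apply/andP; split; rewrite /q in cq q0 *; lra.
have [bq|qb] := leP b q.
  exists (cos q); first by rewrite cq0 cos_le1.
  by move=> x /andP[x0 xb]; apply: near0; rewrite x0 (le_trans xb).
have [c cqb cmin] := EVT_min (ltW qb) (continuous_subspaceT (@continuous_sin R)).
have sc0 : 0 < sin c.
  apply: sin_gt0_pi; move: cqb; rewrite in_itv/= => /andP[? ?].
  by apply/andP; split; lra.
exists (Num.min (cos q) (sin c / pi)).
  by rewrite lt_min cq0 divr_gt0//= ge_min cos_le1.
move=> x /andP[x0 xb]; have [xq|qx] := leP x q.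
  by apply: le_trans (near0 x _); rewrite ?x0// ler_wpM2r// ge_min lexx.
apply: (@le_trans _ _ (sin c)); last by apply: cmin; rewrite in_itv/= xb ltW.
apply: (@le_trans _ _ (sin c / pi * x)).
  by rewrite ler_wpM2r// ge_min lexx orbT.
by rewrite -mulrA ler_piMr ?(ltW sc0)// mulrC ler_pdivrMr// mul1r (le_trans xb)// ltW.
Qed.

(* the squared chord length |1 - e^(iu)|^2 *)
Definition chord2 u : R := 2 * (1 - cos u).

Lemma chord2E u : chord2 u = 4 * sin (u / 2) ^+ 2.
Proof.
rewrite /chord2 -[in cos u](_ : u / 2 *+ 2 = u) ?cos_mulr2n; last by rewrite -mulr_natr; lra.
rewrite sin2cos2 !mulr2n; ring.
Qed.

Lemma chord2_ge0 u : 0 <= chord2 u.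
Proof. by rewrite chord2E mulr_ge0// sqr_ge0. Qed.

Lemma chord2_le4 u : chord2 u <= 4.
Proof. by rewrite /chord2; have := cos_geN1 u; lra. Qed.

(** Any b < 2 pi is allowed because the difference of two points of a period can exceed pi. *)
Lemma chord2_ge (b : R) : 0 < b < 2 * pi -> exists2 k : R, 0 < k <= 1 &
  forall u, `|u| <= b -> k * u ^+ 2 <= chord2 u.
Proof.
move=> /andP[b0 bpi].
have [c /andP[c0 c1] H] := @sin_ge_linear (b / 2) ltac:(by apply/andP; split; lra).
exists (c ^+ 2); first by rewrite exprn_gt0//= exprn_ile1// ltW.
move=> u ub; rewrite chord2E.
have -> : sin (u / 2) ^+ 2 = sin (`|u| / 2) ^+ 2.
  have [u0|u0] := leP 0 u; first by rewrite ger0_norm.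
  by rewrite ltr0_norm// mulNr sinN sqrrN.
have := H (`|u| / 2) ltac:(apply/andP; split; [by rewrite divr_ge0| lra]).
move=> h; have h0 : 0 <= c * (`|u| / 2) by rewrite mulr_ge0 ?divr_ge0// ltW.
have := ler_pM h0 h0 h h; rewrite -[sin _ * _]expr2.
have -> : c ^+ 2 * u ^+ 2 = 4 * (c * (`|u| / 2) * (c * (`|u| / 2))).
  have -> : u ^+ 2 = `|u| ^+ 2 by rewrite real_normK ?num_real.
  by move: (`|u|) => w; field.
by move=> hh; rewrite ler_pM2l.
Qed.

Lemma chord2D2pi u : chord2 (u + 2 * pi) = chord2 u.
Proof. by rewrite /chord2 [2 * pi]mulr_natl cosD2pi. Qed.

End Trig.

(** * The kernels and their pointwise bounds *)

Section Kernels.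
Variable R : realType.
Implicit Types (r s u v phi : R).

Definition dconj_poisson r u : R :=
  2 * r * ((1 + r ^+ 2) * cos u - 2 * r) / (1 - 2 * r * cos u + r ^+ 2) ^+ 2.

(* the derivative of the Poisson kernel (1 - r^2) / (1 - 2 r cos u + r^2) *)
Definition dpoisson r u : R :=
  - (2 * r * (1 - r ^+ 2) * sin u) / (1 - 2 * r * cos u + r ^+ 2) ^+ 2.

(* the opposite of the limit of [dconj_poisson r] as r tends to 1 *)
Definition dcot u : R := 2 / chord2 u.

Lemma poisson_denE r u :
  1 - 2 * r * cos u + r ^+ 2 = (1 - r) ^+ 2 + r * chord2 u.
Proof. rewrite /chord2; ring. Qed.

Lemma poisson_den_gt0 r u : 0 <= r < 1 -> 0 < 1 - 2 * r * cos u + r ^+ 2.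
Proof.
move=> /andP[r0 r1]; rewrite poisson_denE.
by rewrite ltr_wpDr ?mulr_ge0 ?chord2_ge0// exprn_gt0// subr_gt0.
Qed.

Lemma continuous_poisson_den r : continuous (fun u => 1 - 2 * r * cos u + r ^+ 2).
Proof.
move=> u; apply: cvgD; last exact: cvg_cst.
apply: cvgB; first exact: cvg_cst.
by apply: cvgMl_tmp; exact: continuous_cos.
Qed.

Lemma is_derive_conj_poisson r u : 0 <= r < 1 ->
  is_derive u 1 (conj_poisson_kernel r) (dconj_poisson r u).
Proof.
move=> r01; have D0 := poisson_den_gt0 u r01.
have Dn : 1 - 2 * r * cos u + r ^+ 2 != 0 by rewrite lt0r_neq0.
have dD : is_derive u 1 (fun y => 1 - 2 * r * cos y + r ^+ 2) (2 * r * sin u).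
  apply: is_derive_eq; rewrite /GRing.scale/=; ring.
have dV := @is_deriveV _ (fun y => 1 - 2 * r * cos y + r ^+ 2) u _ 1 Dn dD.
have dS : is_derive u 1 (fun y => 2 * r * sin y) (2 * r * cos u).
  apply: is_derive_eq; rewrite /GRing.scale/=; ring.
have -> : conj_poisson_kernel r = ((fun y => 2 * r * sin y) : R -> R) *
    (fun y => (1 - 2 * r * cos y + r ^+ 2)^-1) by apply/funext.
apply: (is_derive_eq (is_deriveM dS dV)).
rewrite /GRing.scale/= /dconj_poisson.
have -> : (1 + r ^+ 2) * cos u - 2 * r =
  (1 - 2 * r * cos u + r ^+ 2) * cos u - 2 * r * sin u ^+ 2.
  rewrite sin2cos2; ring.
by field.
Qed.

Lemma continuous_dconj_poisson r : 0 <= r < 1 -> continuous (dconj_poisson r).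
Proof.
move=> r01 u; have D0 := poisson_den_gt0 u r01.
apply: cvgM; first by apply: cvgMl_tmp; apply: cvgB; [apply: cvgMl_tmp; exact: continuous_cos|exact: cvg_cst].
apply: cvgV; first by rewrite expf_neq0// lt0r_neq0.
exact: (@continuous_comp _ _ _ _ (fun x : R => x ^+ 2) u
  (@continuous_poisson_den r u) (@exprn_continuous _ 2 _)).
Qed.

Lemma continuous_dpoisson r : 0 <= r < 1 -> continuous (dpoisson r).
Proof.
move=> r01 u; have D0 := poisson_den_gt0 u r01.
apply: cvgM; first by apply: cvgN; apply: cvgMl_tmp; exact: continuous_sin.
apply: cvgV; first by rewrite expf_neq0// lt0r_neq0.
exact: (@continuous_comp _ _ _ _ (fun x : R => x ^+ 2) u
  (@continuous_poisson_den r u) (@exprn_continuous _ 2 _)).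
Qed.

Lemma is_derive_hilbert_kernel tau t : sin ((tau - t) / 2) != 0 ->
  is_derive t 1 (hilbert_kernel tau) (dcot (tau - t)).
Proof.
move=> sn.
have dl : is_derive t 1 (fun y : R => (tau - y) / 2) (- 2^-1).
  apply: is_derive_eq; rewrite /GRing.scale/=; ring.
have dS : is_derive t 1 (fun y => sin ((tau - y) / 2)) (cos ((tau - t) / 2) * - 2^-1).
  exact: (@is_derive1_comp _ sin (fun y => (tau - y) / 2) t _ _ (is_derive_sin _) dl).
have dC : is_derive t 1 (fun y => cos ((tau - y) / 2)) (- sin ((tau - t) / 2) * - 2^-1).
  exact: (@is_derive1_comp _ cos (fun y => (tau - y) / 2) t _ _ (is_derive_cos _) dl).
have dV := @is_deriveV _ (fun y => sin ((tau - y) / 2)) t _ 1 sn dS.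
have -> : hilbert_kernel tau = ((fun y => cos ((tau - y) / 2)) : R -> R) *
    (fun y => (sin ((tau - y) / 2))^-1) by apply/funext.
apply: (is_derive_eq (is_deriveM dC dV)).
rewrite /GRing.scale/= /dcot chord2E.
transitivity ((sin ((tau - t) / 2) ^+ 2 + cos ((tau - t) / 2) ^+ 2) * (2 * sin ((tau - t) / 2) ^+ 2)^-1).
  by field.
by rewrite [X in X * _]addrC cos2Dsin2; field.
Qed.

Lemma measurable_chord2 : measurable_fun setT (@chord2 R).
Proof.
apply: continuous_measurable_fun => u.
by apply: cvgMl_tmp; apply: cvgB; [exact: cvg_cst|exact: continuous_cos].
Qed.

Lemma measurable_dcot : measurable_fun setT dcot.
Proof.
apply: measurable_funM => //; apply: measurableT_comp; first exact: measurable_inv.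
exact: measurable_chord2.
Qed.

Lemma dconj_poissonE r u : dconj_poisson r u =
  2 * r * ((1 - r) ^+ 2 - (1 + r ^+ 2) * chord2 u / 2) /
    ((1 - r) ^+ 2 + r * chord2 u) ^+ 2.
Proof.
rewrite /dconj_poisson poisson_denE; congr (_ * _ / _).
by rewrite /chord2; field.
Qed.

Lemma dconj_poisson_bound r u : 1 / 2 <= r < 1 ->
  `|dconj_poisson r u| <= 4 / ((1 - r) ^+ 2 + r * chord2 u).
Proof.
move=> /andP[r12 r1]; rewrite dconj_poissonE.
have := chord2_ge0 u; set s := chord2 u => s0.
set D := (1 - r) ^+ 2 + r * s.
have D0 : 0 < D by rewrite ltr_wpDr ?mulr_ge0 ?exprn_gt0 ?subr_gt0//; lra.
rewrite normrM [`|_^-1|]ger0_norm ?invr_ge0 ?sqr_ge0// ler_pdivrMr ?exprn_gt0//.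
have -> : 4 / D * D ^+ 2 = 4 * D by field; rewrite lt0r_neq0.
rewrite /D; have d0 : 0 <= (1 - r) ^+ 2 by rewrite sqr_ge0.
have rs : 2^-1 * s <= r * s by rewrite ler_wpM2r//; lra.
have r2 : r ^+ 2 <= 1 by rewrite exprn_ile1//; lra.
have r2' : 0 <= r ^+ 2 by rewrite sqr_ge0.
have r2s : r ^+ 2 * s <= 1 * s by rewrite ler_wpM2r.
have r2s' : 0 <= r ^+ 2 * s by rewrite mulr_ge0.
rewrite normrM ger0_norm; last lra.
apply: (@le_trans _ _ (2 * `|(1 - r) ^+ 2 - (1 + r ^+ 2) * s / 2|)).
  by rewrite ler_wpM2r//; lra.
suff : `|(1 - r) ^+ 2 - (1 + r ^+ 2) * s / 2| <= (1 - r) ^+ 2 + s by lra.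
by rewrite ler_norml; apply/andP; split; lra.
Qed.

(** Over a common denominator, with s the squared chord, the coefficient of s^2 collapses to -r (1 -
    r)^2, so the whole numerator carries a factor (1 - r)^2. Then s <= 4 bounds the numerator, and D
    >= s / 2 costs the factor 4 in 40 = 4 * 10 and 8 = 4 * 2. *)
Lemma dconj_poissonD_dcot_bound r u : 1 / 2 <= r < 1 -> 0 < chord2 u ->
  `|dconj_poisson r u + dcot u| <=
    40 * (1 - r) ^+ 2 / chord2 u ^+ 2 + 8 * (1 - r) ^+ 4 / chord2 u ^+ 3.
Proof.
move=> /andP[r12 r1]; rewrite /dcot dconj_poissonE.
have := chord2_le4 u; set s := chord2 u => s4 s0.
set d := 1 - r; set D := d ^+ 2 + r * s.
have d0 : 0 < d by rewrite subr_gt0.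
have d20 : 0 <= d ^+ 2 by rewrite sqr_ge0.
have r0 : 0 < r by lra.
have D0 : 0 < D by rewrite ltr_wpDl// mulr_gt0.
have Ds : s / 2 <= D.
  have : 2^-1 * s <= r * s by rewrite ler_pM2r//; lra.
  by rewrite /D; lra.
have Dn := lt0r_neq0 D0; have sn := lt0r_neq0 s0.
have -> : 2 * r * (d ^+ 2 - (1 + r ^+ 2) * s / 2) / D ^+ 2 + 2 / s =
  (- r * d ^+ 2 * s ^+ 2 + 6 * r * d ^+ 2 * s + 2 * d ^+ 4) / (s * D ^+ 2).
  by rewrite /D /d in Dn *; field; rewrite Dn sn.
have sD : s ^+ 3 / 4 <= s * D ^+ 2.
  have -> : s ^+ 3 / 4 = s * (s / 2) ^+ 2 by field.
  by rewrite ler_pM2l// lerXn2r// nnegrE ?divr_ge0 ?ltW.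
rewrite normrM [`|_^-1|]ger0_norm; last by rewrite invr_ge0 mulr_ge0 ?sqr_ge0 ?ltW.
have -> : 40 * d ^+ 2 / s ^+ 2 + 8 * d ^+ 4 / s ^+ 3 =
  (10 * d ^+ 2 * s + 2 * d ^+ 4) / (s ^+ 3 / 4) by field.
apply: ler_pM => //.
- by rewrite invr_ge0 mulr_ge0 ?sqr_ge0 ?ltW.
- have a1 : 0 <= d ^+ 2 * s by rewrite mulr_ge0// ltW.
  have a2 : r * (d ^+ 2 * s) <= 1 * (d ^+ 2 * s) by rewrite ler_wpM2r// ltW.
  have a2' : 0 <= r * (d ^+ 2 * s) by rewrite mulr_ge0// ltW.
  have a3 : r * (d ^+ 2 * s) * s <= (d ^+ 2 * s) * 4.
    by apply: ler_pM; lra.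
  have a3' : 0 <= r * (d ^+ 2 * s) * s by rewrite mulr_ge0// ltW.
  have a4 : 0 <= d ^+ 4 by rewrite exprn_ge0// ltW.
  have -> : - r * d ^+ 2 * s ^+ 2 + 6 * r * d ^+ 2 * s + 2 * d ^+ 4 =
    - (r * (d ^+ 2 * s) * s) + 6 * (r * (d ^+ 2 * s)) + 2 * d ^+ 4 by ring.
  have -> : 10 * d ^+ 2 * s = 10 * (d ^+ 2 * s) by ring.
  by rewrite ler_norml; apply/andP; split; lra.
- rewrite lef_pV2 ?posrE; [exact: sD|by rewrite mulr_gt0 ?exprn_gt0|by rewrite divr_gt0 ?exprn_gt0].
Qed.

Lemma dpoisson_bound r u : 1 / 2 <= r < 1 ->
  `|dpoisson r u| <= 4 * (1 - r) * `|sin u| / ((1 - r) ^+ 2 + r * chord2 u) ^+ 2.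
Proof.
move=> /andP[r12 r1]; rewrite /dpoisson poisson_denE.
rewrite normrM [`|_^-1|]ger0_norm ?invr_ge0 ?sqr_ge0// ler_wpM2r ?invr_ge0 ?sqr_ge0//.
rewrite normrN normrM ler_wpM2r// ger0_norm; last first.
  by rewrite mulr_ge0 ?subr_ge0 ?exprn_ile1//; lra.
have -> : 2 * r * (1 - r ^+ 2) = 2 * (r * (1 + r)) * (1 - r) by ring.
rewrite ler_wpM2r ?subr_ge0 ?(ltW r1)//.
have -> : 4 = 2 * (1 * 2) :> R by ring.
by rewrite ler_pM2l// ler_pM//; lra.
Qed.

End Kernels.

(** * Majorants of the kernels at distance 1 - r from the boundary *)

Section KernelEstimates.
Variable R : realType.
Implicit Types (r s u v phi d : R).

Lemma ler_div_denom (a x y : R) : 0 <= a -> 0 < y -> y <= x -> a / x <= a / y.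
Proof.
move=> a0 y0 yx; rewrite ler_wpM2l// lef_pV2// posrE//.
exact: lt_le_trans yx.
Qed.

Definition dcot_trunc d u : R := if d <= `|u| then dcot u else 0.

(** Passing to the limit kernel costs (1 - r)^2 / |u|^4, which 1 - r <= |u| reduces to (1 - r) /
    |u|^3 and which accounts for 48 = 40 + 8. Moving the argument from [phi - u] to [u] costs |phi|
    / |u|^3, which accounts for [5 * kappa]. *)
Lemma dconj_poisson_far (k kappa : R) r u phi : 0 < k <= 1 -> 0 <= kappa ->
  1 / 2 <= r < 1 -> 2 * `|phi| <= `|u| -> `|phi| <= kappa * (1 - r) ->
  0 < 1 - r <= `|u| ->
  k * u ^+ 2 <= chord2 u -> k * u ^+ 2 <= chord2 (phi - u) ->
  `|dconj_poisson r (phi - u) + dcot u| <=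
     (48 + 5 * kappa) / k ^+ 3 * ((1 - r) / `|u| ^+ 3).
Proof.
move=> /andP[k0 k1] kap0 r01 phiu phid /andP[d0 du] su sv.
have w0 : 0 < `|u| by exact: lt_le_trans du.
have u2 : u ^+ 2 = `|u| ^+ 2 by rewrite real_normK ?num_real.
rewrite u2 in su sv.
have kw0 : 0 < k * `|u| ^+ 2 by rewrite mulr_gt0 ?exprn_gt0.
have sv0 : 0 < chord2 (phi - u) by exact: lt_le_trans sv.
have su0 : 0 < chord2 u by exact: lt_le_trans su.
have h1 := dconj_poissonD_dcot_bound r01 sv0.
set d := 1 - r in d0 du phid h1 *; set w := `|u| in phiu du w0 su sv kw0 *.
have dw3 : 0 < d / w ^+ 3 by rewrite divr_gt0 ?exprn_gt0.
have k30 : 0 < k ^+ 3 by rewrite exprn_gt0.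
have Q0 : 0 < d / w ^+ 3 / k ^+ 3 by rewrite divr_gt0.
have b1 : d ^+ 2 / chord2 (phi - u) ^+ 2 <= d / w ^+ 3 / k ^+ 3.
  apply: (@le_trans _ _ (d ^+ 2 / (k * w ^+ 2) ^+ 2)).
    apply: ler_div_denom; [by rewrite exprn_ge0// ltW|by rewrite exprn_gt0|].
    by rewrite lerXn2r// nnegrE ltW.
  have -> : d ^+ 2 / (k * w ^+ 2) ^+ 2 = (d / w * k) * (d / w ^+ 3 / k ^+ 3).
    by field; rewrite !lt0r_neq0.
  have dw1 : d / w <= 1 by rewrite ler_pdivrMr// mul1r.
  have dw0 : 0 <= d / w by rewrite divr_ge0// ltW.
  by rewrite ger_pMl// -[leRHS]mulr1 ler_pM// ltW.
have b2 : d ^+ 4 / chord2 (phi - u) ^+ 3 <= d / w ^+ 3 / k ^+ 3.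
  apply: (@le_trans _ _ (d ^+ 4 / (k * w ^+ 2) ^+ 3)).
    apply: ler_div_denom; [by rewrite exprn_ge0// ltW|by rewrite exprn_gt0|].
    by rewrite lerXn2r// nnegrE ltW.
  have -> : d ^+ 4 / (k * w ^+ 2) ^+ 3 = (d / w) ^+ 3 * (d / w ^+ 3 / k ^+ 3).
    by field; rewrite !lt0r_neq0.
  have dw1 : d / w <= 1 by rewrite ler_pdivrMr// mul1r.
  have dw0 : 0 <= d / w by rewrite divr_ge0// ltW.
  by rewrite ger_pMl// exprn_ile1.
have b3 : `|dcot (phi - u) - dcot u| <= 5 * kappa * (d / w ^+ 3 / k ^+ 3).
  have -> : dcot (phi - u) - dcot u =
    4 * (cos (phi - u) - cos u) / (chord2 u * chord2 (phi - u)).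
    rewrite /dcot; have -> : 4 * (cos (phi - u) - cos u) =
      2 * (chord2 u - chord2 (phi - u)) by rewrite /chord2; ring.
    by field; rewrite !lt0r_neq0.
  have c1 := norm_cos_sub_le (phi - u) u.
  rewrite subrK in c1.
  have c2 : `|phi - u - u| <= 5 / 2 * w.
    rewrite -addrA -opprD (le_trans (ler_normB _ _))//.
    by rewrite (le_trans (lerD (lexx _) (ler_normD _ _)))// -/w; lra.
  have c3 : `|phi| * `|phi - u - u| <= kappa * d * (5 / 2 * w) by rewrite ler_pM.
  have kd0 : 0 <= kappa * d by rewrite mulr_ge0// ltW.
  rewrite normrM [`|_^-1|]ger0_norm; last by rewrite invr_ge0; exact/ltW/mulr_gt0.
  apply: (@le_trans _ _ (5 * (kappa * d * w) / (k * w ^+ 2 * (k * w ^+ 2)))).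
    apply: (@le_trans _ _ (5 * (kappa * d * w) / (chord2 u * chord2 (phi - u)))).
      rewrite ler_wpM2r ?invr_ge0 ?mulr_ge0 ?chord2_ge0//.
      by rewrite normrM ger0_norm//; lra.
    apply: ler_div_denom; [by rewrite !mulr_ge0 ?(ltW d0) ?(ltW w0)|by rewrite mulr_gt0|].
    by apply: ler_pM => //; exact: ltW.
  have -> : 5 * (kappa * d * w) / (k * w ^+ 2 * (k * w ^+ 2)) =
    k * (5 * kappa * (d / w ^+ 3 / k ^+ 3)).
    by field; rewrite !lt0r_neq0.
  rewrite -[leRHS]mul1r ler_wpM2r//.
  by apply: mulr_ge0; [rewrite mulr_ge0|exact: ltW].
have -> : dconj_poisson r (phi - u) + dcot u =
  (dconj_poisson r (phi - u) + dcot (phi - u)) - (dcot (phi - u) - dcot u) by ring.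
apply: (le_trans (ler_normB _ _)).
have -> : (48 + 5 * kappa) / k ^+ 3 * (d / w ^+ 3) =
   (40 * (d / w ^+ 3 / k ^+ 3) + 8 * (d / w ^+ 3 / k ^+ 3)) +
   5 * kappa * (d / w ^+ 3 / k ^+ 3) by field; rewrite !lt0r_neq0.
apply: lerD => //; apply: (le_trans h1).
by rewrite -[40 * _ / _]mulrA -[8 * _ / _]mulrA; apply: lerD; rewrite ler_wpM2l.
Qed.

(** No cancellation is used: each term is O((1 - r)^-2), with constants 4 and 2, and for |u| <= c (1
    - r) the right-hand side is at least of this order. *)
Lemma dconj_poisson_near (k c : R) r u v : 0 < k <= 1 -> 0 <= c ->
  1 / 2 <= r < 1 -> `|u| <= c * (1 - r) -> k * u ^+ 2 <= chord2 u ->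
  `|dconj_poisson r v + dcot_trunc (1 - r) u| <=
    6 / k * (1 + c) ^+ 3 * ((1 - r) / (1 - r + `|u|) ^+ 3).
Proof.
move=> /andP[k0 k1] c0 r01 uc su.
have d0 : 0 < 1 - r by rewrite subr_gt0; case/andP: r01.
have h1 := dconj_poisson_bound v r01.
set d := 1 - r in d0 uc h1 *.
have kd0 : 0 < k * d ^+ 2 by rewrite mulr_gt0 ?exprn_gt0.
have h2 : `|dconj_poisson r v| <= 4 / (k * d ^+ 2).
  apply: (le_trans h1); apply: ler_div_denom => //.
  rewrite -[leLHS]addr0 lerD//; last first.
    by rewrite mulr_ge0 ?chord2_ge0//; case/andP: r01 => + _; lra.
  by rewrite ger_pMl ?exprn_gt0.
have h3 : `|dcot_trunc d u| <= 2 / (k * d ^+ 2).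
  rewrite /dcot_trunc; case: ifPn => [du|_]; last by rewrite normr0 divr_ge0// ltW.
  have kdu : k * d ^+ 2 <= chord2 u.
    apply: le_trans su; rewrite ler_pM2l// -[u ^+ 2]real_normK ?num_real//.
    by rewrite lerXn2r// nnegrE// ltW.
  rewrite /dcot ger0_norm ?divr_ge0 ?chord2_ge0//.
  exact: ler_div_denom.
apply: (@le_trans _ _ (6 / (k * d ^+ 2))).
  by rewrite (le_trans (ler_normD _ _))// (le_trans (lerD h2 h3))// -mulrDl ler_pM2r ?invr_gt0//; lra.
have -> : 6 / (k * d ^+ 2) = 6 / k * (1 + c) ^+ 3 * (d / (d + c * d) ^+ 3).
  have dn : d != 0 by rewrite lt0r_neq0.
  have kn : k != 0 by rewrite lt0r_neq0.
  have cn : 1 + c != 0 by rewrite lt0r_neq0// ltr_wpDr.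
  have -> : d + c * d = (1 + c) * d by ring.
  by field; rewrite kn dn cn.
rewrite ler_wpM2l// ?mulr_ge0 ?invr_ge0 ?exprn_ge0 ?addr_ge0// ?(ltW k0)//.
apply: ler_div_denom; first exact: ltW.
  by rewrite exprn_gt0// ltr_wpDr.
by rewrite lerXn2r ?nnegrE ?lerD2l// addr_ge0 ?mulr_ge0// ltW.
Qed.

Lemma dconj_poissonD_dcot_trunc_le (kappa : R) : 0 <= kappa ->
  exists2 C : R, 0 <= C & forall r u phi, 1 / 2 <= r < 1 ->
    `|phi| <= kappa * (1 - r) -> `|u| <= pi ->
    `|dconj_poisson r (phi - u) + dcot_trunc (1 - r) u| <=
      C * ((1 - r) / (1 - r + `|u|) ^+ 3).
Proof.
move=> kap0; have pi0 := pi_gt0 R.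
have [k0 /andP[k00 k01] Hk0] := @chord2_ge R (3 / 2 * pi) ltac:(apply/andP; split; lra).
(* In the far case |phi - u| lies between |u| / 2 and 3/2 |u|. This explains the range 3/2 pi of
   [k0], and squaring the half gives the factor 1/4. *)
have [k [kE k01']] : exists k, k = k0 / 4 /\ 0 < k <= 1.
  by exists (k0 / 4); split => //; apply/andP; split; lra.
(* With this threshold, |u| > c (1 - r) implies both 1 - r <= |u| and 2 |phi| <= |u|. *)
pose c := 1 + 2 * kappa.
have c0 : 0 <= c by rewrite addr_ge0 ?mulr_ge0.
have k_ge0 : 0 <= k by case/andP: k01' => /ltW.
exists (6 / k * (1 + c) ^+ 3 + (48 + 5 * kappa) / k ^+ 3 * 8).
  rewrite addr_ge0 ?mulr_ge0 ?invr_ge0 ?exprn_ge0 ?addr_ge0 ?mulr_ge0//.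
move=> r u phi r01 phid upi.
have d0 : 0 < 1 - r by rewrite subr_gt0; case/andP: r01.
have Hu v : `|v| <= 3 / 2 * pi -> `|u| <= 2 * `|v| -> k * u ^+ 2 <= chord2 v.
  move=> vpi uv; apply: le_trans (Hk0 v vpi).
  have -> : k * u ^+ 2 = k0 * (`|u| / 2) ^+ 2.
    by rewrite expr_div_n real_normK ?num_real// kE; field.
  rewrite ler_pM2l// -[v ^+ 2]real_normK ?num_real//.
  by rewrite lerXn2r ?nnegrE ?divr_ge0//; lra.
have su : k * u ^+ 2 <= chord2 u by apply: Hu; have := normr_ge0 u; lra.
have w0 := normr_ge0 u.
have dw0 : 0 < 1 - r + `|u| by exact: ltr_wpDr.
have q0 : 0 <= (1 - r) / (1 - r + `|u|) ^+ 3.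
  by rewrite divr_ge0 ?exprn_ge0 ?(ltW dw0)// ltW.
have c1 : 0 <= 1 + c by exact: addr_ge0.
have A0 : 0 <= 6 / k * (1 + c) ^+ 3.
  by apply: mulr_ge0; [exact: divr_ge0|exact: exprn_ge0].
have kap5 : 0 <= 48 + 5 * kappa by apply: addr_ge0 => //; exact: mulr_ge0.
have B0 : 0 <= (48 + 5 * kappa) / k ^+ 3.
  by apply: divr_ge0 => //; exact: exprn_ge0.
rewrite mulrDl; have [uc|cu] := leP `|u| (c * (1 - r)).
  apply: (le_trans (dconj_poisson_near (phi - u) k01' c0 r01 uc su)).
  by rewrite lerDl; apply: mulr_ge0 => //; exact: mulr_ge0.
have phi2 : 2 * `|phi| <= `|u|.
  by rewrite (le_trans _ (ltW cu))// /c mulrDl mul1r; lra.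
have du : 1 - r <= `|u|.
  rewrite (le_trans _ (ltW cu))// /c mulrDl mul1r lerDl.
  by rewrite !mulr_ge0// ltW.
have n1 : `|phi - u| <= `|phi| + `|u| by exact: ler_normB.
have n2 : `|u| <= `|phi| + `|phi - u|.
  by rewrite -{1}[u](subKr phi) ler_normB.
have phi0 := normr_ge0 phi.
have sv : k * u ^+ 2 <= chord2 (phi - u) by apply: Hu; lra.
rewrite /dcot_trunc du.
have H := dconj_poisson_far k01' kap0 r01 phi2 phid ltac:(by rewrite d0 du) su sv.
apply: (le_trans H).
have wgt0 : 0 < `|u| by exact: lt_le_trans du.
(* Since 1 - r <= |u| here, |u| is at least half of 1 - r + |u|. *)
have : (1 - r) / `|u| ^+ 3 <= 8 * ((1 - r) / (1 - r + `|u|) ^+ 3).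
  have -> : 8 * ((1 - r) / (1 - r + `|u|) ^+ 3) = (1 - r) / ((1 - r + `|u|) / 2) ^+ 3.
    by field; rewrite lt0r_neq0.
  apply: ler_div_denom; first exact: ltW.
    by rewrite exprn_gt0// divr_gt0.
  rewrite lerXn2r ?nnegrE ?divr_ge0 ?(ltW dw0)//; lra.
move=> h8; apply: ler_wpDl; first exact: mulr_ge0.
by rewrite -[leRHS]mulrA ler_wpM2l.
Qed.

Lemma dpoisson_le (b : R) : 0 < b < 2 * pi -> exists2 C : R, 0 <= C &
  forall r u, 1 / 2 <= r < 1 -> `|u| <= b ->
    `|dpoisson r u| <= C * ((1 - r) / (1 - r + `|u|) ^+ 3).
Proof.
move=> b2pi; have [k /andP[k0 k1] Hk] := chord2_ge b2pi.
exists (64 / k ^+ 2); first by rewrite divr_ge0 ?exprn_ge0 ?ltW.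
move=> r u r01 ub; have d0 : 0 < 1 - r by rewrite subr_gt0; case/andP: r01.
apply: (le_trans (dpoisson_bound u r01)).
have := Hk u ub; rewrite -[u ^+ 2]real_normK ?num_real//.
set d := 1 - r in d0 *; set w := `|u| => su.
have w0 : 0 <= w by exact: normr_ge0.
have dw : 0 < d + w by rewrite ltr_wpDr.
have L0 : 0 < k / 4 * (d + w) ^+ 2 by rewrite mulr_gt0 ?exprn_gt0 ?divr_gt0.
have LD : k / 4 * (d + w) ^+ 2 <= d ^+ 2 + r * chord2 u.
  have h1 : 1 / 2 * (k * w ^+ 2) <= r * chord2 u.
    by rewrite ler_pM ?mulr_ge0 ?exprn_ge0// ?(ltW k0)//; case/andP: r01.
  have h2 : k * d ^+ 2 <= d ^+ 2 by rewrite ger_pMl ?exprn_gt0.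
  have h3 : 0 <= k * (d - w) ^+ 2 by rewrite mulr_ge0 ?sqr_ge0// ltW.
  have h4 : 0 <= k * d ^+ 2 by rewrite mulr_ge0 ?sqr_ge0// ltW.
  have h5 : k / 4 * (d + w) ^+ 2 = 1 / 2 * (k * w ^+ 2) + 1 / 2 * (k * d ^+ 2) - 1 / 4 * (k * (d - w) ^+ 2) by field.
  lra.
apply: (@le_trans _ _ (4 * d * w / (k / 4 * (d + w) ^+ 2) ^+ 2)).
  apply: (@le_trans _ _ (4 * d * w / (d ^+ 2 + r * chord2 u) ^+ 2)).
    rewrite ler_wpM2r ?invr_ge0 ?sqr_ge0// ler_wpM2l ?mulr_ge0 ?(ltW d0)//.
    exact: norm_sin_le.
  apply: ler_div_denom; [by rewrite !mulr_ge0 ?(ltW d0)|by rewrite exprn_gt0|].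
  by rewrite lerXn2r// nnegrE ltW// (lt_le_trans L0).
have -> : 4 * d * w / (k / 4 * (d + w) ^+ 2) ^+ 2 =
   64 / k ^+ 2 * (d / (d + w) ^+ 3) * (w / (d + w)).
  by field; rewrite !lt0r_neq0.
rewrite ger_pMr; first by rewrite ler_pdivrMr// mul1r lerDr ltW.
by rewrite mulr_gt0 ?divr_gt0 ?exprn_gt0.
Qed.

(** The bound is uniform in [r]: it supplies the dominating function for functions that vanish at
    the singularity and are integrable against u^-2. *)
Lemma dconj_poisson_le_sqr (b : R) : 0 < b < 2 * pi -> exists2 C : R, 0 <= C &
  forall r u, 1 / 2 <= r < 1 -> `|u| <= b -> `|dconj_poisson r u| * u ^+ 2 <= C.
Proof.
move=> b2pi; have [k /andP[k0 k1] Hk] := chord2_ge b2pi.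
exists (8 / k); first by rewrite divr_ge0// ltW.
move=> r u r01 ub; have [->|u0] := eqVneq u 0.
  by rewrite expr0n/= mulr0 divr_ge0// ltW.
have u2 : 0 < u ^+ 2 by rewrite exprn_even_gt0.
rewrite -ler_pdivlMr//; apply: (le_trans (dconj_poisson_bound u r01)).
have ku : 0 < k / 2 * u ^+ 2 by rewrite mulr_gt0// divr_gt0.
have -> : 8 / k / u ^+ 2 = 4 / (k / 2 * u ^+ 2) by field; rewrite u0 lt0r_neq0.
have LD : k / 2 * u ^+ 2 <= (1 - r) ^+ 2 + r * chord2 u.
  have h1 : 1 / 2 * (k * u ^+ 2) <= r * chord2 u.
    apply: ler_pM; [exact: divr_ge0|by apply: mulr_ge0; exact: ltW| |exact: Hk].
    by case/andP: r01.
  have := sqr_ge0 (1 - r); lra.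
exact: ler_div_denom.
Qed.

End KernelEstimates.

(** * Integrals of o(|t - x|) against the kernels *)

Section LittleO.
Variable R : realType.
Notation mu := (@lebesgue_measure R).
Implicit Types (a b x d t : R).

Lemma continuous_cauchy_bump d x : 0 < d ->
  continuous (fun t : R => d / (d + `|t - x|) ^+ 2).
Proof.
move=> d0 t; apply: cvgMl_tmp; apply: cvgV.
  by rewrite expf_neq0// lt0r_neq0// ltr_wpDr.
apply: (@continuous_comp _ _ _ (fun t => d + `|t - x|) (fun y : R => y ^+ 2)).
  apply: cvgD; first exact: cvg_cst.
  by apply: cvg_norm; apply: cvgB; [exact: cvg_id|exact: cvg_cst].
exact: exprn_continuous.
Qed.

(** On either side of [x] a primitive is, up to sign, d / (d + |t - x|), which has values in [0, 1];
    each side contributes at most 1. *)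
Lemma int_cauchy_bump_le2 a b x d : a <= x -> x <= b -> 0 < d ->
  \int[mu]_(t in `[a, b]) (d / (d + `|t - x|) ^+ 2) <= 2.
Proof.
move=> ax xb d0.
have ci u v : mu.-integrable `[u, v] (EFin \o (fun t : R => d / (d + `|t - x|) ^+ 2)).
  by apply: integrable_itv_cont => t _; exact: continuous_cauchy_bump.
rewrite (int_itv_split ax xb)//.
have dV (s c t : R) : c + s * t != 0 ->
    is_derive t (1 : R) (fun t : R => d / (c + s * t)) (- s * d / (c + s * t) ^+ 2).
  move=> n0; have dl : is_derive t (1 : R) (fun t : R => c + s * t) s.
    apply: is_derive_eq; rewrite /GRing.scale/=; ring.
  have dW := @is_deriveV _ (fun t : R => c + s * t) t _ 1 n0 dl.
  have -> : (fun t : R => d / (c + s * t)) = (cst d : R -> R) * (fun t => (c + s * t)^-1).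
    by apply/funext.
  apply: (is_derive_eq (is_deriveM (is_derive_cst _ _ _) dW)).
  by rewrite /GRing.scale/= /cst; field.
have cb t : {for t, continuous (fun t : R => d / (d + `|t - x|) ^+ 2)}.
  exact: continuous_cauchy_bump.
have dr t : t \in `[x, b] -> is_derive t (1 : R)
    (fun t => - (d / (d - x + 1 * t))) (d / (d + `|t - x|) ^+ 2).
  rewrite in_itv/= => /andP[xt tb].
  have n0 : d - x + 1 * t != 0 by rewrite lt0r_neq0//; lra.
  apply: (is_derive_eq (is_deriveN (dV _ _ _ n0))).
  rewrite ger0_norm ?subr_ge0//.
  have -> : d + (t - x) = d - x + 1 * t by ring.
  by rewrite mulN1r mulNr opprK.
have dl t : t \in `[a, x] -> is_derive t (1 : R)
    (fun t => d / (d + x + -1 * t)) (d / (d + `|t - x|) ^+ 2).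
  rewrite in_itv/= => /andP[at_ tx].
  have n0 : d + x + -1 * t != 0 by rewrite lt0r_neq0//; lra.
  apply: (is_derive_eq (dV _ _ _ n0)).
  rewrite distrC ger0_norm ?subr_ge0//.
  have -> : d + (x - t) = d + x + -1 * t by ring.
  by rewrite opprK mul1r.
rewrite (int_itv_deriv xb dr (fun t _ => cb t)) (int_itv_deriv ax dl (fun t _ => cb t)).
have -> : d / (d - x + 1 * x) = 1 by rewrite mul1r subrK divff// lt0r_neq0.
have -> : d / (d + x + -1 * x) = 1 by rewrite mulN1r addrK divff// lt0r_neq0.
have : 0 <= d / (d - x + 1 * b) by apply: divr_ge0; lra.
have : 0 <= d / (d + x + -1 * a) by apply: divr_ge0; lra.
lra.
Qed.

(** Near [x] the factor |t - x| lowers the exponent 3 to 2 and leaves a bump of mass at most 2,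
    times a small constant; away from [x] the kernel is O(d). The threshold [d0] is chosen before
    [N], which later gives uniformity over a whole angle. *)
Lemma int_littleo_kernel a b x (M C : R) (rho : R -> R) :
  a <= x -> x <= b -> 0 <= C -> measurable_fun `[a, b] rho ->
  (forall t, t \in `[a, b] -> `|rho t| <= M) ->
  (forall e, 0 < e -> exists2 d, 0 < d &
     forall t, `|t - x| < d -> `|rho t| <= e * `|t - x|) ->
  forall e, 0 < e -> exists2 d0, 0 < d0 & forall (d : R) (N : R -> R), 0 < d < d0 ->
    measurable_fun `[a, b] N ->
    (forall t, t \in `[a, b] -> `|N t| <= C * (d / (d + `|t - x|) ^+ 3)) ->
    `|\int[mu]_(t in `[a, b]) (rho t * N t)| <= e.
Proof.
move=> ax xb C0 mrho rhoM rhoo e e0.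
have M0 : 0 <= M by apply: le_trans (rhoM x _); rewrite ?normr_ge0// in_itv/= ax.
have ab : a <= b by exact: le_trans xb.
(* The near part is at most 2 * e1 * C and the far part at most d * B; each is allotted e / 2. *)
pose e1 := e / (4 * (C + 1)).
have C1 : 0 < C + 1 by rewrite ltr_wpDl.
have e10 : 0 < e1 by rewrite divr_gt0// mulr_gt0.
have [d1 d10 Hd1] := rhoo e1 e10.
pose B := M * C / d1 ^+ 3 * (b - a).
have B0 : 0 <= B.
  apply: mulr_ge0; last by rewrite subr_ge0.
  by apply: divr_ge0; [exact: mulr_ge0|rewrite exprn_ge0// ltW].
exists (e / (2 * (B + 1))).
  by rewrite divr_gt0// mulr_gt0// ltr_wpDl.
move=> d N /andP[d0 dB] mN Nle.
pose g t := e1 * C * (d / (d + `|t - x|) ^+ 2) + M * C * d / d1 ^+ 3.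
have ig1 : mu.-integrable `[a, b] (EFin \o (fun t : R => d / (d + `|t - x|) ^+ 2)).
  by apply: integrable_itv_cont => t _; exact: continuous_cauchy_bump.
have ig2 : mu.-integrable `[a, b] (EFin \o (fun=> M * C * d / d1 ^+ 3)).
  by apply: integrable_itv_cont => t _; exact: cvg_cst.
have ig : mu.-integrable `[a, b] (EFin \o g).
  by apply: integrable_itvD => //; exact: integrable_itvZ.
have le_g t : t \in `[a, b] -> `|rho t * N t| <= g t.
  move=> tab; rewrite normrM.
  have w0 := normr_ge0 (t - x); set w := `|t - x| in w0.
  have dw : 0 < d + w by rewrite ltr_wpDr.
  have h1 : 0 <= e1 * C * (d / (d + w) ^+ 2).
    apply: mulr_ge0; first by apply: mulr_ge0 => //; exact: ltW.
    by apply: divr_ge0; [exact: ltW|apply: exprn_ge0; exact: ltW].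
  have h2 : 0 <= M * C * d / d1 ^+ 3.
    apply: divr_ge0; last by apply: exprn_ge0; exact: ltW.
    by apply: mulr_ge0; [exact: mulr_ge0|exact: ltW].
  have h3 : 0 <= C * (d / (d + w) ^+ 3).
    apply: mulr_ge0 => //; apply: divr_ge0; first exact: ltW.
    by apply: exprn_ge0; exact: ltW.
  rewrite /g -/w; have [wd|dw1] := ltP w d1.
    apply: ler_wpDr => //.
    apply: (@le_trans _ _ (e1 * w * (C * (d / (d + w) ^+ 3)))).
      by apply: ler_pM => //; [exact: Hd1|exact: Nle].
    have -> : e1 * w * (C * (d / (d + w) ^+ 3)) =
        e1 * C * (d / (d + w) ^+ 2) * (w / (d + w)) by field; rewrite lt0r_neq0.
    by apply: ler_piMr => //; rewrite ler_pdivrMr// mul1r lerDr ltW.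
  apply: ler_wpDl => //.
  apply: (@le_trans _ _ (M * (C * (d / (d + w) ^+ 3)))).
    by apply: ler_pM => //; [exact: rhoM|exact: Nle].
  have -> : M * C * d / d1 ^+ 3 = M * (C * (d / d1 ^+ 3)) by rewrite !mulrA.
  apply: ler_wpM2l => //; apply: ler_wpM2l => //; apply: ler_div_denom.
  - exact: ltW.
  - by rewrite exprn_gt0.
  - by rewrite lerXn2r ?nnegrE ?(ltW d10) ?(ltW dw)// ler_wpDl// ltW.
have irN : mu.-integrable `[a, b] (EFin \o (fun t => rho t * N t)).
  apply: (le_integrable _ _ _ ig) => //.
    by apply/measurable_EFinP; exact: measurable_funM.
  move=> t tab /=; rewrite lee_fin (le_trans (le_g t tab))//; exact: ler_norm.
apply: (le_trans (le_int_itv irN ig le_g)).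
rewrite /g RintegralD//; last exact: integrable_itvZ.
rewrite int_itv_cst// RintegralZl//.
have h := int_cauchy_bump_le2 ax xb d0.
have e1C : e1 * C <= e / 4.
  have -> : e / 4 = e1 * (C + 1) by rewrite /e1; field; rewrite lt0r_neq0.
  by rewrite ler_wpM2l ?(ltW e10)// lerDl.
have e1C0 : 0 <= e1 * C by rewrite mulr_ge0// ltW.
have k1 := ler_wpM2l e1C0 h.
have -> : M * C * d / d1 ^+ 3 * (b - a) = d * B by rewrite /B; ring.
have dB' : d * B <= e / 2.
  have : d * (B + 1) <= e / 2.
    move: dB; rewrite ltr_pdivlMr; last by rewrite mulr_gt0// ltr_wpDl.
    by move=> /ltW; rewrite mulrCA; lra.
  lra.
lra.
Qed.

Lemma dconj_poisson_continuousl (u q : R) : 1 - 2 * q * cos u + q ^+ 2 != 0 ->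
  dconj_poisson r u @[r --> q] --> dconj_poisson q u.
Proof.
move=> Dq; have cX : continuous (fun r : R => r ^+ 2) by exact: exprn_continuous.
have cD : {for q, continuous (fun r : R => 1 - 2 * r * cos u + r ^+ 2)}.
  apply: cvgD; last exact: cX.
  apply: cvgB; first exact: cvg_cst.
  by apply: cvgMr_tmp; apply: cvgMl_tmp; exact: cvg_id.
apply: cvgM.
  apply: cvgM; first by apply: cvgMl_tmp; exact: cvg_id.
  apply: cvgB; last by apply: cvgMl_tmp; exact: cvg_id.
  by apply: cvgMr_tmp; apply: cvgD; [exact: cvg_cst|exact: cX].
apply: cvgV; first exact: expf_neq0.
exact: (@continuous_comp _ _ _ _ (fun y : R => y ^+ 2) q cD (@exprn_continuous _ 2 _)).
Qed.

(** Away from the singularity the formula is continuous in [r] up to r = 1, where the denominator is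
    the square of [chord2 u]. *)
Lemma dconj_poisson_cvg (u : R) : 0 < chord2 u ->
  dconj_poisson r u @[r --> (1 : R)^'-] --> - dcot u.
Proof.
move=> su; have -> : - dcot u = dconj_poisson 1 u.
  rewrite dconj_poissonE /dcot subrr expr0n/= add0r mul1r.
  by field; rewrite lt0r_neq0.
apply: cvg_at_left_filter; apply: dconj_poisson_continuousl.
by rewrite poisson_denE subrr expr0n/= add0r mul1r lt0r_neq0.
Qed.

End LittleO.

(** * The conjugate function of a Lipschitz function *)

Section FourierKernels.
Variable R : realType.
Implicit Types (r u x t a b : R) (n N : nat).

Definition dconj_sum r N u := \sum_(n < N) n%:R * r ^+ n * cos (n%:R * u).
Definition dpoisson_sum r N u := \sum_(n < N) n%:R * r ^+ n * sin (n%:R * u).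

Lemma cosSn u n : cos (n.+1%:R * u) = cos (n%:R * u) * cos u - sin (n%:R * u) * sin u.
Proof. by rewrite -natr1 mulrDl mul1r cosD. Qed.

Lemma sinSn u n : sin (n.+1%:R * u) = sin (n%:R * u) * cos u + cos (n%:R * u) * sin u.
Proof. by rewrite -natr1 mulrDl mul1r sinD. Qed.

(* real and imaginary parts of
   (1 - z)^2 * sum_(n < N) n z^n = z - N z^N + (N - 1) z^(N+1), z = r e^(iu) *)
Lemma dconj_dpoisson_sumE r u N :
  let p := 1 - 2 * r * cos u + r ^+ 2 * (cos u ^+ 2 - sin u ^+ 2) in
  let q := - 2 * r * sin u + 2 * r ^+ 2 * (sin u * cos u) in
  (p * dconj_sum r N u - q * dpoisson_sum r N u =
    r * cos u - N%:R * r ^+ N * cos (N%:R * u) +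
      (N%:R - 1) * r ^+ N.+1 * cos (N.+1%:R * u)) /\
  (q * dconj_sum r N u + p * dpoisson_sum r N u =
    r * sin u - N%:R * r ^+ N * sin (N%:R * u) +
      (N%:R - 1) * r ^+ N.+1 * sin (N.+1%:R * u)).
Proof.
move=> p q; elim: N => [|N [IH1 IH2]].
  by rewrite /dconj_sum /dpoisson_sum !big_ord0 !mul1r expr1; split; ring.
rewrite /dconj_sum /dpoisson_sum !big_ord_recr/= -/(dconj_sum r N u) -/(dpoisson_sum r N u).
split.
  have -> : p * (dconj_sum r N u + N%:R * r ^+ N * cos (N%:R * u)) -
            q * (dpoisson_sum r N u + N%:R * r ^+ N * sin (N%:R * u)) =
    (p * dconj_sum r N u - q * dpoisson_sum r N u) +
    N%:R * r ^+ N * (p * cos (N%:R * u) - q * sin (N%:R * u)) by ring.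
  rewrite IH1 /p /q !cosSn !sinSn -[N.+1%:R]natr1 !exprS; ring.
have -> : q * (dconj_sum r N u + N%:R * r ^+ N * cos (N%:R * u)) +
          p * (dpoisson_sum r N u + N%:R * r ^+ N * sin (N%:R * u)) =
    (q * dconj_sum r N u + p * dpoisson_sum r N u) +
    N%:R * r ^+ N * (q * cos (N%:R * u) + p * sin (N%:R * u)) by ring.
rewrite IH2 /p /q !sinSn !cosSn -[N.+1%:R]natr1 !exprS; ring.
Qed.

(** The remainder terms N z^N and (N - 1) z^(N+1), divided by |1 - z|^2 >= (1 - r)^2. *)
Definition fourier_tail r N : R := 4 * (N.+1%:R * r ^+ N) / (1 - r) ^+ 2.

(** Here p + i q = (1 - z)^2 has modulus D = |1 - z|^2. Multiplying the two identities by its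
    conjugate solves for the sums, with leading terms half of [dconj_poisson] and minus half of
    [dpoisson]. *)
Lemma dconj_dpoisson_sum_le r u N : 0 <= r < 1 ->
  `|dconj_poisson r u - 2 * dconj_sum r N u| <= 2 * fourier_tail r N /\
  `|dpoisson r u + 2 * dpoisson_sum r N u| <= 2 * fourier_tail r N.
Proof.
move=> r01; have [] := dconj_dpoisson_sumE r u N.
set p := 1 - 2 * r * cos u + r ^+ 2 * (cos u ^+ 2 - sin u ^+ 2).
set q := - 2 * r * sin u + 2 * r ^+ 2 * (sin u * cos u).
move=> h1 h2.
have D0 := poisson_den_gt0 u r01; set D := 1 - 2 * r * cos u + r ^+ 2 in D0.
have sc : sin u ^+ 2 = 1 - cos u ^+ 2 by exact: sin2cos2.
have pqD : p ^+ 2 + q ^+ 2 = D ^+ 2.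
  rewrite /p /q /D.
  have -> : (1 - 2 * r * cos u + r ^+ 2 * (cos u ^+ 2 - sin u ^+ 2)) ^+ 2 +
   (- 2 * r * sin u + 2 * r ^+ 2 * (sin u * cos u)) ^+ 2 =
   (1 - 2 * r * cos u + r ^+ 2 * (cos u ^+ 2 - sin u ^+ 2)) ^+ 2 +
   4 * r ^+ 2 * sin u ^+ 2 * (1 - r * cos u) ^+ 2 by ring.
  rewrite sc; ring.
set E1 := - (N%:R * r ^+ N * cos (N%:R * u)) + (N%:R - 1) * r ^+ N.+1 * cos (N.+1%:R * u).
set E2 := - (N%:R * r ^+ N * sin (N%:R * u)) + (N%:R - 1) * r ^+ N.+1 * sin (N.+1%:R * u).
have Dn : D != 0 by rewrite lt0r_neq0.
have kc : D ^+ 2 * (dconj_sum r N u - dconj_poisson r u / 2) = p * E1 + q * E2.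
  have -> : p * E1 + q * E2 = p * (p * dconj_sum r N u - q * dpoisson_sum r N u) +
     q * (q * dconj_sum r N u + p * dpoisson_sum r N u) - (p * (r * cos u) + q * (r * sin u)).
    by rewrite h1 h2 /E1 /E2; ring.
  have -> : p * (p * dconj_sum r N u - q * dpoisson_sum r N u) +
     q * (q * dconj_sum r N u + p * dpoisson_sum r N u) = D ^+ 2 * dconj_sum r N u.
    by rewrite -pqD; ring.
  have -> : p * (r * cos u) + q * (r * sin u) = r * ((1 + r ^+ 2) * cos u - 2 * r).
    rewrite /p /q.
    have -> : (1 - 2 * r * cos u + r ^+ 2 * (cos u ^+ 2 - sin u ^+ 2)) * (r * cos u) +
      (- 2 * r * sin u + 2 * r ^+ 2 * (sin u * cos u)) * (r * sin u) =
      r * cos u * (1 + r ^+ 2 * (cos u ^+ 2 + sin u ^+ 2)) - 2 * r ^+ 2 * (cos u ^+ 2 + sin u ^+ 2) by ring.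
    by rewrite cos2Dsin2; ring.
  by rewrite /dconj_poisson -/D; field.
have ks : D ^+ 2 * (dpoisson_sum r N u + dpoisson r u / 2) = p * E2 - q * E1.
  have -> : p * E2 - q * E1 = p * (q * dconj_sum r N u + p * dpoisson_sum r N u) -
     q * (p * dconj_sum r N u - q * dpoisson_sum r N u) - (p * (r * sin u) - q * (r * cos u)).
    by rewrite h1 h2 /E1 /E2; ring.
  have -> : p * (q * dconj_sum r N u + p * dpoisson_sum r N u) -
     q * (p * dconj_sum r N u - q * dpoisson_sum r N u) = D ^+ 2 * dpoisson_sum r N u.
    by rewrite -pqD; ring.
  have -> : p * (r * sin u) - q * (r * cos u) = r * (1 - r ^+ 2) * sin u.
    rewrite /p /q.
    have -> : (1 - 2 * r * cos u + r ^+ 2 * (cos u ^+ 2 - sin u ^+ 2)) * (r * sin u) -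
      (- 2 * r * sin u + 2 * r ^+ 2 * (sin u * cos u)) * (r * cos u) =
      r * sin u * (1 - r ^+ 2 * (cos u ^+ 2 + sin u ^+ 2)) by ring.
    by rewrite cos2Dsin2; ring.
  by rewrite /dpoisson -/D; field.
have [r0 r1] : 0 <= r /\ r <= 1 by case/andP: r01 => ? /ltW.
have rN0 : 0 <= r ^+ N by rewrite exprn_ge0.
have nr0 : 0 <= N.+1%:R * r ^+ N by rewrite mulr_ge0.
have Ebound (c c' : R) : `|c| <= 1 -> `|c'| <= 1 ->
    `|- (N%:R * r ^+ N * c) + (N%:R - 1) * r ^+ N.+1 * c'| <= 2 * (N.+1%:R * r ^+ N).
  move=> c1 c1'; rewrite (le_trans (ler_normD _ _))//.
  rewrite normrN [leRHS]mulr_natl mulr2n; apply: lerD; rewrite normrM.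
    apply: (@le_trans _ _ `|N%:R * r ^+ N|); first exact: ler_piMr.
    by rewrite ger0_norm ?mulr_ge0// ler_wpM2r// ler_nat.
  apply: (@le_trans _ _ `|(N%:R - 1) * r ^+ N.+1|); first exact: ler_piMr.
  rewrite normrM (ger0_norm (exprn_ge0 _ r0)); apply: ler_pM => //.
  - exact: exprn_ge0.
  - rewrite (le_trans (ler_normB _ _))// normr1 ger0_norm// natr1//.
  - by rewrite exprS ler_piMl.
have E1b : `|E1| <= 2 * (N.+1%:R * r ^+ N) by apply: Ebound; exact: cos_max.
have E2b : `|E2| <= 2 * (N.+1%:R * r ^+ N) by apply: Ebound; exact: sin_max.
have pD : `|p| <= D.
  rewrite -(ger0_norm (ltW D0)) -ler_sqr ?nnegrE// !real_normK ?num_real// -pqD.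
  by rewrite lerDl sqr_ge0.
have qD : `|q| <= D.
  rewrite -(ger0_norm (ltW D0)) -ler_sqr ?nnegrE// !real_normK ?num_real// -pqD.
  by rewrite lerDr sqr_ge0.
have dD : (1 - r) ^+ 2 <= D.
  rewrite /D poisson_denE lerDl mulr_ge0// chord2_ge0 //.
have d0 : 0 < (1 - r) ^+ 2.
  by rewrite exprn_gt0// subr_gt0; case/andP: r01.
have fin (X Y : R) : D ^+ 2 * X = Y -> `|Y| <= D * (4 * (N.+1%:R * r ^+ N)) ->
    `|X| <= fourier_tail r N.
  move=> XY Yb; have -> : X = Y / D ^+ 2 by rewrite -XY mulrC mulKf// expf_neq0.
  rewrite normrM [`|_^-1|]ger0_norm ?invr_ge0 ?sqr_ge0//.
  apply: (@le_trans _ _ (4 * (N.+1%:R * r ^+ N) / D)).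
    rewrite ler_pdivrMr ?exprn_gt0//.
    suff -> : 4 * (N.+1%:R * r ^+ N) / D * D ^+ 2 = D * (4 * (N.+1%:R * r ^+ N)) by [].
    by field.
  by apply: ler_div_denom => //; exact: mulr_ge0.
have bnd (x y : R) : `|x| <= 2 * (N.+1%:R * r ^+ N) ->
    `|y| <= 2 * (N.+1%:R * r ^+ N) ->
    `|p * x| + `|q * y| <= D * (4 * (N.+1%:R * r ^+ N)).
  move=> xb yb; have -> : D * (4 * (N.+1%:R * r ^+ N)) =
    D * (2 * (N.+1%:R * r ^+ N)) + D * (2 * (N.+1%:R * r ^+ N)) by ring.
  by apply: lerD; rewrite normrM ler_pM.
split.
  have -> : dconj_poisson r u - 2 * dconj_sum r N u =
    - (2 * (dconj_sum r N u - dconj_poisson r u / 2)) by field.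
  rewrite normrN normrM ger0_norm// ler_pM2l//.
  apply: (fin _ _ kc); apply: (le_trans (ler_normD _ _)); exact: bnd.
have -> : dpoisson r u + 2 * dpoisson_sum r N u =
  2 * (dpoisson_sum r N u + dpoisson r u / 2) by field.
rewrite normrM ger0_norm// ler_pM2l//.
apply: (fin _ _ ks); apply: (le_trans (ler_normB _ _)); exact: bnd.
Qed.

(** Write r^N = q^N q^N with q the square root of [r]: one factor absorbs N + 1, by comparison with
    the geometric series, and the other tends to 0. *)
Lemma fourier_tail_cvg0 r : 0 <= r < 1 -> fourier_tail r N @[N --> \oo] --> 0.
Proof.
move=> /andP[r0 r1].
suff H : N.+1%:R * r ^+ N @[N --> \oo] --> (0 : R).
  have -> : 0 = 4 * 0 / (1 - r) ^+ 2 :> R by rewrite mulr0 mul0r.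
  by apply: cvgMr_tmp; apply: cvgMl_tmp.
pose q := Num.sqrt r.
have q0 : 0 <= q by exact: sqrtr_ge0.
have q1 : q < 1 by rewrite -sqrtr1 ltr_sqrt.
have bnd N : N.+1%:R * q ^+ N <= (1 - q)^-1.
  apply: (@le_trans _ _ (\sum_(n < N.+1) q ^+ n)).
    have -> : N.+1%:R * q ^+ N = \sum_(n < N.+1) q ^+ N.
      by rewrite sumr_const card_ord mulr_natl.
    apply: ler_sum => i _; rewrite ler_wiXn2l// ?ltW//.
    by rewrite -ltnS.
  have -> : \sum_(n < N.+1) q ^+ n = (1 - q ^+ N.+1) / (1 - q).
    have q1n : 1 - q != 0 by rewrite lt0r_neq0// subr_gt0.
    rewrite -{1}(expr1n _ N.+1) subrXX mulrC mulKf//.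
    by apply: eq_bigr => i _; rewrite expr1n mul1r.
  by rewrite ler_pdivrMr ?subr_gt0// mulVf ?lt0r_neq0 ?subr_gt0// gerBl exprn_ge0.
apply: (@squeeze_cvgr _ _ _ _ (cst 0) (fun N => (1 - q)^-1 * q ^+ N)).
- apply: nearW => N; rewrite mulr_ge0 ?exprn_ge0//=.
  have -> : r ^+ N = q ^+ N * q ^+ N by rewrite -exprMn -expr2 sqr_sqrtr.
  by rewrite mulrA ler_wpM2r ?exprn_ge0.
- exact: cvg_cst.
- rewrite -[X in _ --> X](mulr0 (1 - q)^-1); apply: cvgMl_tmp; apply: cvg_expr.
  by rewrite ger0_norm.
Qed.

End FourierKernels.

(** * Orthogonality of harmonics and Fourier expansion of the kernels *)

Section Harmonics.
Variable R : realType.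
Notation mu := (@lebesgue_measure R).
Implicit Types (r u x t a b k : R) (n N : nat) (h : R -> R).

Lemma integrable_itv_sum a b (F : nat -> R -> R) M N :
  (forall n, mu.-integrable `[a, b] (EFin \o F n)) ->
  mu.-integrable `[a, b] (EFin \o (fun t => \sum_(M <= n < N) F n t)).
Proof.
move=> Fi.
have i0 : mu.-integrable `[a, b] (EFin \o (fun=> 0 : R)).
  by apply: integrable_itv_cont => t _; exact: cvg_cst.
elim: N => [|N IH].
  by apply: eq_integrable i0 => // t _ /=; rewrite big_geq.
have [MN|NM] := leqP M N; last first.
  by apply: eq_integrable i0 => // t _ /=; rewrite big_geq.
have := integrable_itvD IH (Fi N); apply: eq_integrable => // t _ /=.
by rewrite big_nat_recr.
Qed.

Lemma int_itv_sum a b (F : nat -> R -> R) M N :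
  (forall n, mu.-integrable `[a, b] (EFin \o F n)) ->
  \int[mu]_(t in `[a, b]) (\sum_(M <= n < N) F n t) =
  \sum_(M <= n < N) \int[mu]_(t in `[a, b]) F n t.
Proof.
move=> Fi.
have i0 : \int[mu]_(t in `[a, b]) (0 : R) = 0 by rewrite Rintegral_cst// mul0r.
elim: N => [|N IH].
  by rewrite big_geq// -[RHS]i0; apply: eq_Rintegral => t _; rewrite big_geq.
have [MN|NM] := leqP M N; last first.
  by rewrite big_geq// -[RHS]i0; apply: eq_Rintegral => t _; rewrite big_geq.
rewrite big_nat_recr//= -IH -RintegralD//; last exact: integrable_itv_sum.
by apply: eq_Rintegral => t _; rewrite big_nat_recr.
Qed.

Lemma continuous_cosM k : continuous (fun t => cos (k * t)).
Proof.
move=> t; apply: continuous_comp; last exact: continuous_cos.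
by apply: cvgMl_tmp; exact: cvg_id.
Qed.

Lemma continuous_sinM k : continuous (fun t => sin (k * t)).
Proof.
move=> t; apply: continuous_comp; last exact: continuous_sin.
by apply: cvgMl_tmp; exact: cvg_id.
Qed.

Lemma is_derive_cosM k t : is_derive t (1 : R) (fun t => cos (k * t)) (- k * sin (k * t)).
Proof.
have dl : is_derive t (1 : R) (fun t : R => k * t) k.
  apply: is_derive_eq; rewrite /GRing.scale/=; ring.
apply: (is_derive_eq (@is_derive1_comp _ cos (fun t => k * t) t _ _ (is_derive_cos _) dl)).
by ring.
Qed.

Lemma is_derive_sinM k t : is_derive t (1 : R) (fun t => sin (k * t)) (k * cos (k * t)).
Proof.
have dl : is_derive t (1 : R) (fun t : R => k * t) k.
  apply: is_derive_eq; rewrite /GRing.scale/=; ring.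
apply: (is_derive_eq (@is_derive1_comp _ sin (fun t => k * t) t _ _ (is_derive_sin _) dl)).
by ring.
Qed.

Lemma continuous_scale a h : continuous h -> continuous (fun t => a * h t).
Proof. by move=> ch t; apply: cvgMl_tmp; exact: ch. Qed.

Let Npi_le_pi : - pi <= pi :> R.
Proof. by have := pi_ge0 R; lra. Qed.

Lemma int_cosM_pi k : k != 0 -> sin (k * pi) = 0 ->
  \int[mu]_(t in `[- pi, pi]) cos (k * t) = 0.
Proof.
move=> k0 sk.
have dF t : t \in `[- pi, pi] ->
    is_derive t (1 : R) (fun t => k^-1 * sin (k * t)) (cos (k * t)).
  move=> _; apply: (is_derive_eq (is_deriveZ _ (is_derive_sinM k t))).
  by rewrite /GRing.scale/= mulKf.
rewrite (int_itv_deriv Npi_le_pi dF); last by move=> t _; exact: continuous_cosM.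
by rewrite mulrN sinN sk oppr0 mulr0 subrr.
Qed.

Lemma int_sinM_pi k : \int[mu]_(t in `[- pi, pi]) sin (k * t) = 0.
Proof.
have [->|k0] := eqVneq k 0.
  rewrite (@eq_Rintegral _ _ _ mu `[- pi, pi]%classic (fun=> 0)) ?Rintegral_cst ?mul0r// => t _.
  by rewrite mul0r sin0.
have dF t : t \in `[- pi, pi] ->
    is_derive t (1 : R) (fun t => - k^-1 * cos (k * t)) (sin (k * t)).
  move=> _; apply: (is_derive_eq (is_deriveZ _ (is_derive_cosM k t))).
  by rewrite /GRing.scale/= mulrA mulrNN mulVf// mul1r.
rewrite (int_itv_deriv Npi_le_pi dF); last by move=> t _; exact: continuous_sinM.
by rewrite mulrN cosN subrr.
Qed.

Lemma sin_natpi n : sin (n%:R * pi) = 0 :> R.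
Proof.
elim: n => [|n IH]; first by rewrite mul0r sin0.
by rewrite sinSn IH sinpi mul0r mulr0 addr0.
Qed.

Definition harmonic n a b t : R := a * cos (n%:R * t) + b * sin (n%:R * t).

Lemma continuous_harmonic n a b : continuous (harmonic n a b).
Proof.
move=> t; apply: cvgD; apply: cvgMl_tmp; [exact: continuous_cosM|exact: continuous_sinM].
Qed.

(** For n = 0 the sine is zero and the squared norm of the cosine is 2 pi instead of pi, hence the
    inner case. All other integrals vanish because the sum and the difference of the frequencies are
    integers. *)
Lemma int_harmonicM n m a b a' b' :
  \int[mu]_(t in `[- pi, pi]) (harmonic n a b t * harmonic m a' b' t) =
  if n == m then (if n == 0%N then 2 * pi * (a * a') else pi * (a * a' + b * b')) else 0.
Proof.
pose k : R := n%:R - m%:R; pose l : R := n%:R + m%:R.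
have sk : sin (k * pi) = 0.
  by rewrite mulrBl sinB !sin_natpi mul0r mulr0 subrr.
have sl : sin (l * pi) = 0.
  by rewrite mulrDl sinD !sin_natpi mul0r mulr0 addr0.
have iC c (d : R) : mu.-integrable `[- pi, pi] (EFin \o (fun t => c * cos (d * t))).
  by apply: integrable_itv_cont => t _; apply: continuous_scale; exact: continuous_cosM.
have iS c (d : R) : mu.-integrable `[- pi, pi] (EFin \o (fun t => c * sin (d * t))).
  by apply: integrable_itv_cont => t _; apply: continuous_scale; exact: continuous_sinM.
have iC1 (d : R) : mu.-integrable `[- pi, pi] (EFin \o (fun t => cos (d * t))).
  by apply: integrable_itv_cont => t _; exact: continuous_cosM.
have iS1 (d : R) : mu.-integrable `[- pi, pi] (EFin \o (fun t => sin (d * t))).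
  by apply: integrable_itv_cont => t _; exact: continuous_sinM.
transitivity (\int[mu]_(t in `[- pi, pi])
    ((a * a' + b * b') / 2 * cos (k * t) + (a * a' - b * b') / 2 * cos (l * t) +
     ((a * b' + b * a') / 2 * sin (l * t) + (b * a' - a * b') / 2 * sin (k * t)))).
  apply: eq_Rintegral => t _; rewrite /harmonic /k /l !mulrDl !mulNr.
  by rewrite cosB cosD sinB sinD; field.
pose c1 := (a * a' + b * b') / 2; pose c2 := (a * a' - b * b') / 2.
pose c3 := (a * b' + b * a') / 2; pose c4 := (b * a' - a * b') / 2.
rewrite (@RintegralD _ _ _ mu `[- pi, pi]%classic
  (fun t => c1 * cos (k * t) + c2 * cos (l * t))
  (fun t => c3 * sin (l * t) + c4 * sin (k * t)))//; [|exact: integrable_itvD|exact: integrable_itvD].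
rewrite (@RintegralD _ _ _ mu `[- pi, pi]%classic
  (fun t => c1 * cos (k * t)) (fun t => c2 * cos (l * t)))//.
rewrite (@RintegralD _ _ _ mu `[- pi, pi]%classic
  (fun t => c3 * sin (l * t)) (fun t => c4 * sin (k * t)))//.
rewrite !RintegralZl// !int_sinM_pi !mulr0 !addr0 /c1 /c2.
have cst1 : \int[mu]_(t in `[- pi, pi]) cos (0 * t) = 2 * pi.
  rewrite (@eq_Rintegral _ _ _ mu `[- pi, pi]%classic (fun=> 1)) ?int_itv_cst//; first by ring.
  by move=> t _; rewrite mul0r cos0.
case: eqVneq => [nm|nm].
  have -> : k = 0 by rewrite /k nm subrr.
  rewrite cst1; case: eqVneq => n0.
    have -> : l = 0 by rewrite /l -nm n0 addr0.
    by rewrite cst1; field.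
  rewrite int_cosM_pi//; first by field.
  by rewrite /l -nm -natrD pnatr_eq0 addn_eq0 (negbTE n0).
rewrite !int_cosM_pi// ?mulr0 ?addr0//.
- rewrite /l -natrD pnatr_eq0 addn_eq0; apply: contra nm => /andP[/eqP-> /eqP->]//.
- by rewrite /k subr_eq0 eqr_nat.
Qed.

Lemma continuous_dconj_poisson_sub r x : 0 <= r < 1 ->
  continuous (fun t => dconj_poisson r (x - t)).
Proof.
move=> r01 t; apply: (@continuous_comp _ _ _ (fun t => x - t)).
  by apply: cvgB; [exact: cvg_cst|exact: cvg_id].
exact: continuous_dconj_poisson.
Qed.

Lemma continuous_dpoisson_sub r x : 0 <= r < 1 ->
  continuous (fun t => dpoisson r (x - t)).
Proof.
move=> r01 t; apply: (@continuous_comp _ _ _ (fun t => x - t)).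
  by apply: cvgB; [exact: cvg_cst|exact: cvg_id].
exact: continuous_dpoisson.
Qed.

Lemma int_kernel_cvg (k : R -> R) (k_ : nat -> R -> R) (e_ : nat -> R) h :
  continuous h -> continuous k -> (forall n, continuous (k_ n)) ->
  (forall n t, `|k t - k_ n t| <= e_ n) -> e_ n @[n --> \oo] --> 0 ->
  \int[mu]_(t in `[- pi, pi]) (h t * k_ n t) @[n --> \oo] -->
  \int[mu]_(t in `[- pi, pi]) (h t * k t).
Proof.
move=> ch ck ck_ kk e0.
have [C C0 hC] := bounded_itv_cont (fun t (_ : t \in `[- pi, pi]) => ch t).
have ci (f g : R -> R) : continuous f -> continuous g ->
    mu.-integrable `[- pi, pi] (EFin \o (fun t => f t * g t)).
  by move=> cf cg; apply: integrable_itv_cont => t _; apply: cvgM; [exact: cf|exact: cg].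
have bnd n : `|\int[mu]_(t in `[- pi, pi]) (h t * k t) -
    \int[mu]_(t in `[- pi, pi]) (h t * k_ n t)| <= e_ n * (C * (pi - - pi)).
  rewrite -RintegralB//; [|exact: ci|exact: ci].
  rewrite mulrA -int_itv_cst//; apply: le_int_itv.
  - by apply: integrable_itvB; exact: ci.
  - by apply: integrable_itv_cont => t _; exact: cvg_cst.
  - by move=> t tp; rewrite -mulrBr normrM mulrC ler_pM// hC.
apply/cvgrPdist_le => e eps0.
have : e_ n * (C * (pi - - pi)) @[n --> \oo] --> (0 : R).
  by rewrite -(mul0r (C * (pi - - pi))); exact: cvgMr_tmp.
move=> /cvgrPdist_le /(_ e eps0); apply: filterS => n.
rewrite sub0r normrN => /(le_trans (ler_norm _)); exact: le_trans.
Qed.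

Lemma dconj_poisson_fourier r x h : 0 <= r < 1 -> continuous h ->
  2 * \sum_(0 <= n < N) n%:R * r ^+ n *
     \int[mu]_(t in `[- pi, pi]) (h t * harmonic n (cos (n%:R * x)) (sin (n%:R * x)) t)
  @[N --> \oo] --> \int[mu]_(t in `[- pi, pi]) (h t * dconj_poisson r (x - t)).
Proof.
move=> r01 ch.
pose k_ N t := \sum_(0 <= n < N) 2 * (n%:R * r ^+ n) *
   harmonic n (cos (n%:R * x)) (sin (n%:R * x)) t.
have ck_ N : continuous (k_ N).
  elim: N => [|N IH] t.
    have -> : k_ 0%N = (fun=> 0) by apply/funext => s; rewrite /k_ big_geq.
    exact: cvg_cst.
  have -> : k_ N.+1 = (fun s => k_ N s + 2 * (N%:R * r ^+ N) *
     harmonic N (cos (N%:R * x)) (sin (N%:R * x)) s).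
    by apply/funext => s; rewrite /k_ big_nat_recr.
  by apply: cvgD; [exact: IH|apply: continuous_scale; exact: continuous_harmonic].
have kE N t : k_ N t = 2 * dconj_sum r N (x - t).
  rewrite /k_ /dconj_sum big_mkord mulr_sumr; apply: eq_bigr => n _.
  by rewrite /harmonic mulrBr cosB; ring.
have := @int_kernel_cvg (fun t => dconj_poisson r (x - t)) k_
  (fun N => 2 * fourier_tail r N) h ch (@continuous_dconj_poisson_sub r x r01) ck_.
have tail0 : 2 * fourier_tail r N @[N --> \oo] --> 0.
  by rewrite -(mulr0 2); apply: cvgMl_tmp; exact: fourier_tail_cvg0.
move=> /(_ _ tail0).
have kk N t : `|dconj_poisson r (x - t) - k_ N t| <= 2 * fourier_tail r N.
  by rewrite kE; case: (dconj_dpoisson_sum_le (x - t) N r01).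
move=> /(_ kk) H; apply: cvg_trans H; apply: near_eq_cvg; apply: nearW => N /=.
under eq_Rintegral do rewrite /k_ mulr_sumr.
rewrite int_itv_sum; last first.
  move=> n; apply: integrable_itv_cont => t _; apply: cvgM; first exact: ch.
  by apply: continuous_scale; exact: continuous_harmonic.
rewrite mulr_sumr; apply: eq_bigr => n _.
under eq_Rintegral do rewrite mulrCA.
rewrite RintegralZl// ?mulrA//.
apply: integrable_itv_cont => t _; apply: cvgM; first exact: ch.
exact: continuous_harmonic.
Qed.

Lemma dpoisson_fourier r x h : 0 <= r < 1 -> continuous h ->
  -2 * \sum_(0 <= n < N) n%:R * r ^+ n *
     \int[mu]_(t in `[- pi, pi]) (h t * harmonic n (sin (n%:R * x)) (- cos (n%:R * x)) t)
  @[N --> \oo] --> \int[mu]_(t in `[- pi, pi]) (h t * dpoisson r (x - t)).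
Proof.
move=> r01 ch.
pose k_ N t := \sum_(0 <= n < N) -2 * (n%:R * r ^+ n) *
   harmonic n (sin (n%:R * x)) (- cos (n%:R * x)) t.
have ck_ N : continuous (k_ N).
  elim: N => [|N IH] t.
    have -> : k_ 0%N = (fun=> 0) by apply/funext => s; rewrite /k_ big_geq.
    exact: cvg_cst.
  have -> : k_ N.+1 = (fun s => k_ N s + -2 * (N%:R * r ^+ N) *
     harmonic N (sin (N%:R * x)) (- cos (N%:R * x)) s).
    by apply/funext => s; rewrite /k_ big_nat_recr.
  by apply: cvgD; [exact: IH|apply: continuous_scale; exact: continuous_harmonic].
have kE N t : k_ N t = - (2 * dpoisson_sum r N (x - t)).
  rewrite /k_ /dpoisson_sum big_mkord mulr_sumr -sumrN; apply: eq_bigr => n _.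
  by rewrite /harmonic mulrBr sinB; ring.
have := @int_kernel_cvg (fun t => dpoisson r (x - t)) k_
  (fun N => 2 * fourier_tail r N) h ch (@continuous_dpoisson_sub r x r01) ck_.
have tail0 : 2 * fourier_tail r N @[N --> \oo] --> 0.
  by rewrite -(mulr0 2); apply: cvgMl_tmp; exact: fourier_tail_cvg0.
move=> /(_ _ tail0).
have kk N t : `|dpoisson r (x - t) - k_ N t| <= 2 * fourier_tail r N.
  by rewrite kE opprK; case: (dconj_dpoisson_sum_le (x - t) N r01).
move=> /(_ kk) H; apply: cvg_trans H; apply: near_eq_cvg; apply: nearW => N /=.
under eq_Rintegral do rewrite /k_ mulr_sumr.
rewrite int_itv_sum; last first.
  move=> n; apply: integrable_itv_cont => t _; apply: cvgM; first exact: ch.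
  by apply: continuous_scale; exact: continuous_harmonic.
rewrite mulr_sumr; apply: eq_bigr => n _.
under eq_Rintegral do rewrite mulrCA.
rewrite RintegralZl// ?mulrA//.
apply: integrable_itv_cont => t _; apply: cvgM; first exact: ch.
exact: continuous_harmonic.
Qed.

Lemma sum_pick (F : nat -> R) (c : R) n N : (n < N)%N ->
  (forall m, F m = if n == m then c else 0) -> \sum_(0 <= m < N) F m = c.
Proof.
move=> nN FE; rewrite big_mkord (bigD1 (Ordinal nN))//= FE eqxx big1 ?addr0// => i.
by rewrite FE -val_eqE/= eq_sym => /negbTE ->.
Qed.

(** Once N > n the Fourier sum has a single term that can be nonzero, so the limit equals that term:
    harmonics are eigenfunctions of this convolution. *)
Lemma int_harmonic_dconj_poisson r x n a b : 0 <= r < 1 ->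
  \int[mu]_(t in `[- pi, pi]) (harmonic n a b t * dconj_poisson r (x - t)) =
  2 * pi * (n%:R * r ^+ n) * harmonic n a b x.
Proof.
move=> r01; have H := @dconj_poisson_fourier r x _ r01 (@continuous_harmonic n a b).
apply: (cvg_unique _ H) => //; apply: cvg_near_cst.
near=> N; rewrite (@sum_pick _ (pi * (n%:R * r ^+ n) * harmonic n a b x) n)//.
- by rewrite !mulrA.
- by near: N; exact: nbhs_infty_gt.
- move=> m; rewrite int_harmonicM; case: eqVneq => [<-|_]; last by rewrite mulr0.
  case: eqVneq => [->|_]; first by rewrite !(mul0r, mulr0).
  by rewrite /harmonic; ring.
Unshelve. all: by end_near. Qed.

Lemma int_harmonic_dpoisson r x n a b : 0 <= r < 1 ->
  \int[mu]_(t in `[- pi, pi]) (harmonic n a b t * dpoisson r (x - t)) =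
  -2 * pi * (n%:R * r ^+ n) * harmonic n (- b) a x.
Proof.
move=> r01; have H := @dpoisson_fourier r x _ r01 (@continuous_harmonic n a b).
apply: (cvg_unique _ H) => //; apply: cvg_near_cst.
near=> N; rewrite (@sum_pick _ (pi * (n%:R * r ^+ n) * harmonic n (- b) a x) n)//.
- by rewrite !mulrA.
- by near: N; exact: nbhs_infty_gt.
- move=> m; rewrite int_harmonicM; case: eqVneq => [<-|_]; last by rewrite mulr0.
  case: eqVneq => [->|_]; first by rewrite !(mul0r, mulr0).
  by rewrite /harmonic; ring.
Unshelve. all: by end_near. Qed.

End Harmonics.

(** * Bessel's inequality and the Fourier coefficients of a Lipschitz function *)

Section Bessel.
Variable R : realType.
Notation mu := (@lebesgue_measure R).
Implicit Types (r u x t a b k : R) (n N : nat) (h : R -> R).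

Let Npi_le_pi : - pi <= pi :> R.
Proof. by have := pi_ge0 R; lra. Qed.

Let integrable_mul (f g : R -> R) a b : continuous f -> continuous g ->
  mu.-integrable `[a, b] (EFin \o (fun t => f t * g t)).
Proof. by move=> cf cg; apply: integrable_itv_cont => t _; apply: cvgM; [exact: cf|exact: cg]. Qed.

Lemma continuous_sum (F : nat -> R -> R) M N : (forall n, continuous (F n)) ->
  continuous (fun t => \sum_(M <= n < N) F n t).
Proof.
move=> cF; elim: N => [|N IH] t.
  have -> : (fun t => \sum_(M <= n < 0) F n t) = (fun=> 0).
    by apply/funext => s; rewrite big_geq.
  exact: cvg_cst.
have [MN|NM] := leqP M N; last first.
  have -> : (fun t => \sum_(M <= n < N.+1) F n t) = (fun=> 0).
    by apply/funext => s; rewrite big_geq.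
  exact: cvg_cst.
have -> : (fun t => \sum_(M <= n < N.+1) F n t) =
    (fun t => \sum_(M <= n < N) F n t + F N t).
  by apply/funext => s; rewrite big_nat_recr.
by apply: cvgD; [exact: IH|exact: cF].
Qed.

Definition trig_sum (a b : nat -> R) M N t := \sum_(M <= n < N) harmonic n (a n) (b n) t.

Lemma continuous_trig_sum (a b : nat -> R) M N : continuous (trig_sum a b M N).
Proof. by apply: continuous_sum => n; exact: continuous_harmonic. Qed.

Lemma int_trig_sumM h (a b : nat -> R) M N : continuous h ->
  \int[mu]_(t in `[- pi, pi]) (h t * trig_sum a b M N t) =
  \sum_(M <= n < N) (a n * \int[mu]_(t in `[- pi, pi]) (h t * cos (n%:R * t)) +
                     b n * \int[mu]_(t in `[- pi, pi]) (h t * sin (n%:R * t))).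
Proof.
move=> ch; rewrite /trig_sum; under eq_Rintegral do rewrite mulr_sumr.
rewrite int_itv_sum; last first.
  by move=> n; apply: integrable_mul => //; exact: continuous_harmonic.
apply: eq_bigr => n _.
have i1 := @integrable_mul h _ (- pi) pi ch (@continuous_cosM _ n%:R).
have i2 := @integrable_mul h _ (- pi) pi ch (@continuous_sinM _ n%:R).
rewrite -!RintegralZl// -RintegralD//; [|exact: integrable_itvZ|exact: integrable_itvZ].
by apply: eq_Rintegral => t _; rewrite /harmonic; ring.
Qed.

Lemma int_trig_sum_sqr (a b : nat -> R) M N :
  \int[mu]_(t in `[- pi, pi]) (trig_sum a b M.+1 N t ^+ 2) =
  pi * \sum_(M.+1 <= n < N) (a n ^+ 2 + b n ^+ 2).
Proof.
under eq_Rintegral do rewrite expr2.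
under eq_Rintegral do rewrite {2}/trig_sum mulr_sumr.
rewrite int_itv_sum; last first.
  move=> n; apply: integrable_mul; first exact: continuous_trig_sum.
  exact: continuous_harmonic.
rewrite mulr_sumr big_nat_cond [RHS]big_nat_cond; apply: eq_bigr => n; rewrite andbT => /andP[Mn nN].
rewrite /trig_sum; under eq_Rintegral do rewrite mulr_suml.
rewrite int_itv_sum; last first.
  by move=> m; apply: integrable_mul; exact: continuous_harmonic.
under eq_bigr do rewrite int_harmonicM.
rewrite -big_mkcond/= big_nat1_eq Mn nN -!expr2.
by rewrite gtn_eqF// (leq_trans _ Mn).
Qed.

(** The coefficients are not divided by pi, so the square to expand is that of [pi * h - S]. *)
Lemma bessel h N : continuous h ->
  \sum_(1 <= n < N) ((\int[mu]_(t in `[- pi, pi]) (h t * cos (n%:R * t))) ^+ 2 +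
                     (\int[mu]_(t in `[- pi, pi]) (h t * sin (n%:R * t))) ^+ 2)
  <= pi * \int[mu]_(t in `[- pi, pi]) (h t ^+ 2).
Proof.
move=> ch; have pi0 := pi_gt0 R.
pose a n := \int[mu]_(t in `[- pi, pi]) (h t * cos (n%:R * t)).
pose b n := \int[mu]_(t in `[- pi, pi]) (h t * sin (n%:R * t)).
pose S := trig_sum a b 1 N; have cS : continuous S by exact: continuous_trig_sum.
set A := \sum_(1 <= n < N) _.
have AE : A = \int[mu]_(t in `[- pi, pi]) (h t * S t).
  by rewrite int_trig_sumM.
have SE : \int[mu]_(t in `[- pi, pi]) (S t * S t) = pi * A.
  rewrite -int_trig_sum_sqr; apply: eq_Rintegral => t _.
  by rewrite expr2.
have HE : \int[mu]_(t in `[- pi, pi]) (h t * h t) =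
    \int[mu]_(t in `[- pi, pi]) (h t ^+ 2).
  by apply: eq_Rintegral => t _; rewrite expr2.
have : 0 <= \int[mu]_(t in `[- pi, pi]) ((pi * h t - S t) ^+ 2).
  by apply: Rintegral_ge0 => t _; exact: sqr_ge0.
have -> : \int[mu]_(t in `[- pi, pi]) ((pi * h t - S t) ^+ 2) =
   \int[mu]_(t in `[- pi, pi]) (pi ^+ 2 * (h t * h t) - 2 * pi * (h t * S t) + S t * S t).
  by apply: eq_Rintegral => t _; ring.
have ihh := @integrable_mul h h (- pi) pi ch ch.
have ihS := @integrable_mul h S (- pi) pi ch cS.
have iSS := @integrable_mul S S (- pi) pi cS cS.
rewrite (@RintegralD _ _ _ mu `[- pi, pi]%classic
  (fun t => pi ^+ 2 * (h t * h t) - 2 * pi * (h t * S t)) (fun t => S t * S t))//; last first.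
  by apply: integrable_itvB; exact: integrable_itvZ.
rewrite RintegralB//; [|exact: integrable_itvZ|exact: integrable_itvZ].
rewrite RintegralZl// RintegralZl// SE -AE HE.
have -> : pi ^+ 2 * \int[mu]_(t in `[- pi, pi]) (h t ^+ 2) - 2 * pi * A + pi * A =
  pi * (pi * \int[mu]_(t in `[- pi, pi]) (h t ^+ 2) - A) by ring.
by rewrite pmulr_rge0// subr_ge0.
Qed.

Lemma int_pi_periodic_shift (f : R -> R) (M c : R) : measurable_fun setT f ->
  (forall x, `|f x| <= M) -> periodic f (2 * pi) ->
  \int[mu]_(x in `[- pi, pi]) f (x + c) = \int[mu]_(x in `[- pi, pi]) f x.
Proof.
move=> mf fM pf; have := @int_itv_periodic_shift R f M (2 * pi) c (- pi).
rewrite (_ : - pi + 2 * pi = pi); last by ring.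
by apply => //; rewrite mulr_gt0// pi_gt0.
Qed.

Section Lipschitz.
Variables (G : R -> R) (L M : R).
Hypothesis GL : forall x y, `|G x - G y| <= L * `|x - y|.
Hypothesis GM : forall x, `|G x| <= M.
Hypothesis Gper : periodic G (2 * pi).

Lemma lipschitz_continuous : continuous G.
Proof.
move=> x; apply/cvgrPdist_le => e e0.
have L1 : 0 < `|L| + 1 by rewrite ltr_wpDl.
near=> y; apply: (le_trans (GL x y)).
apply: (@le_trans _ _ ((`|L| + 1) * `|x - y|)).
  by rewrite ler_wpM2r// ler_wpDr// ler_norm.
rewrite mulrC -ler_pdivlMr//; near: y.
apply/nbhs_ballP; exists (e / (`|L| + 1)); first by rewrite /= divr_gt0.
by move=> z /= /ltW.
Unshelve. all: by end_near. Qed.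

Let cG := lipschitz_continuous.

Definition cos_coef n := \int[mu]_(t in `[- pi, pi]) (G t * cos (n%:R * t)).
Definition sin_coef n := \int[mu]_(t in `[- pi, pi]) (G t * sin (n%:R * t)).

Let cos_per n : periodic (fun t : R => cos (n%:R * t)) (2 * pi).
Proof.
move=> t; rewrite mulrDr -(periodic_int n (n%:R * t) (@cosD2pi R)).
by congr cos; rewrite mulr2n; ring.
Qed.

Let sin_per n : periodic (fun t : R => sin (n%:R * t)) (2 * pi).
Proof.
move=> t; rewrite mulrDr -(periodic_int n (n%:R * t) (@sinD2pi R)).
by congr sin; rewrite mulr2n; ring.
Qed.

Let int_shift (F : R -> R) c : continuous F -> (forall t, `|F t| <= 1) ->
  periodic F (2 * pi) ->
  \int[mu]_(t in `[- pi, pi]) (G (t + c) * F t) =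
  \int[mu]_(t in `[- pi, pi]) (G t * F (t - c)).
Proof.
move=> cF F1 pF.
have cFc : continuous (fun t => F (t - c)).
  move=> t; apply: (@continuous_comp _ _ _ (fun t => t - c)); last exact: cF.
  by apply: cvgB; [exact: cvg_id|exact: cvg_cst].
rewrite -[RHS](@int_pi_periodic_shift (fun t => G t * F (t - c)) M c).
- by apply: eq_Rintegral => t _; rewrite addrK.
- apply: continuous_measurable_fun => t; apply: cvgM; [exact: cG|exact: cFc].
- move=> t; rewrite normrM -[leRHS]mulr1; exact: ler_pM.
- by move=> t; rewrite Gper addrAC pF.
Qed.

(** The symmetric difference quotient of [G] is bounded by [L]. Moving the translations onto the
    harmonics multiplies the coefficients by sin (n h) / h, up to sign, and exchanges cosine and
    sine. *)
Let bessel_diff N (h : R) : h != 0 ->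
  \sum_(1 <= n < N) (sin (n%:R * h) / h) ^+ 2 * (cos_coef n ^+ 2 + sin_coef n ^+ 2)
  <= 2 * pi ^+ 2 * L ^+ 2.
Proof.
move=> h0; have pi0 := pi_gt0 R.
pose D t := (G (t + h) - G (t - h)) / (2 * h).
have cGs c : continuous (fun t => G (t + c)).
  move=> t; apply: (@continuous_comp _ _ _ (fun t => t + c)); last exact: cG.
  by apply: cvgD; [exact: cvg_id|exact: cvg_cst].
have cD : continuous D.
  by move=> t; apply: cvgMr_tmp; apply: cvgB; [exact: cGs|exact: (cGs (- h))].
have intD (F : R -> R) : continuous F -> (forall t, `|F t| <= 1) ->
    periodic F (2 * pi) -> \int[mu]_(t in `[- pi, pi]) (D t * F t) =
    \int[mu]_(t in `[- pi, pi]) (G t * ((F (t - h) - F (t + h)) / (2 * h))).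
  move=> cF F1 pF.
  have cFs c : continuous (fun t => F (t + c)).
    move=> t; apply: (@continuous_comp _ _ _ (fun t => t + c)); last exact: cF.
    by apply: cvgD; [exact: cvg_id|exact: cvg_cst].
  transitivity (\int[mu]_(t in `[- pi, pi])
      ((2 * h)^-1 * (G (t + h) * F t - G (t - h) * F t))).
    by apply: eq_Rintegral => t _; rewrite /D; field.
  have i1 c := @integrable_mul _ _ (- pi) pi (@cGs c) cF.
  have i2 c := @integrable_mul _ _ (- pi) pi cG (@cFs c).
  rewrite RintegralZl//; last by apply: integrable_itvB; [exact: i1|exact: (i1 (- h))].
  rewrite RintegralB//.
  rewrite int_shift// (int_shift (- h))//.
  under [X in _ * (_ - X)]eq_Rintegral do rewrite opprK.
  rewrite -RintegralB//.
  rewrite -RintegralZl//; last by apply: integrable_itvB; [exact: (i2 (- h))|exact: i2].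
  by apply: eq_Rintegral => t _; field.
have cosC n : \int[mu]_(t in `[- pi, pi]) (D t * cos (n%:R * t)) = sin (n%:R * h) / h * sin_coef n.
  rewrite intD//; [|exact: continuous_cosM|by move=> t; exact: cos_max].
  rewrite /sin_coef -RintegralZl//; last first.
    by apply: integrable_mul => //; exact: continuous_sinM.
  apply: eq_Rintegral => t _; rewrite mulrBr mulrDr cosB cosD.
  by field.
have sinC n : \int[mu]_(t in `[- pi, pi]) (D t * sin (n%:R * t)) = - (sin (n%:R * h) / h) * cos_coef n.
  rewrite intD//; [|exact: continuous_sinM|by move=> t; exact: sin_max].
  rewrite /cos_coef -RintegralZl//; last first.
    by apply: integrable_mul => //; exact: continuous_cosM.
  apply: eq_Rintegral => t _; rewrite mulrBr mulrDr sinB sinD.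
  by field.
have := bessel N cD; set B := \sum_(1 <= n < N) _.
have -> : B = \sum_(1 <= n < N) (sin (n%:R * h) / h) ^+ 2 * (cos_coef n ^+ 2 + sin_coef n ^+ 2).
  by apply: eq_bigr => n _; rewrite cosC sinC; ring.
move=> /le_trans; apply.
have -> : 2 * pi ^+ 2 * L ^+ 2 = pi * (L ^+ 2 * (pi - - pi)) by ring.
rewrite ler_pM2l// -int_itv_cst//.
apply: le_Rintegral => //.
- apply: integrable_itv_cont => t _; have -> : (fun t => D t ^+ 2) = (fun t => D t * D t).
    by apply/funext => u; rewrite expr2.
  by apply: cvgM; exact: cD.
- by apply: integrable_itv_cont => t _; exact: cvg_cst.
- move=> t _; rewrite -[leLHS]real_normK ?num_real//.
  have Dt : `|D t| <= L.
    rewrite /D normrM normfV ler_pdivrMr; last by rewrite normr_gt0 mulf_neq0.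
    have := GL (t + h) (t - h); rewrite (_ : t + h - (t - h) = 2 * h)//; ring.
  by rewrite lerXn2r// nnegrE (le_trans _ Dt).
Qed.

(** The sum is finite, so h can tend to 0 term by term in [bessel_diff]; this replaces any appeal to
    a derivative of [G]. *)
Lemma sum_coef_le N :
  \sum_(1 <= n < N) n%:R ^+ 2 * (cos_coef n ^+ 2 + sin_coef n ^+ 2) <= 2 * pi ^+ 2 * L ^+ 2.
Proof.
have lim n : (fun h : R => sin (n%:R * h) / h) h @[h --> (0 : R)^'] --> (n%:R : R).
  have [d1 d2] := @is_derive_sinM R n%:R 0.
  have := d1; rewrite /derivable => /cvg_ex[l hl].
  have ln : l = n%:R * cos (n%:R * 0).
    rewrite -d2; apply/esym; apply: cvg_lim => //.
  rewrite ln mulr0 cos0 mulr1 in hl; apply: cvg_trans hl.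
  apply: near_eq_cvg; apply: nearW => h /=.
  by rewrite /GRing.scale/= mulr1 addr0 sin0 subr0 mulrC.
have lims : (fun h : R => \sum_(1 <= n < N) (sin (n%:R * h) / h) ^+ 2 *
    (cos_coef n ^+ 2 + sin_coef n ^+ 2)) h @[h --> (0 : R)^'] -->
    \sum_(1 <= n < N) n%:R ^+ 2 * (cos_coef n ^+ 2 + sin_coef n ^+ 2).
  elim: N => [|N IH].
    rewrite big_geq//; under eq_fun do rewrite big_geq//; exact: cvg_cst.
  case: N IH => [_|N IH].
    rewrite big_geq//; under eq_fun do rewrite big_geq//; exact: cvg_cst.
  rewrite big_nat_recr//=; under eq_fun do rewrite big_nat_recr//=.
  apply: cvgD; first exact: IH.
  apply: cvgMr_tmp; under eq_fun do rewrite expr2; rewrite expr2.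
  by apply: cvgM; exact: lim.
rewrite -(cvg_lim (@Rhausdorff R) lims); apply: limr_le; first by apply/cvg_ex; eexists; exact: lims.
near=> h; apply: bessel_diff.
by near: h; exact: nbhs_dnbhs_neq.
Unshelve. all: by end_near. Qed.

End Lipschitz.
End Bessel.

(** * Completeness of L^1 for rapidly Cauchy sequences *)

Section L1Limit.
Variable R : realType.
Notation mu := (@lebesgue_measure R).

(** The sum [D] of the absolute increments is integrable, so it is finite almost everywhere. There
    the sequence converges, and [|H 0| + D] dominates it. *)
Lemma L1_fast_cauchy_cvg (a b : R) (H : nat -> R -> R) (C : R) :
  (forall n, continuous (H n)) ->
  (forall N, \sum_(0 <= n < N) \int[mu]_(t in `[a, b]) `|H n.+1 t - H n t| <= C) ->
  exists g : R -> R, mu.-integrable `[a, b] (EFin \o g) /\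
    \int[mu]_(t in `[a, b]) `|H n t - g t| @[n --> \oo] --> 0.
Proof.
move=> cH HC.
pose d n t := `|H n.+1 t - H n t|.
have cd n : continuous (d n).
  by move=> t; apply: cvg_norm; apply: cvgB; exact: cH.
have md n : measurable_fun `[a, b] (EFin \o d n).
  by apply/measurable_EFinP; apply: measurable_funTS; exact: continuous_measurable_fun.
have id n : mu.-integrable `[a, b] (EFin \o d n).
  by apply: integrable_itv_cont => t _; exact: cd.
pose D t := (\sum_(0 <= n <oo) (d n t)%:E)%E.
have D0 t : (0 <= D t)%E by apply: nneseries_ge0 => n _ _; rewrite lee_fin normr_ge0.
have mD : measurable_fun `[a, b] D.
  apply: (@ge0_emeasurable_sum _ _ _ _ (fun n t => (d n t)%:E) predT).
    by move=> n t _ _; rewrite lee_fin normr_ge0.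
  by move=> n _; exact: md.
have intD : (\int[mu]_(t in `[a, b]) D t <= C%:E)%E.
  rewrite /D (@integral_nneseries _ _ _ mu `[a, b]%classic _ (fun n t => (d n t)%:E))//; last first.
    by move=> n t _; rewrite lee_fin normr_ge0.
  apply: lime_le.
    by apply: is_cvg_nneseries => n *; apply: integral_ge0 => t _; rewrite lee_fin normr_ge0.
  apply: nearW => N.
  have -> : (\sum_(0 <= n < N) \int[mu]_(x in `[a, b]) (d n x)%:E)%E =
     (\sum_(0 <= n < N) \int[mu]_(t in `[a, b]) d n t)%:E.
    rewrite -sumEFin; apply: eq_bigr => n _.
    rewrite /Rintegral fineK//.
    by apply: (integrable_fin_num _ (id n)).
  by rewrite lee_fin; exact: HC.
have iD : mu.-integrable `[a, b] D.
  apply/integrableP; split => //.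
  have -> : (\int[mu]_(t in `[a, b]) `|D t| = \int[mu]_(t in `[a, b]) D t)%E.
    by apply: eq_integral => t _; rewrite gee0_abs.
  exact: le_lt_trans intD (ltry _).
(* The upper limit is measurable and defined everywhere, also at the points where the sequence
   diverges. *)
pose g t := fine (limn_esup (fun n => (H n t)%:E)).
have mH n : measurable_fun `[a, b] (EFin \o H n).
  by apply/measurable_EFinP; apply: measurable_funTS; exact: continuous_measurable_fun.
have mg : measurable_fun `[a, b] g.
  apply: measurableT_comp; first exact: fine_measurable.
  exact: (@measurable_fun_limn_esup _ _ _ _ (fun n t => (H n t)%:E)).
have Hg t : D t \is a fin_num -> H n t @[n --> \oo] --> g t.
  move=> Dfin; pose u n := H n.+1 t - H n t.
  have cu : cvgn (series u).
    apply: normed_cvg; apply: nondecreasing_is_cvgn.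
      by apply: nondecreasing_series => n _ _; exact: normr_ge0.
    exists (fine (D t)) => _ [N _ <-].
    rewrite -lee_fin fineK//.
    rewrite /series/= -sumEFin; apply: nneseries_lim_ge => n _ _.
    by rewrite lee_fin normr_ge0.
  have cHt : cvgn (fun n => H n t).
    have -> : (fun n => H n t) = (fun n => series u n + H 0%N t).
      by apply/funext => n; rewrite /series/= telescope_sumr// subrK.
    by apply: is_cvgD => //; exact: is_cvg_cst.
  move/cvg_ex : cHt => [/= l Hl].
  suff -> : g t = l by exact: Hl.
  rewrite /g (cvg_limn_einf_sup (l := l%:E))//.
  by apply: cvg_EFin; [exact: nearW|exact: Hl].
have Dfin := @integrable_ae _ _ _ mu `[a, b]%classic (measurable_itv _) D iD.
have iH0 : mu.-integrable `[a, b] (EFin \o (fun t => `|H 0%N t|)).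
  by apply: integrable_itv_cont => t _; apply: cvg_norm; exact: cH.
have Hle n t : (`|(H n t)%:E| <= (`|H 0%N t|)%:E + D t)%E.
  apply: (@le_trans _ _ (`|H 0%N t| + \sum_(0 <= k < n) d k t)%:E).
    rewrite lee_fin; have -> : H n t = H 0%N t + \sum_(0 <= k < n) (H k.+1 t - H k t).
      by rewrite telescope_sumr// addrC subrK.
    by rewrite (le_trans (ler_normD _ _))// lerD2l ler_norm_sum.
  rewrite EFinD leeD2l// -sumEFin.
  by apply: nneseries_lim_ge => k _ _; rewrite lee_fin normr_ge0.
have [ig H0 _] := @dominated_convergence _ _ R mu `[a, b]%classic (measurable_itv _)
  (fun n t => (H n t)%:E) (fun t => (g t)%:E) (fun t => (`|H 0%N t|)%:E + D t)%E
  mH ltac:(exact/measurable_EFinP)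
  ltac:(by apply: aeS Dfin => t Dt tab; apply: cvg_EFin; [exact: nearW|exact/Hg/Dt])
  ltac:(exact: integrableD) ltac:(by apply: aeW => t n _; exact: Hle).
exists g; split=> //.
have : (\int[mu]_(t in `[a, b]) `|(H n t)%:E - (g t)%:E|)%E @[n --> \oo] --> (0%:E)%E by exact: H0.
by move/fine_cvg.
Qed.

End L1Limit.

(** * The derivative of the conjugate function as an L^1 limit *)

Section LipschitzConjugate.
Variable R : realType.
Notation mu := (@lebesgue_measure R).
Variables (G : R -> R) (L M : R).
Hypothesis GL : forall x y, `|G x - G y| <= L * `|x - y|.
Hypothesis GM : forall x, `|G x| <= M.
Hypothesis Gper : periodic G (2 * pi).

Let cG : continuous G. Proof. exact: lipschitz_continuous GL. Qed.

Let Npi_le_pi : - pi <= pi :> R.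
Proof. by have := pi_ge0 R; lra. Qed.

Let c := cos_coef G.
Let s := sin_coef G.
Let a n := n%:R * c n.
Let b n := n%:R * s n.

(** The inequality |S| <= l / 2 + S^2 / (2 l), integrated, plays the role of Cauchy-Schwarz; it
    yields 3/2 pi l. *)
Lemma int_norm_trig_sum_le (a' b' : nat -> R) M' N l : 0 < l ->
  \sum_(M'.+1 <= n < N) (a' n ^+ 2 + b' n ^+ 2) <= l ^+ 2 ->
  \int[mu]_(t in `[- pi, pi]) `|trig_sum a' b' M'.+1 N t| <= 2 * pi * l.
Proof.
move=> l0 Sl; set S := trig_sum a' b' M'.+1 N.
have cS : continuous S by exact: continuous_trig_sum.
have iS2 : mu.-integrable `[- pi, pi] (EFin \o (fun t => S t ^+ 2)).
  apply: integrable_itv_cont => t _; have -> : (fun t => S t ^+ 2) = (fun t => S t * S t).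
    by apply/funext => u; rewrite expr2.
  by apply: cvgM; exact: cS.
have il : mu.-integrable `[- pi, pi] (EFin \o (fun=> l / 2)).
  by apply: integrable_itv_cont => t _; exact: cvg_cst.
apply: (@le_trans _ _ (\int[mu]_(t in `[- pi, pi]) (l / 2 + (2 * l)^-1 * S t ^+ 2))).
  apply: le_Rintegral => //.
  - by apply: integrable_itv_cont => t _; apply: cvg_norm; exact: cS.
  - by apply: integrable_itvD => //; exact: integrable_itvZ.
  - move=> t _; rewrite -subr_ge0 -[S t ^+ 2]real_normK ?num_real//.
    have -> : l / 2 + (2 * l)^-1 * `|S t| ^+ 2 - `|S t| = (2 * l)^-1 * (l - `|S t|) ^+ 2.
      by field; rewrite lt0r_neq0.
    by rewrite mulr_ge0 ?sqr_ge0// invr_ge0 mulr_ge0// ltW.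
rewrite RintegralD//; last exact: integrable_itvZ.
rewrite int_itv_cst// RintegralZl// int_trig_sum_sqr.
have pi0 := pi_gt0 R.
have : (2 * l)^-1 * (pi * \sum_(M'.+1 <= n < N) (a' n ^+ 2 + b' n ^+ 2)) <=
    (2 * l)^-1 * (pi * l ^+ 2).
  by rewrite ler_pM2l ?invr_gt0 ?mulr_gt0// ler_pM2l.
have -> : (2 * l)^-1 * (pi * l ^+ 2) = pi * l / 2 by field; rewrite lt0r_neq0.
have : 0 < pi * l by rewrite mulr_gt0.
lra.
Qed.

Let alpha_tail k : exists N : nat, forall n m, (N <= n)%N -> (n <= m)%N ->
  \sum_(n <= i < m) (a i ^+ 2 + b i ^+ 2) <= ((2^-1 : R) ^+ k) ^+ 2.
Proof.
pose A N := \sum_(1 <= i < N.+1) (a i ^+ 2 + b i ^+ 2).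
have A_split n m : (n <= m)%N -> A m = A n + \sum_(n.+1 <= i < m.+1) (a i ^+ 2 + b i ^+ 2).
  by move=> nm; rewrite /A (@big_cat_nat _ _ _ n.+1).
have pos i : 0 <= a i ^+ 2 + b i ^+ 2 by rewrite addr_ge0 ?sqr_ge0.
have cA : cvgn A.
  apply: nondecreasing_is_cvgn.
    by move=> n m nm; rewrite (A_split n m)// lerDl sumr_ge0.
  exists (2 * pi ^+ 2 * L ^+ 2) => _ [N _ <-].
  apply: le_trans (sum_coef_le GL GM Gper N.+1); rewrite /A.
  rewrite le_eqVlt; apply/orP; left; apply/eqP; apply: eq_bigr => i _.
  by rewrite /a /b !exprMn mulrDr.
set e := _ ^+ 2; have e0 : 0 < e by rewrite !exprn_gt0// invr_gt0.
have /cvgrPdist_lt /(_ (e / 2)) := cA; rewrite divr_gt0// => /(_ isT) [N _ HN].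
exists N.+1 => -[//|n] [//|m] Nn nm.
have h1 := HN n Nn; have h2 := HN m (leq_trans Nn nm).
move: h1 h2; rewrite (A_split n m)// !ltr_norml => /andP[? ?] /andP[? ?]; lra.
Qed.

(** The partial sums form an L^2 Cauchy sequence; along [N] the increments have geometrically
    decreasing norms, as the L^1 limit requires. *)
Let index : exists N : nat -> nat, [/\ forall k, (N k <= N k.+1)%N,
  forall k, (k < N k)%N &
  forall k, \sum_(N k <= i < N k.+1) (a i ^+ 2 + b i ^+ 2) <= ((2^-1 : R) ^+ k) ^+ 2].
Proof.
have [nu Hnu] := choice alpha_tail.
(* The successors make [N] tend to infinity and keep it positive, so that no block contains the
   constant harmonic, whose norm is different. *)
pose N := fix N k := if k is k'.+1 then maxn (N k').+1 (nu k) else (nu 0%N).+1.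
exists N; split.
- by move=> k; rewrite /= leq_max leqnSn.
- by elim=> [//|k IH]; rewrite /= leq_max ltnS IH.
- move=> k; apply: Hnu; last by rewrite /= leq_max leqnSn.
  by case: k => [|k] /=; rewrite ?leqnSn// leq_max leqnn orbT.
Qed.

(** [W_ N], divided by pi, is a partial Fourier sum of the conjugate function of [G], and [S N] is
    the derivative of [W_ N]. *)
Let S N := trig_sum a b 1 N.
Let W_ N := trig_sum (fun n => - s n) c 1 N.

Let int_S N t : - pi <= t -> \int[mu]_(u in `[- pi, t]) S N u = W_ N t - W_ N (- pi).
Proof.
move=> pit; rewrite /S /W_ /trig_sum int_itv_sum; last first.
  by move=> n; apply: integrable_itv_cont => u _; exact: continuous_harmonic.
rewrite -sumrB; apply: eq_bigr => n _.
have dF u : u \in `[- pi, t] ->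
    is_derive u (1 : R) (harmonic n (- s n) (c n)) (harmonic n (a n) (b n) u).
  move=> _; have d1 := is_deriveZ (- s n) (is_derive_cosM n%:R u).
  have d2 := is_deriveZ (c n) (is_derive_sinM n%:R u).
  apply: (is_derive_eq (is_deriveD d1 d2)).
  by rewrite /GRing.scale/= /harmonic /a /b; ring.
by rewrite (int_itv_deriv pit dF)// => u _; exact: continuous_harmonic.
Qed.

(** Convolution with [dpoisson] rotates harmonics by a quarter turn, which undoes the conjugation in
    [W_] and leaves the Fourier sum of [G] against [dconj_poisson]. The subtracted constant
    integrates to 0. *)
Let int_W_dpoisson r x N : 0 <= r < 1 ->
  \int[mu]_(t in `[- pi, pi]) ((W_ N t - W_ N (- pi)) * dpoisson r (x - t)) =
  pi * (2 * \sum_(0 <= n < N) n%:R * r ^+ n *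
     \int[mu]_(t in `[- pi, pi]) (G t * harmonic n (cos (n%:R * x)) (sin (n%:R * x)) t)).
Proof.
move=> r01; have cP := @continuous_dpoisson_sub R r x r01.
have iM (f : R -> R) : continuous f ->
    mu.-integrable `[- pi, pi] (EFin \o (fun t => f t * dpoisson r (x - t))).
  by move=> cf; apply: integrable_itv_cont => t _; apply: cvgM; [exact: cf|exact: cP].
have iW := iM _ (@continuous_trig_sum R (fun n => - s n) c 1 N).
have i1 := iM _ (@continuous_harmonic R 0 1 0).
have iP : mu.-integrable `[- pi, pi] (EFin \o (fun t => dpoisson r (x - t))).
  by apply: integrable_itv_cont => t _; exact: cP.
have P0 : \int[mu]_(t in `[- pi, pi]) dpoisson r (x - t) = 0.
  have := @int_harmonic_dpoisson R r x 0 1 0 r01; rewrite mul0r mulr0 mul0r => <-.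
  by apply: eq_Rintegral => t _; rewrite /harmonic mul0r cos0 mul0r addr0 mulr1 mul1r.
transitivity (\int[mu]_(t in `[- pi, pi]) (W_ N t * dpoisson r (x - t) -
    W_ N (- pi) * dpoisson r (x - t))).
  by apply: eq_Rintegral => t _; rewrite mulrBl.
rewrite RintegralB//; last exact: integrable_itvZ.
rewrite RintegralZl// P0 mulr0 subr0 /W_ /trig_sum.
under eq_Rintegral do rewrite mulr_suml.
rewrite int_itv_sum; last by move=> n; apply: iM; exact: continuous_harmonic.
under eq_bigr do rewrite int_harmonic_dpoisson//.
case: N {iW} => [|N]; first by rewrite !big_geq// !mulr0.
rewrite [in RHS]big_ltn// !mul0r add0r !mulr_sumr; apply: eq_bigr => n _.
have -> : \int[mu]_(t in `[- pi, pi]) (G t * harmonic n (cos (n%:R * x)) (sin (n%:R * x)) t) =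
   cos (n%:R * x) * c n + sin (n%:R * x) * s n.
  have ic : mu.-integrable `[- pi, pi] (EFin \o (fun t => G t * cos (n%:R * t))).
    by apply: integrable_itv_cont => t _; apply: cvgM; [exact: cG|exact: continuous_cosM].
  have is_ : mu.-integrable `[- pi, pi] (EFin \o (fun t => G t * sin (n%:R * t))).
    by apply: integrable_itv_cont => t _; apply: cvgM; [exact: cG|exact: continuous_sinM].
  rewrite /c /s /cos_coef /sin_coef -!RintegralZl// -RintegralD//; [|exact: integrable_itvZ|exact: integrable_itvZ].
  by apply: eq_Rintegral => t _; rewrite /harmonic; ring.
by rewrite /harmonic; ring.
Qed.

(* g / pi is the derivative of the conjugate function of G. *)
Lemma conjugate_density : exists g : R -> R,
  mu.-integrable `[- pi, pi] (EFin \o g) /\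
  forall r x, 0 <= r < 1 ->
    pi * \int[mu]_(t in `[- pi, pi]) (G t * dconj_poisson r (x - t)) =
    \int[mu]_(t in `[- pi, pi])
      (\int[mu]_(u in `[- pi, t]) g u * dpoisson r (x - t)).
Proof.
have [N [Nmono Nge Nsum]] := index.
pose H k := S (N k).
have cH k : continuous (H k) by exact: continuous_trig_sum.
have N1 k : (1 <= N k)%N by exact: leq_ltn_trans (Nge k).
have Hdiff k t : H k.+1 t - H k t = trig_sum a b (N k) (N k.+1) t.
  by rewrite /H /S /trig_sum (@big_cat_nat _ _ _ (N k))//= addrAC subrr add0r.
have [g [ig gH]] : exists g : R -> R, mu.-integrable `[- pi, pi] (EFin \o g) /\
    \int[mu]_(t in `[- pi, pi]) `|H n t - g t| @[n --> \oo] --> 0.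
  (* The constant is the sum of 2 pi / 2^k over all k. *)
  apply: (@L1_fast_cauchy_cvg _ _ _ _ (4 * pi)) => // K.
  apply: (@le_trans _ _ (\sum_(0 <= k < K) 2 * pi * 2^-1 ^+ k)).
    apply: ler_sum => k _.
    under eq_Rintegral do rewrite Hdiff.
    have := Nsum k; rewrite -(prednK (N1 k)); apply: int_norm_trig_sum_le.
    by rewrite exprn_gt0// invr_gt0.
  rewrite -mulr_sumr big_mkord.
  have -> : \sum_(i < K) (2^-1 : R) ^+ i = 2 * (1 - 2^-1 ^+ K).
    have := @subrXX R 1 2^-1 K; rewrite expr1n => ->.
    have -> : \sum_(i < K) (1 : R) ^+ (K.-1 - i) * 2^-1 ^+ i = \sum_(i < K) 2^-1 ^+ i.
      by apply: eq_bigr => i _; rewrite expr1n mul1r.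
    by field.
  have : 0 <= pi * 2^-1 ^+ K :> R by rewrite mulr_ge0 ?pi_ge0 ?exprn_ge0 ?invr_ge0.
  lra.
exists g; split=> // r x r01.
pose W t := \int[mu]_(u in `[- pi, t]) g u.
have iH k : mu.-integrable `[- pi, pi] (EFin \o H k).
  by apply: integrable_itv_cont => t _; exact: cH.
have idiff k : mu.-integrable `[- pi, pi] (EFin \o (fun t => `|H k t - g t|)).
  by apply: integrable_itv_norm; exact: integrable_itvB.
pose eta k := \int[mu]_(t in `[- pi, pi]) `|H k t - g t|.
(* Convergence of the densities in L^1 makes their primitives converge uniformly, so the limit can
   be taken under the integral against the bounded kernel. *)
have WW k t : t \in `[- pi, pi] -> `|(W_ (N k) t - W_ (N k) (- pi)) - W t| <= eta k.
  rewrite in_itv/= => /andP[pit tpi]; rewrite -int_S//.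
  have s1 := integrable_itvW (iH k) (lexx _) tpi.
  have s2 := integrable_itvW ig (lexx _) tpi.
  rewrite -RintegralB//.
  apply: (@le_trans _ _ (\int[mu]_(u in `[- pi, t]) `|H k u - g u|)).
    by apply: le_normr_Rintegral => //; exact: integrable_itvB.
  rewrite /eta (int_itv_split pit tpi)// lerDl.
  by apply: Rintegral_ge0 => u _; exact: normr_ge0.
have cW : {within `[- pi, pi], continuous W}.
  by apply: parameterized_integral_continuous.
have mW : measurable_fun `[- pi, pi] W.
  exact: subspace_continuous_measurable_fun.
have Wb t : t \in `[- pi, pi] -> `|W t| <= \int[mu]_(u in `[- pi, pi]) `|g u|.
  rewrite in_itv/= => /andP[pit tpi].
  have s2 := integrable_itvW ig (lexx _) tpi.
  apply: (@le_trans _ _ (\int[mu]_(u in `[- pi, t]) `|g u|)).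
    by apply: le_normr_Rintegral.
  rewrite (@int_itv_split _ (- pi) t pi) ?lerDl//; last exact: integrable_itv_norm.
  by apply: Rintegral_ge0 => u _; exact: normr_ge0.
have iW : mu.-integrable `[- pi, pi] (EFin \o W).
  exact: integrable_itv_bounded Wb.
have cP := @continuous_dpoisson_sub R r x r01.
have [C C0 PC] := bounded_itv_cont (fun t (_ : t \in `[- pi, pi]) => cP t).
have iWP : mu.-integrable `[- pi, pi] (EFin \o (fun t => W t * dpoisson r (x - t))).
  apply: (@integrable_itv_bounded _ _ _ _ (\int[mu]_(u in `[- pi, pi]) `|g u| * C)).
    apply: measurable_funM => //; apply: measurable_funTS.
    exact: continuous_measurable_fun.
  by move=> t tp; rewrite normrM ler_pM// ?Wb ?PC.
pose X k := \int[mu]_(t in `[- pi, pi]) ((W_ (N k) t - W_ (N k) (- pi)) * dpoisson r (x - t)).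
have XW : X k @[k --> \oo] --> \int[mu]_(t in `[- pi, pi]) (W t * dpoisson r (x - t)).
  have iX k : mu.-integrable `[- pi, pi] (EFin \o (fun t =>
      (W_ (N k) t - W_ (N k) (- pi)) * dpoisson r (x - t))).
    apply: integrable_itv_cont => t _; apply: cvgM; last exact: cP.
    by apply: cvgB; [exact: continuous_trig_sum|exact: cvg_cst].
  have bnd k : `|\int[mu]_(t in `[- pi, pi]) (W t * dpoisson r (x - t)) - X k|
      <= eta k * (C * (pi - - pi)).
    rewrite distrC /X -RintegralB// mulrA -int_itv_cst//; apply: le_int_itv.
    - exact: integrable_itvB.
    - by apply: integrable_itv_cont => t _; exact: cvg_cst.
    - by move=> t tp; rewrite -mulrBl normrM; apply: ler_pM => //; [exact: WW|exact: PC].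
  apply/cvgrPdist_le => e e0.
  have : eta k * (C * (pi - - pi)) @[k --> \oo] --> (0 : R).
    by rewrite -(mul0r (C * (pi - - pi))); exact: cvgMr_tmp.
  move=> /cvgrPdist_le /(_ e e0); apply: filterS => k.
  rewrite sub0r normrN => /(le_trans (ler_norm _)); exact: le_trans.
have Noo : N k @[k --> \oo] --> \oo.
  apply/cvgnyPge => K; near=> k; rewrite (leq_trans _ (ltnW (Nge k)))//.
  by near: k; exact: nbhs_infty_ge.
have FG := cvg_comp _ _ Noo (@dconj_poisson_fourier R r x G r01 cG).
apply: (cvg_unique _ _ XW) => //.
have -> : X = (fun k => pi * (2 * \sum_(0 <= n < N k) n%:R * r ^+ n *
     \int[mu]_(t in `[- pi, pi]) (G t * harmonic n (cos (n%:R * x)) (sin (n%:R * x)) t))).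
  by apply/funext => k; rewrite /X int_W_dpoisson.
by apply: cvgMl_tmp; exact: FG.
Unshelve. all: by end_near. Qed.

End LipschitzConjugate.

(** * Radial limits at points where a primitive is differentiable *)

Section LipschitzLimit.
Variable R : realType.
Notation mu := (@lebesgue_measure R).

(** The kernel annihilates the constant [F x], pairs with sin (t - x) to give exactly 2 pi r, and
    sends the remainder o(|t - x|) to 0. *)
Lemma int_dpoisson_cvg (F : R -> R) (K x A : R) : x \in `]- pi, pi[ ->
  measurable_fun `[- pi, pi] F -> (forall t, t \in `[- pi, pi] -> `|F t| <= K) ->
  is_derive x (1 : R) F A ->
  \int[mu]_(t in `[- pi, pi]) (F t * dpoisson r (x - t)) @[r --> (1 : R)^'-]
    --> 2 * pi * A.
Proof.
rewrite in_itv/= => /andP[x1 x2] mF FK dF.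
pose rho t := F t - F x - A * sin (t - x).
have xin : x \in `[- pi, pi] by rewrite in_itv/= !ltW.
have csx : continuous (fun t : R => A * sin (t - x)).
  move=> t; apply: cvgMl_tmp; apply: (@continuous_comp _ _ _ (fun t => t - x)).
    by apply: cvgB; [exact: cvg_id|exact: cvg_cst].
  exact: continuous_sin.
have rho_slope : has_slope rho x 0.
  apply: is_derive_has_slope.
  have dl : is_derive x (1 : R) (fun t : R => t - x) 1.
    apply: is_derive_eq; rewrite /GRing.scale/=; ring.
  have ds := @is_derive1_comp _ sin (fun t => t - x) x _ _ (is_derive_sin _) dl.
  have := is_deriveB (is_deriveB dF (is_derive_cst (F x) x 1)) (is_deriveZ A ds).
  move=> h; apply: (is_derive_eq h).
  by rewrite /GRing.scale/= subrr cos0 !mulr1 subr0 subrr.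
have rho0 : rho x = 0 by rewrite /rho !subrr sin0 mulr0 subr0.
have K0 : 0 <= K by exact: le_trans (FK x xin).
have mrho : measurable_fun `[- pi, pi] rho.
  apply: measurable_funB; first by apply: measurable_funB => //; exact: measurable_cst.
  by apply: measurable_funTS; exact: continuous_measurable_fun.
have rhoM t : t \in `[- pi, pi] -> `|rho t| <= 2 * K + `|A|.
  move=> tin; rewrite (le_trans (ler_normB _ _))// lerD//.
    rewrite (le_trans (ler_normB _ _))// mulr_natl mulr2n lerD//; exact: FK.
  by rewrite normrM ler_piMr// sin_max.
have rhoo e : 0 < e -> exists2 d, 0 < d &
    forall t, `|t - x| < d -> `|rho t| <= e * `|t - x|.
  move=> e0; have [d d0 H] := rho_slope e e0; exists d => // t td.
  have := H (t - x) td; rewrite rho0 mul0r !subr0.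
  by rewrite (_ : x + (t - x) = t)//; ring.
(* [F] is not periodic, so x - t ranges up to pi + |x|; this stays below 2 pi because [x] is an
   interior point. *)
have [C C0 PC] : exists2 C : R, 0 <= C & forall r u, 1 / 2 <= r < 1 ->
    `|u| <= pi + `|x| -> `|dpoisson r u| <= C * ((1 - r) / (1 - r + `|u|) ^+ 3).
  apply: dpoisson_le; have := pi_gt0 R; have := normr_ge0 x.
  have : `|x| < pi by rewrite ltr_norml x1.
  by move=> ? ? ?; apply/andP; split; lra.
apply/cvgrPdist_le => e e0.
have [d0 d00 Hd0] := int_littleo_kernel (ltW x1) (ltW x2) C0 mrho rhoM rhoo
  (ltac:(by rewrite divr_gt0) : 0 < e / 2).
have lin : 2 * pi * (A * r) @[r --> (1 : R)^'-] --> 2 * pi * A.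
  rewrite -[X in _ --> X](_ : 2 * pi * (A * 1) = _); last by rewrite mulr1.
  apply: cvgMl_tmp; apply: cvgMl_tmp; apply: cvg_at_left_filter; exact: cvg_id.
have /cvgrPdist_le /(_ (e / 2)) := lin; rewrite divr_gt0// => /(_ isT) Hlin.
near=> r.
have r1 : r < 1 by [].
have r12 : 1 / 2 <= r.
  by near: r; apply: nbhs_left_ge; lra.
have r01 : 0 <= r < 1 by rewrite r1 andbT; lra.
have rd : 1 - r < d0.
  rewrite ltrBlDl -ltrBlDr; near: r; apply: nbhs_left_gt; lra.
have cP := @continuous_dpoisson_sub R r x r01.
have iP : mu.-integrable `[- pi, pi] (EFin \o (fun t => dpoisson r (x - t))).
  by apply: integrable_itv_cont => t _; exact: cP.
have mP : measurable_fun `[- pi, pi] (fun t => dpoisson r (x - t)).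
  by apply: measurable_funTS; exact: continuous_measurable_fun.
have [CP CP0 HCP] := bounded_itv_cont (fun t (_ : t \in `[- pi, pi]) => cP t).
have irP : mu.-integrable `[- pi, pi] (EFin \o (fun t => rho t * dpoisson r (x - t))).
  apply: (@integrable_itv_bounded _ _ _ _ ((2 * K + `|A|) * CP)).
    exact: measurable_funM.
  by move=> t tin; rewrite normrM ler_pM// ?rhoM ?HCP.
have P0 : \int[mu]_(t in `[- pi, pi]) dpoisson r (x - t) = 0.
  have := @int_harmonic_dpoisson R r x 0 1 0 r01; rewrite mul0r mulr0 mul0r => <-.
  by apply: eq_Rintegral => t _; rewrite /harmonic mul0r cos0 mul0r addr0 mulr1 mul1r.
have hE t : harmonic 1 (- sin x) (cos x) t = sin (t - x).
  by rewrite /harmonic !mul1r sinB; ring.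
have P1 : \int[mu]_(t in `[- pi, pi]) (sin (t - x) * dpoisson r (x - t)) = 2 * pi * r.
  have := @int_harmonic_dpoisson R r x 1 (- sin x) (cos x) r01.
  under eq_Rintegral do rewrite hE.
  move=> ->; rewrite /harmonic !mul1r expr1.
  have -> : -2 * pi * r * (- cos x * cos x + - sin x * sin x) =
    2 * pi * r * (cos x ^+ 2 + sin x ^+ 2) by ring.
  by rewrite cos2Dsin2 mulr1.
have isP : mu.-integrable `[- pi, pi] (EFin \o (fun t => sin (t - x) * dpoisson r (x - t))).
  apply: integrable_itv_cont => t _; apply: cvgM; last exact: cP.
  apply: (@continuous_comp _ _ _ (fun t => t - x)); last exact: continuous_sin.
  by apply: cvgB; [exact: cvg_id|exact: cvg_cst].
have -> : \int[mu]_(t in `[- pi, pi]) (F t * dpoisson r (x - t)) =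
  2 * pi * (A * r) + \int[mu]_(t in `[- pi, pi]) (rho t * dpoisson r (x - t)).
  transitivity (\int[mu]_(t in `[- pi, pi]) (F x * dpoisson r (x - t) +
    A * (sin (t - x) * dpoisson r (x - t)) + rho t * dpoisson r (x - t))).
    by apply: eq_Rintegral => t _; rewrite /rho; ring.
  rewrite (@RintegralD _ _ _ mu `[- pi, pi]%classic (fun t => F x * dpoisson r (x - t) +
    A * (sin (t - x) * dpoisson r (x - t))) (fun t => rho t * dpoisson r (x - t)))//; last first.
    by apply: integrable_itvD; exact: integrable_itvZ.
  rewrite RintegralD//; [|exact: integrable_itvZ|exact: integrable_itvZ].
  by rewrite RintegralZl// RintegralZl// P0 P1; ring.
have h1 : `|2 * pi * A - 2 * pi * (A * r)| <= e / 2 by near: r; exact: Hlin.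
have h2 : `|\int[mu]_(t in `[- pi, pi]) (rho t * dpoisson r (x - t))| <= e / 2.
  apply: (Hd0 (1 - r)) => //; first by rewrite subr_gt0 r1.
  move=> t; rewrite in_itv/= => /andP[t1 t2]; rewrite (distrC t x); apply: PC.
    by rewrite r12.
  rewrite (le_trans (ler_normB _ _))// addrC lerD2r ler_norml t1//.
rewrite opprD addrA (le_trans (ler_normB _ _))//; lra.
Unshelve. all: by end_near. Qed.

Variables (G : R -> R) (L M : R).
Hypothesis GL : forall x y, `|G x - G y| <= L * `|x - y|.
Hypothesis GM : forall x, `|G x| <= M.
Hypothesis Gper : periodic G (2 * pi).

(** The density from [conjugate_density] is only integrable, but its primitive is differentiable at
    every Lebesgue point, which is what [int_dpoisson_cvg] asks for. *)
Lemma lipschitz_dconj_poisson_cvg : {ae mu, forall x : R, x \in `]- pi, pi[ ->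
  cvg (\int[mu]_(t in `[- pi, pi]) (G t * dconj_poisson r (x - t)) @[r --> (1 : R)^'-])}.
Proof.
have [g [ig E]] := conjugate_density GL GM Gper.
have pi0 := pi_gt0 R.
have Npi_pi : - pi <= pi :> R by lra.
pose gr := g \_ `[- pi, pi].
have lgr : locally_integrable setT gr by exact: integrable_locally_restrict.
have grE t : t \in `[- pi, pi] -> gr t = g t.
  by move=> tin; rewrite /gr patchE mem_set.
have igr : mu.-integrable `[- pi, pi] (EFin \o gr).
  by apply: eq_integrable ig => // t /set_mem tin /=; rewrite grE.
pose F t := \int[mu]_(u in `[- pi, t]) gr u.
apply: aeS (lebesgue_differentiation lgr) => x lx xin.
have /andP[x1 x2] : - pi < x < pi by move: xin; rewrite in_itv.
have [|dF _] := FTC1_lebesgue_pt x2 igr _ lx.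
  by rewrite /= lte_fin.
have mF : measurable_fun `[- pi, pi] F.
  apply: subspace_continuous_measurable_fun => //.
  exact: parameterized_integral_continuous.
have FK t : t \in `[- pi, pi] -> `|F t| <= \int[mu]_(u in `[- pi, pi]) `|gr u|.
  rewrite in_itv/= => /andP[pit tpi].
  have s2 := integrable_itvW igr (lexx _) tpi.
  apply: (@le_trans _ _ (\int[mu]_(u in `[- pi, t]) `|gr u|)).
    by apply: le_normr_Rintegral.
  rewrite (@int_itv_split _ (- pi) t pi) ?lerDl//; last exact: integrable_itv_norm.
  by apply: Rintegral_ge0 => u _; exact: normr_ge0.
have H := int_dpoisson_cvg xin mF FK (@DeriveDef _ _ _ _ _ _ _ dF erefl).
have H2 : pi^-1 * \int[mu]_(t in `[- pi, pi]) (F t * dpoisson r (x - t)) @[r --> (1 : R)^'-]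
    --> pi^-1 * (2 * pi * 'D_1 F x) by apply: cvgMl_tmp; exact: H.
apply/cvg_ex; exists (pi^-1 * (2 * pi * 'D_1 F x)); apply: cvg_trans H2.
apply: near_eq_cvg; near=> r.
have r01 : 0 <= r < 1.
  apply/andP; split => //; near: r; apply: nbhs_left_ge; exact: ltr01.
have pin : pi != 0 :> R by rewrite lt0r_neq0.
apply: (mulfI pin); rewrite (E r x r01) (mulVKf pin).
apply: eq_Rintegral => t tin; congr (_ * _); apply: eq_Rintegral => u uin.
apply: grE; move: uin tin => /set_mem; rewrite /= in_itv/= => /andP[u1 u2] /set_mem.
by rewrite /= !in_itv/= => /andP[t1 t2]; rewrite u1 (le_trans u2).
Unshelve. all: by end_near. Qed.

End LipschitzLimit.

(** * Radial limits *)

Section LipschitzExtension.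
Variable R : realType.

Section McShane.
Variables (f : R -> R) (M K : R).
Hypothesis fM : forall x, `|f x| <= M.
Hypothesis K0 : 0 <= K.

Definition lip_at : set R := [set x | forall y, `|f y - f x| <= K * `|y - x|].

Definition mcshane x : R := inf [set f p + K * `|x - p| | p in lip_at].

(** Since [f] may be discontinuous, [f x] is not obtained as a limit: it is compared with [f p] by
    the inequality at the nearby point p, used once with y and once with x. *)
Lemma closed_lip_at : closed lip_at.
Proof.
move=> x clx y; apply/ler_addgt0Pl => e e0.
have K1 : 0 < 2 * K + 1 by rewrite ltr_wpDl// mulr_ge0.
have [p [lp px]] : lip_at `&` ball x (e / (2 * K + 1)) !=set0.
  by apply: clx; apply: nbhsx_ballx; rewrite divr_gt0.
have pxe : (2 * K + 1) * `|x - p| < e.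
  by rewrite mulrC -ltr_pdivlMr.
have h1 := lp y; have h2 := lp x.
have h3 : `|y - p| <= `|y - x| + `|x - p| by rewrite (le_trans _ (ler_normD _ _))// addrA subrK.
have h4 : K * `|y - p| <= K * (`|y - x| + `|x - p|) by rewrite ler_wpM2l.
have h5 : `|f y - f x| <= `|f y - f p| + `|f x - f p|.
  by rewrite (le_trans _ (ler_normB _ _))// opprB addrA subrK.
have := normr_ge0 (x - p); lra.
Qed.

Lemma lip_at_periodic T : periodic f T -> forall (k : int) x, lip_at x -> lip_at (x + T * k%:~R).
Proof.
move=> pf k x lx y; rewrite periodic_int//.
have := lx (y - T * k%:~R); rewrite -(periodic_int k (y - _) pf) subrK.
by rewrite [y - _ - x]addrAC -addrA -opprD.
Qed.

Hypothesis lip0 : lip_at !=set0.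

Let has_lb x : has_lbound [set f p + K * `|x - p| | p in lip_at].
Proof.
exists (- M) => _ [p _ <-]; have := fM p; rewrite ler_norml => /andP[h _].
by rewrite (le_trans h)// lerDl mulr_ge0.
Qed.

Lemma mcshane_le x p : lip_at p -> mcshane x <= f p + K * `|x - p|.
Proof. by move=> lp; apply: ge_inf; [exact: has_lb|exists p]. Qed.

Lemma mcshane_ge x c : (forall p, lip_at p -> c <= f p + K * `|x - p|) -> c <= mcshane x.
Proof.
move=> H; apply: lb_le_inf; last by move=> _ [p lp <-]; exact: H.
by have [p lp] := lip0; exists (f p + K * `|x - p|), p.
Qed.

Lemma mcshane_lip x y : `|mcshane x - mcshane y| <= K * `|x - y|.
Proof.
suff H u v : mcshane u <= mcshane v + K * `|u - v|.
  have := H x y; have := H y x; rewrite (distrC y x) ler_norml => h1 h2.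
  by apply/andP; split; lra.
rewrite -lerBlDr; apply: mcshane_ge => p lp.
rewrite lerBlDr (le_trans (mcshane_le u lp))// -addrA lerD2l -mulrDr ler_wpM2l//.
by rewrite [leRHS]addrC (le_trans _ (ler_normD _ _))// addrA subrK.
Qed.

Lemma mcshane_eq p : lip_at p -> mcshane p = f p.
Proof.
move=> lp; apply/le_anti/andP; split.
  by have := mcshane_le p lp; rewrite subrr normr0 mulr0 addr0.
apply: mcshane_ge => q lq; have := lq p; rewrite ler_norml => /andP[_]; lra.
Qed.

Lemma mcshane_periodic T : periodic f T -> periodic mcshane T.
Proof.
move=> pf x; rewrite /mcshane; congr inf; apply/seteqP; split=> _ [p lp <-].
  exists (p + T * (-1 : int)%:~R); first exact: lip_at_periodic.
  by rewrite periodic_int// mulrN1z mulrN mulr1 opprB addrA.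
exists (p + T * (1 : int)%:~R); first exact: lip_at_periodic.
by rewrite periodic_int// mulr1z mulr1 opprD addrACA subrr addr0.
Qed.

(** For the upper bound, the set is invariant under the period, so it has a point within [T] of
    [x]. *)
Lemma mcshane_bounded T x : 0 < T -> periodic f T -> `|mcshane x| <= M + K * T.
Proof.
move=> T0 pf; rewrite ler_norml; apply/andP; split.
  apply: mcshane_ge => p lp; have := fM p; rewrite ler_norml => /andP[h _].
  have : 0 <= K * `|x - p| by rewrite mulr_ge0.
  have : 0 <= K * T by rewrite mulr_ge0// ltW.
  by rewrite opprD; lra.
have [p lp] := lip0; pose k := Num.floor ((x - p) / T).
have k1 : k%:~R * T <= x - p by rewrite -ler_pdivlMr// floor_le.
have k2 : x - p <= k%:~R * T + T.
  by rewrite -[X in _ <= _ + X]mul1r -mulrDl -ler_pdivrMr// -[1]/(1%:~R) -intrD ltW// floorD1_gt.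
apply: (le_trans (mcshane_le x (lip_at_periodic pf k lp))).
rewrite lerD//; first exact: le_trans (ler_norm _) (fM _).
by rewrite ler_wpM2l// ler_norml mulrC; apply/andP; split; lra.
Qed.

(** [f] and its extension agree at [p], and each moves by at most K |t - p|; for [f] this uses the
    inequality at p against the arbitrary point t. *)
Lemma mcshane_diff_le t p : lip_at p -> `|f t - mcshane t| <= 2 * K * `|t - p|.
Proof.
move=> lp; have -> : f t - mcshane t = (f t - f p) - (mcshane t - mcshane p).
  by rewrite (mcshane_eq lp); ring.
rewrite (le_trans (ler_normB _ _))// (le_trans (lerD (lp t) (mcshane_lip t p)))//.
by rewrite -mulrDl; have := normr_ge0 (t - p); lra.
Qed.

End McShane.
End LipschitzExtension.

(** * Marcinkiewicz' integral for functions bounded by the distance to a set *)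

Section Marcinkiewicz.
Variable R : realType.
Notation mu := (@lebesgue_measure R).

(* Integrate in x first: for fixed t only the x with |t - x| >= beta t
   contribute, and these contribute O(1). *)
Lemma marcinkiewicz (a b : R) (E : set R) (beta : R -> R) : a <= b ->
  measurable E -> E `<=` `[a, b] -> measurable_fun setT beta ->
  (forall t, 0 <= beta t) -> (forall x t, E x -> beta t <= `|t - x|) ->
  {ae mu, forall x, E x ->
    mu.-integrable `[a, b] (EFin \o (fun t => beta t / (t - x) ^+ 2))}.
Proof.
move=> ab mE Eab mb b0 bE.
pose I : set R := `[a, b]%classic.
pose k (x t : R) : R := \1_E x * (\1_I t * (beta t / (t - x) ^+ 2)).
have k0 x t : 0 <= k x t.
  by rewrite /k !mulr_ge0// invr_ge0 sqr_ge0.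
have mk : measurable_fun [set: R * R] (fun z : R * R => k z.1 z.2).
  have mfst : measurable_fun [set: R * R] (fun z : R * R => z.1) by exact: measurable_fst.
  have msnd : measurable_fun [set: R * R] (fun z : R * R => z.2) by exact: measurable_snd.
  apply: measurable_funM.
    by apply: (measurableT_comp _ mfst); exact: measurable_indic.
  apply: measurable_funM.
    by apply: (measurableT_comp _ msnd); apply: measurable_indic; exact: measurable_itv.
  apply: measurable_funM; first exact: (measurableT_comp mb msnd).
  apply: (measurableT_comp (@measurable_inv R setT)).
  by apply: measurable_funX; exact: measurable_funB.
pose h (z : R * R) : \bar R := (k z.1 z.2)%:E.
have mh : measurable_fun [set: R * R] h by exact/measurable_EFinP.
have h0 z : (0 <= h z)%E by rewrite lee_fin.
have inner y : (\int[mu]_x h (x, y) <= ((8 * \1_I y) : R)%:E)%E.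
  have [yI|nyI] := pselect (I y); last first.
    rewrite indicE memNset// mulr0 integral0_eq// => x _.
    by rewrite /h /k/= [\1_I y]indicE memNset// mul0r mulr0.
  have yab : y \in `[a, b] by exact: yI.
  have /andP[ay yb] : a <= y <= b by move: yab; rewrite in_itv.
  have := b0 y; rewrite le_eqVlt => /predU1P[b00|bp].
    rewrite integral0_eq; last by move=> x _; rewrite /h /k/= -b00 mul0r !mulr0.
    by rewrite lee_fin mulr_ge0.
  (* On [E] one has |x - y| >= [beta y], so |x - y| is at least half of beta y + |x - y|. This costs
     a factor 4, and the bump has mass at most 2, hence the bound 8. *)
  pose q (x : R) : R := beta y / (beta y + `|x - y|) ^+ 2.
  have iq : mu.-integrable `[a, b] (EFin \o (fun x => 4 * q x)).
    apply: integrable_itvZ; apply: integrable_itv_cont => t _.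
    exact: continuous_cauchy_bump.
  apply: (@le_trans _ _ (\int[mu]_(x in `[a, b]) (4 * q x)%:E)%E).
    rewrite [leRHS]integral_mkcond; apply: ge0_le_integral => //.
    - have mkx : measurable_fun [set: R] (fun x : R => k x y).
        apply: measurable_funM; first exact: measurable_indic.
        apply: measurable_funM; first exact: measurable_cst.
        apply: measurable_funM; first exact: measurable_cst.
        apply: (measurableT_comp (@measurable_inv R setT)).
        by apply: measurable_funX; apply: measurable_funB => //; exact: measurable_cst.
      by apply/measurable_EFinP; exact: mkx.
    - apply: (measurable_restrictT _ _).1; last by case/integrableP : iq.
      exact: measurable_itv.
    - move=> x _; rewrite /h /k/= patchE; case: ifPn => [xab|xab]; last first.
        rewrite indicE memNset ?mul0r// => /Eab xab'; move: xab.
        by rewrite mem_set.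
      rewrite lee_fin [\1_I y]indicE mem_set// mul1r indicE.
      have q0 : 0 <= 4 * q x by rewrite mulr_ge0// divr_ge0// sqr_ge0.
      case: (boolP (x \in E)) => xE; last by rewrite mul0r.
      rewrite mul1r /q.
      have byx : beta y <= `|x - y| by rewrite distrC; apply: bE; rewrite -in_setE.
      have -> : 4 * (beta y / (beta y + `|x - y|) ^+ 2) =
        beta y / ((beta y + `|x - y|) / 2) ^+ 2.
        by field; rewrite lt0r_neq0// ltr_pwDl.
      apply: ler_div_denom => //.
        by rewrite exprn_gt0// divr_gt0// ltr_pwDl.
      rewrite -[(y - x) ^+ 2]real_normK ?num_real// (distrC y x).
      have w0 := normr_ge0 (x - y).
      by rewrite lerXn2r ?nnegrE//; lra.
  have -> : (\int[mu]_(x in `[a, b]) (4 * q x)%:E = (\int[mu]_(x in `[a, b]) (4 * q x))%:E)%E.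
    rewrite /Rintegral fineK//.
    by apply: (integrable_fin_num _ iq).
  rewrite lee_fin RintegralZl//; last first.
    by apply: integrable_itv_cont => t _; exact: continuous_cauchy_bump.
  rewrite indicE mem_set// mulr1.
  have := int_cauchy_bump_le2 ay yb bp; rewrite /q; lra.
have total : (\int[mu]_x \int[mu]_y h (x, y) < +oo)%E.
  rewrite (fubini_tonelli (m1 := mu) (m2 := mu) h mh h0).
  apply: (@le_lt_trans _ _ (\int[mu]_y ((8 * \1_I y) : R)%:E)%E).
    apply: ge0_le_integral => //.
    - by move=> y _; apply: integral_ge0 => x _; exact: h0.
    - exact: measurable_fun_fubini_tonelli_G.
    - by apply/measurable_EFinP; apply: measurable_funM => //; apply: measurable_indic; exact: measurable_itv.
  under eq_integral do rewrite EFinM.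
  rewrite ge0_integralZl//; last first.
    by apply/measurable_EFinP; apply: measurable_indic; exact: measurable_itv.
  rewrite integral_indic//; last exact: measurable_itv.
  rewrite setIT /I /= lebesgue_measure_itv/=; case: ifPn => _; last by rewrite mule0 ltry.
  by rewrite -EFinB -EFinM ltry.
have mF : measurable_fun [set: R] (fun x => (\int[mu]_y h (x, y))%E).
  exact: measurable_fun_fubini_tonelli_F.
have iF : mu.-integrable setT (fun x => (\int[mu]_y h (x, y))%E).
  apply/integrableP; split => //.
  under eq_integral do rewrite gee0_abs ?integral_ge0//.
  exact: total.
have ae := @integrable_ae _ _ _ mu setT measurableT _ iF.
apply: aeS ae => x /(_ Logic.I) fx Ex.
have mkx : measurable_fun setT (fun t => beta t / (t - x) ^+ 2).
  apply: measurable_funM => //; apply: (measurableT_comp (@measurable_inv R setT)).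
  by apply: measurable_funX; exact: measurable_funB.
apply/integrableP; split.
  by apply/measurable_EFinP; exact: measurable_funTS.
rewrite integral_mkcond.
rewrite (_ : integral _ _ _ = (\int[mu]_y h (x, y))%E); first by rewrite ltey_eq fx.
apply: eq_integral => t _.
rewrite patchE /h /k/= [\1_E x]indicE (mem_set Ex) mul1r indicE.
case: ifPn => tI; last by rewrite mul0r.
by rewrite mulr1n mul1r ger0_norm// divr_ge0// sqr_ge0.
Qed.

End Marcinkiewicz.

(** * Almost everywhere existence of the radial limit *)

Section RadialLimit.
Variable R : realType.
Notation mu := (@lebesgue_measure R).
Variables (f : R -> R) (M : R).
Hypothesis mf : measurable_fun setT f.
Hypothesis fM : forall x, `|f x| <= M.
Hypothesis fper : periodic f (2 * pi).

Definition dconj_int (h : R -> R) r x :=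
  \int[mu]_(t in `[- pi, pi]) (h t * dconj_poisson r (x - t)).

Let Npi_pi : - pi <= pi :> R.
Proof. by have := pi_gt0 R; lra. Qed.

(** Dominated convergence with majorant C |B t| / (t - x)^2. The hypothesis [B x = 0] takes care of
    t = x, where the kernel is unbounded as r tends to 1. *)
Lemma dconj_int_cvg_marcinkiewicz (B : R -> R) M' x : x \in `]- pi, pi[ ->
  measurable_fun setT B -> (forall t, `|B t| <= M') -> B x = 0 ->
  mu.-integrable `[- pi, pi] (EFin \o (fun t => `|B t| / (t - x) ^+ 2)) ->
  cvg (dconj_int B r x @[r --> (1 : R)^'-]).
Proof.
rewrite in_itv/= => /andP[x1 x2] mB BM Bx iB.
have pi0 := pi_gt0 R.
have [C C0 HC] : exists2 C : R, 0 <= C & forall r u, 1 / 2 <= r < 1 ->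
    `|u| <= pi + `|x| -> `|dconj_poisson r u| * u ^+ 2 <= C.
  apply: dconj_poisson_le_sqr; have := normr_ge0 x.
  have : `|x| < pi by rewrite ltr_norml x1.
  by move=> ? ?; apply/andP; split; lra.
have chord_gt0 t : t \in `[- pi, pi] -> t != x -> 0 < chord2 (x - t).
  rewrite in_itv/= => /andP[t1 t2] tx.
  have xpi : `|x| < pi by rewrite ltr_norml x1.
  have bpi : 0 < pi + `|x| < 2 * pi.
    by have := normr_ge0 x; move=> ?; apply/andP; split; lra.
  have [k /andP[k0 k1] Hk] := chord2_ge bpi.
  have h : `|x - t| <= pi + `|x|.
    by rewrite (le_trans (ler_normB _ _))// addrC lerD2r ler_norml t1.
  apply: lt_le_trans (Hk _ h); rewrite mulr_gt0// exprn_even_gt0//= subr_eq0 eq_sym.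
  exact: tx.
apply/cvg_ex; exists (\int[mu]_(t in `[- pi, pi]) (B t * - dcot (x - t))).
(* Dominated convergence is sequential, so the left limit is tested on sequences, shifted until the
   kernel bounds for r >= 1/2 apply. *)
apply/cvg_at_leftP => u [u1 ucvg].
have [N _ HN] : \forall n \near \oo, 1 / 2 <= u n.
  move/cvgrPdist_lt : ucvg => /(_ (1 / 2)); rewrite divr_gt0// => /(_ isT).
  by apply: filterS => n; rewrite ltr_norml => /andP[_]; lra.
rewrite -(cvg_shiftn N); rewrite /dconj_int.
have v01 n : 0 <= u (n + N)%N < 1.
  by rewrite u1 andbT; have := HN (n + N)%N (leq_addl _ _); rewrite /=; lra.
apply: (@int_itv_dominated_cvg _ _ _ _ _ (fun t => C * (`|B t| / (t - x) ^+ 2))).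
- move=> n; apply: measurable_funTS; apply: measurable_funM => //.
  by apply: continuous_measurable_fun; exact: continuous_dconj_poisson_sub.
- apply: measurable_funTS; apply: measurable_funM => //.
  apply: measurable_funN; apply: (measurableT_comp (@measurable_dcot R)).
  by apply: measurable_funB => //; exact: measurable_cst.
- apply: aeW => t tin; have [->|tx] := eqVneq t x.
    by rewrite Bx mul0r; under eq_fun do rewrite mul0r; exact: cvg_cst.
  apply: cvgMl_tmp.
  have := dconj_poisson_cvg (chord_gt0 t tin tx) => /cvg_at_leftP.
  move=> /(_ (fun n => u (n + N)%N)); apply; split; first by move=> n; exact: u1.
  by rewrite (cvg_shiftn N).
- exact: integrable_itvZ.
- move=> n t tin; have [->|tx] := eqVneq t x.
    by rewrite Bx mul0r normr0 mul0r mulr0.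
  have tx2 : 0 < (t - x) ^+ 2 by rewrite exprn_even_gt0//= subr_eq0.
  rewrite normrM mulrCA ler_wpM2l// ler_pdivlMr//.
  have -> : (t - x) ^+ 2 = (x - t) ^+ 2 by ring.
  apply: HC.
    by case/andP: (v01 n) => _ ->; rewrite andbT; exact: HN (leq_addl _ _).
  rewrite (le_trans (ler_normB _ _))// addrC lerD2r ler_norml.
  by move: tin; rewrite in_itv.
Qed.

Lemma dconj_int_cvg_lip_at K : 0 < K ->
  {ae mu, forall x : R, x \in `]- pi, pi[ -> lip_at f K x ->
    cvg (dconj_int f r x @[r --> (1 : R)^'-])}.
Proof.
move=> K0; have pi0 := pi_gt0 R.
(* On an empty set the extension would be an infimum over nothing, but the claim is then void. *)
have [[p lp]|/set0P] := pselect (lip_at f K !=set0); last first.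
  move=> /negP; rewrite negbK => /eqP l0; apply: aeW => x _ lx.
  by have : set0 x by rewrite -l0.
have lip0 : lip_at f K !=set0 by exists p.
have pi20 : 0 < 2 * pi :> R by rewrite mulr_gt0.
pose G := mcshane f K.
have GL x y : `|G x - G y| <= K * `|x - y| by apply: (mcshane_lip fM (ltW K0) lip0).
have GM x : `|G x| <= M + K * (2 * pi).
  exact: (mcshane_bounded fM (ltW K0) lip0 _ pi20 fper).
have Gper : periodic G (2 * pi) by exact: mcshane_periodic.
have cG : continuous G by exact: lipschitz_continuous GL.
have mG : measurable_fun setT G by exact: continuous_measurable_fun.
pose B t := f t - G t.
have mB : measurable_fun setT B by exact: measurable_funB.
have BM t : `|B t| <= M + (M + K * (2 * pi)).
  by rewrite (le_trans (ler_normB _ _))// lerD.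
have Bl t x : lip_at f K x -> `|B t| <= 2 * K * `|t - x|.
  by move=> lx; apply: (mcshane_diff_le fM (ltW K0) lip0).
have K20 : 0 < 2 * K by rewrite mulr_gt0.
have mE : measurable (lip_at f K `&` `[- pi, pi]%classic : set R).
  apply: measurableI; last exact: measurable_itv.
  by apply: closed_measurable; exact: closed_lip_at (ltW K0).
(* Division by [2 * K] turns the bound on [B] into the normalisation that [marcinkiewicz] requires
   of its weight. *)
have ae1 : {ae mu, forall x, (lip_at f K `&` `[- pi, pi]%classic) x ->
    mu.-integrable `[- pi, pi] (EFin \o (fun t => (`|B t| / (2 * K)) / (t - x) ^+ 2))}.
  apply: marcinkiewicz => //.
  - apply: measurable_funM => //.
    by apply: measurableT_comp => //; exact: measurable_normr.
  - by move=> t; rewrite divr_ge0// ltW.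
  - by move=> x t [lx _]; rewrite ler_pdivrMr// mulrC Bl.
apply: aeS (aeI ae1 (lipschitz_dconj_poisson_cvg GL GM Gper)) => x [h1 h2] xin lx.
have xin' : x \in `[- pi, pi] by exact: subset_itv_oo_cc xin.
have Bx : B x = 0.
  by apply/eqP; rewrite -normr_le0 (le_trans (Bl x x lx))// subrr normr0 mulr0.
have iB : mu.-integrable `[- pi, pi] (EFin \o (fun t => `|B t| / (t - x) ^+ 2)).
  have := integrable_itvZ (2 * K) (h1 (conj lx xin')).
  apply: eq_integrable => // t _ /=; congr EFin.
  by rewrite mulrA [2 * K * _]mulrC divfK// lt0r_neq0.
have cB := dconj_int_cvg_marcinkiewicz xin mB BM Bx iB.
have cGx := h2 xin.
have : cvg (dconj_int G r x + dconj_int B r x @[r --> (1 : R)^'-]).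
  exact: is_cvgD cGx cB.
move=> /cvg_ex[l hl]; apply/cvg_ex; exists l; apply: cvg_trans hl.
apply: near_eq_cvg; near=> r.
have r01 : 0 <= r < 1.
  by apply/andP; split => //; near: r; apply: nbhs_left_ge; exact: ltr01.
have cK := @continuous_dconj_poisson_sub R r x r01.
have [CK CK0 HCK] := bounded_itv_cont (fun t (_ : t \in `[- pi, pi]) => cK t).
have iM (h : R -> R) Mh : measurable_fun setT h -> (forall t, `|h t| <= Mh) ->
    mu.-integrable `[- pi, pi] (EFin \o (fun t => h t * dconj_poisson r (x - t))).
  move=> mh hM; apply: (@integrable_itv_bounded _ _ _ _ (Mh * CK)).
    apply: measurable_funTS; apply: measurable_funM => //.
    exact: continuous_measurable_fun.
  by move=> t tin; rewrite normrM ler_pM// HCK.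
rewrite /dconj_int -RintegralD//; [|exact: iM mG GM|exact: iM mB BM].
by apply: eq_Rintegral => t _; rewrite /B; ring.
Unshelve. all: by end_near. Qed.

(** Within distance d of [x] the expansion gives the constant |A| + 1; farther away boundedness
    gives 2 M / d. *)
Lemma has_slope_lip_at x A : has_slope f x A -> exists n : nat, lip_at f n.+1%:R x.
Proof.
move=> fA; have [d d0 H] := fA 1 ltr01.
have M0 : 0 <= M by exact: le_trans (fM 0).
pose K := `|A| + 1 + 2 * M / d.
exists (Num.truncn K) => y.
have KK : K <= (Num.truncn K).+1%:R by apply/ltW/truncnS_gt.
apply: le_trans (ler_wpM2r (normr_ge0 _) KK).
have Md : 0 <= 2 * M / d by rewrite divr_ge0 ?mulr_ge0// ltW.
have yx0 := normr_ge0 (y - x).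
have [yd|dy] := ltP `|y - x| d.
  have := H (y - x) yd; rewrite (_ : x + (y - x) = y); last by ring.
  move=> h; have -> : f y - f x = (f y - f x - A * (y - x)) + A * (y - x) by ring.
  rewrite (le_trans (ler_normD _ _))// normrM (le_trans (lerD h (lexx _)))//.
  by have := mulr_ge0 Md yx0; rewrite /K !mulrDl; lra.
rewrite (le_trans (ler_normB _ _))// (le_trans (lerD (fM y) (fM x)))//.
rewrite /K mulrDl; apply: ler_wpDl; first by rewrite mulr_ge0.
rewrite mulrAC ler_pdivlMr//.
have -> : M + M = 2 * M by ring.
by rewrite ler_wpM2l// mulr_ge0.
Qed.

Hypothesis fslope : {ae mu, forall x, exists A, has_slope f x A}.

Lemma dconj_int_cvg_oo : {ae mu, forall x : R, x \in `]- pi, pi[ ->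
  cvg (dconj_int f r x @[r --> (1 : R)^'-])}.
Proof.
have := ae_foralln (fun n => @dconj_int_cvg_lip_at n.+1%:R (ltr0Sn _ _)).
move=> /(aeI fslope); apply: aeS => x [[A xA] H] xin.
by have [n ln] := has_slope_lip_at xA; exact: H ln.
Qed.

Lemma dconj_poisson_2pi (r u : R) (k : int) :
  dconj_poisson r (u + 2 * pi * k%:~R) = dconj_poisson r u.
Proof.
rewrite /dconj_poisson.
have -> : cos (u + 2 * pi * k%:~R) = cos u.
  rewrite -[RHS](periodic_int k u (@cosD2pi R)); congr cos.
  by rewrite mulr2n; ring.
by [].
Qed.

Lemma dconj_int_2pi h r x (k : int) : dconj_int h r (x + 2 * pi * k%:~R) = dconj_int h r x.
Proof.
by apply: eq_Rintegral => t _; rewrite addrAC dconj_poisson_2pi.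
Qed.

Lemma dconj_int_cvg : {ae mu, forall x : R, cvg (dconj_int f r x @[r --> (1 : R)^'-])}.
Proof.
have pi0 := pi_gt0 R; have pi20 : 0 < 2 * pi :> R by rewrite mulr_gt0.
(* A half-open period contains a translate of every real number, and the endpoint added to the open
   interval is negligible. Only countably many translates occur, so the exceptional set stays
   negligible. *)
pose P (x : R) := x \in `[- pi, pi[ -> cvg (dconj_int f r x @[r --> (1 : R)^'-]).
have aeP : {ae mu, forall x, P x}.
  have npi : {ae mu, forall x : R, x != - pi}.
    exists [set - pi]; split; [exact: measurable_set1|exact: lebesgue_measure_set1|].
    by move=> x /= /negP; rewrite negbK => /eqP.
  apply: aeS (aeI npi dconj_int_cvg_oo) => x [xpi H] xin; apply: H.
  move: xin; rewrite !in_itv/= => /andP[x1 ->]; rewrite andbT.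
  by rewrite lt_neqAle eq_sym xpi.
have aeN : {ae mu, forall x : R, forall n : nat,
    P (x + 2 * pi * (n : int)%:~R) /\ P (x + 2 * pi * (- (n : int))%:~R)}.
  by apply: ae_foralln => n; apply: aeI; exact: ae_shift aeP.
apply: aeS aeN => x H.
pose k := Num.floor ((x + pi) / (2 * pi)).
have k1 : k%:~R * (2 * pi) <= x + pi by rewrite -ler_pdivlMr// floor_le.
have k2 : x + pi < k%:~R * (2 * pi) + 2 * pi.
  by rewrite -[X in _ < _ + X]mul1r -mulrDl -ltr_pdivrMr// -[1]/(1%:~R) -intrD floorD1_gt.
have Pk : P (x + 2 * pi * (- k)%:~R).
  case: k {k1 k2} => n; first by have [] := H n.
  by have [] := H n.+1; rewrite NegzE opprK.
have xin : x + 2 * pi * (- k)%:~R \in `[- pi, pi[.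
  by rewrite in_itv/= mulrNz mulrN mulrC; apply/andP; split; lra.
have := Pk xin; under eq_fun do rewrite dconj_int_2pi.
exact.
Qed.

End RadialLimit.

(** * Comparison of the two integrals *)

Section Truncation.
Variable R : realType.
Notation mu := (@lebesgue_measure R).
Implicit Types (t u v tau sigma : R).

Lemma chord2N v : chord2 (- v) = chord2 v.
Proof. by rewrite /chord2 cosN. Qed.

Lemma chord2_norm v : chord2 `|v| = chord2 v.
Proof. by have [v0|v0] := leP 0 v; rewrite ?(ger0_norm v0)// (ltr0_norm v0) chord2N. Qed.

Lemma chord2_2piz v (k : int) : chord2 (v + 2 * pi * k%:~R) = chord2 v.
Proof. by apply: (@periodic_int _ (@chord2 R)) => t; exact: chord2D2pi. Qed.

Lemma chord2_mono u v : 0 <= u <= pi -> 0 <= v <= pi -> (chord2 u < chord2 v) = (u < v).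
Proof.
move=> upi vpi; rewrite /chord2 ltr_pM2l// ltrD2l ltrN2.
by rewrite (@ltr_cos R)// in_itv.
Qed.

(** Beyond pi the chord is that of the reflected angle 2 pi - |v|. *)
Lemma chord2_ge_far e v : 0 <= e <= pi -> e <= `|v| <= 2 * pi - e -> chord2 e <= chord2 v.
Proof.
move=> /andP[e0 epi] /andP[ev ve]; rewrite -(chord2_norm v); set w := `|v| in ev ve *.
have [wpi|piw] := leP w pi.
  by rewrite leNgt chord2_mono ?e0 ?(le_trans e0 ev)// -leNgt.
have -> : chord2 w = chord2 (2 * pi - w).
  by rewrite -(chord2N w) -(chord2D2pi (- w)) addrC.
by rewrite leNgt chord2_mono ?e0 -?leNgt//; [lra|apply/andP; split; lra].
Qed.

Lemma chord2_lt_near e v : 0 <= e <= pi -> `|v| < e -> chord2 v < chord2 e.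
Proof.
move=> epi ve; rewrite -(chord2_norm v) chord2_mono//.
by rewrite normr_ge0; case/andP: epi => _; exact: le_trans (ltW ve).
Qed.

Lemma chord2_gt0 v : 0 < `|v| < 2 * pi -> 0 < chord2 v.
Proof.
move=> /andP[v0 v2]; have c0 : chord2 0 = 0 :> R by rewrite /chord2 cos0 subrr mulr0.
pose e := Num.min `|v| (2 * pi - `|v|).
have e0 : 0 < e by rewrite lt_min v0 subr_gt0.
have ev : e <= `|v| by rewrite ge_min lexx.
have ev2 : e <= 2 * pi - `|v| by rewrite ge_min lexx orbT.
have epi : 0 <= e <= pi by apply/andP; split; lra.
apply: lt_le_trans (@chord2_ge_far e v epi _); last by apply/andP; split; lra.
by rewrite -c0 chord2_lt_near// normr0.
Qed.

Lemma sin_half_neq0 v : 0 < chord2 v -> sin (v / 2) != 0.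
Proof. by rewrite chord2E; apply: contraTneq => ->; rewrite expr0n/= mulr0 ltxx. Qed.

Lemma continuous_dcot_sub tau t : 0 < chord2 (tau - t) ->
  {for t, continuous (fun s => dcot (tau - s))}.
Proof.
move=> ct; have cc : continuous (fun s : R => chord2 (tau - s)).
  move=> s; apply: cvgMl_tmp; apply: cvgB; first exact: cvg_cst.
  apply: (@continuous_comp _ _ _ (fun s => tau - s)); last exact: continuous_cos.
  by apply: cvgB; [exact: cvg_cst|exact: cvg_id].
by apply: cvgMl_tmp; apply: cvgV; [rewrite lt0r_neq0|exact: cc].
Qed.

Definition cot_half v : R := cos (v / 2) / sin (v / 2).

Lemma cot_halfN v : cot_half (- v) = - cot_half v.
Proof. by rewrite /cot_half mulNr cosN sinN invrN mulrN. Qed.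

Lemma cot_half_2piz v (k : int) : cot_half (v + 2 * pi * k%:~R) = cot_half v.
Proof.
apply: (@periodic_int _ cot_half) => t; rewrite /cot_half.
have -> : (t + 2 * pi) / 2 = t / 2 + pi by field.
by rewrite cosDpi sinDpi invrN mulrNN.
Qed.

Lemma cot_half_pi : cot_half pi = 0.
Proof. by rewrite /cot_half cos_pihalf mul0r. Qed.

Lemma hilbert_kernelE tau t : hilbert_kernel tau t = cot_half (tau - t).
Proof. by []. Qed.

(* the 2 pi-periodic extension of [dcot_trunc e] from [-pi, pi] *)
Definition dcot_ptrunc e v : R := if chord2 e <= chord2 v then dcot v else 0.

Lemma dcot_ptruncE e v : 0 <= e <= pi -> `|v| <= pi -> dcot_ptrunc e v = dcot_trunc e v.
Proof.
move=> epi vpi; rewrite /dcot_ptrunc /dcot_trunc.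
have [ev|ve] := leP e `|v|.
  by rewrite chord2_ge_far// ev; case/andP: epi => ? ?; lra.
by rewrite leNgt chord2_lt_near.
Qed.

Lemma measurable_dcot_ptrunc (e : R) : measurable_fun setT (dcot_ptrunc e).
Proof.
apply: measurable_fun_ifT => //; last exact: (@measurable_dcot R).
by apply: measurable_fun_ler => //; exact: (@measurable_chord2 R).
Qed.

Lemma measurable_dcot_trunc (e : R) : measurable_fun setT (dcot_trunc e).
Proof.
apply: measurable_fun_ifT => //; last exact: (@measurable_dcot R).
by apply: measurable_fun_ler.
Qed.

Lemma dcot_ptrunc_bound e v : 0 < chord2 e -> `|dcot_ptrunc e v| <= 2 / chord2 e.
Proof.
move=> e0; rewrite /dcot_ptrunc; case: ifPn => [ev|_]; last by rewrite normr0 divr_ge0// ltW.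
by rewrite /dcot ger0_norm ?divr_ge0 ?chord2_ge0//; exact: ler_div_denom.
Qed.

Lemma int_itv_opp (h : R -> R) K : measurable_fun setT h -> (forall t, `|h t| <= K) ->
  \int[mu]_(t in `[- pi, pi]) h (- t) = \int[mu]_(t in `[- pi, pi]) h t.
Proof.
move=> mh hK; rewrite /Rintegral; congr fine.
have abE : `[- pi, pi]%classic =
    ((fun x => - x) : _ -> measurableTypeR R) @^-1` `[- pi, pi].
  by apply/seteqP; split=> x /=; rewrite !in_itv/= => /andP[? ?]; apply/andP; split; lra.
have mc : measurable_fun setT
    ((fun x => - x) : measurableTypeR R -> measurableTypeR R).
  exact: measurable_funN.
have mh' : measurable_fun setT (EFin \o h : measurableTypeR R -> \bar R).
  by exact/measurable_EFinP.
have ih : mu.-integrable `[- pi, pi] (EFin \o (fun t => h (- t))).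
  apply: (@integrable_itv_bounded _ _ _ _ K) => //.
  by apply: measurable_funTS; apply: (measurableT_comp mh).
rewrite abE in ih; have E := integral_pushforward mc mh' ih (measurable_itv _).
rewrite -abE in E; apply: (etrans (esym E)).
apply: eq_measure_integral => //= A mA AS; exact: lebesgue_measureN.
Qed.

Section Periodic.
Variables (f : R -> R) (M : R).
Hypothesis mf : measurable_fun setT f.
Hypothesis fM : forall x, `|f x| <= M.
Hypothesis fper : periodic f (2 * pi).

(** [sigma] is the translate of [tau] lying in the window. The cut integrand [F] is periodic and
    vanishes around [sigma], so the two pieces make up a full period, which is recentred at [tau];
    evenness of [dcot] removes the sign. *)
Lemma int_trunc tau (k : int) sigma e a : 0 < e <= pi ->
  sigma = tau + 2 * pi * k%:~R -> a <= sigma - e -> sigma + e <= a + 2 * pi ->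
  \int[mu]_(t in `[a, sigma - e]) (f t * dcot (tau - t)) +
  \int[mu]_(t in `[sigma + e, a + 2 * pi]) (f t * dcot (tau - t)) =
  \int[mu]_(u in `[- pi, pi]) (f (u + tau) * dcot_trunc e u).
Proof.
move=> /andP[e0 epi] sE ae eb.
have pi0 := pi_gt0 R.
have epi' : 0 <= e <= pi by rewrite ltW.
have ce : 0 < chord2 e by apply: chord2_gt0; rewrite gtr0_norm// e0/=; lra.
pose F t := f t * dcot_ptrunc e (tau - t).
have mF : measurable_fun setT F.
  apply: measurable_funM => //; apply: (measurableT_comp (@measurable_dcot_ptrunc e)).
  by apply: measurable_funB => //; exact: measurable_cst.
have FM t : `|F t| <= M * (2 / chord2 e).
  by rewrite normrM ler_pM// dcot_ptrunc_bound.
have Fper : periodic F (2 * pi).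
  move=> t; rewrite /F fper; congr (_ * _); rewrite /dcot_ptrunc /dcot.
  have -> : tau - (t + 2 * pi) = tau - t + 2 * pi * (-1)%:~R by rewrite mulrN1z; ring.
  by rewrite chord2_2piz.
have iF c d : mu.-integrable `[c, d] (EFin \o F).
  by apply: integrable_itv_bounded (fun t _ => FM t); exact: measurable_funTS.
have tauE t : chord2 (tau - t) = chord2 (sigma - t).
  have -> : sigma - t = tau - t + 2 * pi * k%:~R by rewrite sE; ring.
  by rewrite chord2_2piz.
have far t : e <= `|sigma - t| <= 2 * pi - e -> f t * dcot (tau - t) = F t.
  by move=> h; rewrite /F /dcot_ptrunc tauE chord2_ge_far.
have near0 t : t \in `]sigma - e, sigma + e[ -> F t = 0.
  rewrite in_itv/= => /andP[t1 t2]; rewrite /F /dcot_ptrunc tauE leNgt chord2_lt_near ?mulr0//.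
  by rewrite ltr_norml; apply/andP; split; lra.
have -> : \int[mu]_(t in `[a, sigma - e]) (f t * dcot (tau - t)) =
    \int[mu]_(t in `[a, sigma - e]) F t.
  apply: eq_Rintegral => t /set_mem/=; rewrite in_itv/= => /andP[t1 t2].
  by apply: far; rewrite ger0_norm; [apply/andP; split|]; lra.
have -> : \int[mu]_(t in `[sigma + e, a + 2 * pi]) (f t * dcot (tau - t)) =
    \int[mu]_(t in `[sigma + e, a + 2 * pi]) F t.
  apply: eq_Rintegral => t /set_mem/=; rewrite in_itv/= => /andP[t1 t2].
  by apply: far; rewrite ler0_norm; [apply/andP; split|]; lra.
(* At the two endpoints [F] need not vanish; they are discarded by passing to the open interval. *)
have mid : \int[mu]_(t in `[sigma - e, sigma + e]) F t = 0.
  rewrite -Rintegral_itv_obnd_cbnd; last first.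
    by apply: integrableS (iF (sigma - e) (sigma + e)) => //; apply: subset_itv; rewrite bnd_simp.
  rewrite -Rintegral_itv_bndo_bndc; last first.
    by apply: integrableS (iF (sigma - e) (sigma + e)) => //; apply: subset_itv; rewrite bnd_simp.
  transitivity (\int[mu]_(t in `]sigma - e, sigma + e[) (0 : R)).
    by apply: eq_Rintegral => t /set_mem; exact: near0.
  by rewrite Rintegral_cst// mul0r.
have -> : \int[mu]_(t in `[a, sigma - e]) F t + \int[mu]_(t in `[sigma + e, a + 2 * pi]) F t =
    \int[mu]_(t in `[a, a + 2 * pi]) F t.
  rewrite (int_itv_split ae (_ : sigma - e <= a + 2 * pi))//; last lra.
  rewrite (@int_itv_split _ (sigma - e) (sigma + e) (a + 2 * pi))//; last lra.
  by rewrite mid add0r.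
have -> : \int[mu]_(t in `[a, a + 2 * pi]) F t = \int[mu]_(t in `[- pi, pi]) F t.
  have := @int_itv_shift R (- pi) pi (a + pi) F mF.
  rewrite (_ : - pi + (a + pi) = a); last by ring.
  rewrite (_ : pi + (a + pi) = a + 2 * pi); last by ring.
  move=> ->; first exact: int_pi_periodic_shift.
  apply: integrable_itv_bounded (fun t _ => FM _); apply: measurable_funTS.
  by apply: measurableT_comp => //; exact: measurable_funD.
rewrite -(int_pi_periodic_shift tau mF FM Fper).
apply: eq_Rintegral => u /set_mem/=; rewrite in_itv/= => /andP[u1 u2].
rewrite /F (_ : tau - (u + tau) = - u); last by ring.
have un : `|u| <= pi by rewrite ler_norml u1.
rewrite dcot_ptruncE// ?normrN//.
by rewrite /dcot_trunc normrN /dcot chord2N.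
Qed.

End Periodic.

(** The case f = 1 of [int_trunc]. The primitive [hilbert_kernel 0] vanishes at both ends of the
    period, so only the ends of the gap contribute. *)
Lemma int_dcot_trunc e : 0 < e <= pi ->
  \int[mu]_(u in `[- pi, pi]) dcot_trunc e u = 2 * cot_half e.
Proof.
move=> epi; have /andP[e0 epi1] := epi; have pi0 := pi_gt0 R.
pose one : R -> R := fun=> 1.
have mone : measurable_fun setT one by exact: measurable_cst.
have oneM t : `|one t| <= 1 by rewrite normr1.
have oneper : periodic one (2 * pi) by [].
have oE : 0 = 0 + 2 * pi * (0 : int)%:~R :> R by rewrite mulr0 addr0.
have ae : - pi <= 0 - e by lra.
have eb : 0 + e <= - pi + 2 * pi by lra.
transitivity (\int[mu]_(u in `[- pi, pi]) (one (u + 0) * dcot_trunc e u)).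
  by apply: eq_Rintegral => u _; rewrite mul1r.
rewrite -(int_trunc mone oneM oneper epi oE ae eb).
have E (c d : R) : c <= d -> (forall t, t \in `[c, d] -> 0 < `|t| < 2 * pi) ->
    \int[mu]_(t in `[c, d]) (one t * dcot (0 - t)) = hilbert_kernel 0 d - hilbert_kernel 0 c.
  move=> cd Hcd.
  have ct t : t \in `[c, d] -> 0 < chord2 (0 - t).
    by move=> /Hcd; rewrite sub0r chord2N; exact: chord2_gt0.
  have dF t : t \in `[c, d] -> is_derive t (1 : R) (hilbert_kernel 0) (dcot (0 - t)).
    by move=> /ct tp; apply: is_derive_hilbert_kernel; exact: sin_half_neq0.
  rewrite -(int_itv_deriv cd dF); last by move=> t /ct; exact: continuous_dcot_sub.
  by apply: eq_Rintegral => t _; rewrite mul1r.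
have r1 t : t \in `[- pi, 0 - e] -> 0 < `|t| < 2 * pi.
  rewrite in_itv/= => /andP[t1 t2]; rewrite ltr0_norm; last lra.
  by apply/andP; split; lra.
have r2 t : t \in `[0 + e, - pi + 2 * pi] -> 0 < `|t| < 2 * pi.
  rewrite in_itv/= => /andP[t1 t2]; rewrite gtr0_norm; last lra.
  by apply/andP; split; lra.
rewrite (E _ _ ae r1) (E _ _ eb r2) !hilbert_kernelE.
have -> : 0 - (0 - e) = e :> R by ring.
have -> : 0 - - pi = pi :> R by ring.
have -> : 0 - (- pi + 2 * pi) = - pi :> R by ring.
have -> : 0 - (0 + e) = - e :> R by ring.
by rewrite !cot_halfN cot_half_pi; ring.
Qed.

Lemma int_sin_dcot_trunc e : 0 < e <= pi ->
  \int[mu]_(u in `[- pi, pi]) (sin u * dcot_trunc e u) = 0.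
Proof.
move=> epi; have /andP[e0 epi1] := epi; have pi0 := pi_gt0 R.
have ce : 0 < chord2 e by apply: chord2_gt0; rewrite gtr0_norm// e0/=; lra.
pose h u : R := sin u * dcot_ptrunc e u.
have mh : measurable_fun setT h.
  apply: measurable_funM; last exact: measurable_dcot_ptrunc.
  exact: continuous_measurable_fun (@continuous_sin R).
have hK u : `|h u| <= 1 * (2 / chord2 e).
  by rewrite normrM ler_pM// ?sin_max// dcot_ptrunc_bound.
have -> : \int[mu]_(u in `[- pi, pi]) (sin u * dcot_trunc e u) =
    \int[mu]_(u in `[- pi, pi]) h u.
  apply: eq_Rintegral => u /set_mem/=; rewrite in_itv/= => /andP[u1 u2].
  by rewrite /h dcot_ptruncE// ?ler_norml ?u1// (ltW e0).
have ih : mu.-integrable `[- pi, pi] (EFin \o h).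
  by apply: integrable_itv_bounded (fun t _ => hK t); exact: measurable_funTS.
have H := int_itv_opp mh hK.
have : \int[mu]_(t in `[- pi, pi]) h (- t) = -1 * \int[mu]_(t in `[- pi, pi]) h t.
  rewrite -RintegralZl//; apply: eq_Rintegral => t _.
  rewrite /h sinN /dcot_ptrunc /dcot chord2N; ring.
rewrite H; lra.
Qed.

End Truncation.

(** * The two Stieltjes integrals after integration by parts *)

Section StieltjesIntegrals.
Variable R : realType.
Notation mu := (@lebesgue_measure R).
Variables (Phi : R -> R) (M : R).
Hypothesis PhiM : forall x, `|Phi x| <= M.
Hypothesis Phi_cont : {ae mu, forall t, {for t, continuous Phi}}.
Hypothesis Phi_per : periodic Phi (2 * pi).

Let f := envelope Phi.

(** The boundary terms cancel by periodicity, and the minus sign of integration by parts cancels the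
    one from differentiating in t. *)
Lemma is_RS_conj_poisson r theta : 0 <= r < 1 ->
  is_RS_integral (fun t => conj_poisson_kernel r (theta - t)) Phi (- pi) pi
    (dconj_int f r theta).
Proof.
move=> r01; have pi0 := pi_gt0 R.
have dg (t : R) : t \in `[- pi, pi] ->
    is_derive t (1 : R) (fun t => conj_poisson_kernel r (theta - t))
      (- dconj_poisson r (theta - t)).
  move=> _; have dl : is_derive t (1 : R) (fun y : R => theta - y) (-1).
    by apply: is_derive_eq; rewrite /GRing.scale/=; ring.
  have := @is_derive1_comp _ (conj_poisson_kernel r) (fun y => theta - y) t _ _
    (is_derive_conj_poisson _ r01) dl.
  by move=> H; apply: (is_derive_eq H); rewrite mulrN1.
have cg (t : R) : t \in `[- pi, pi] -> {for t, continuous (fun t => - dconj_poisson r (theta - t))}.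
  by move=> _; apply: cvgN; exact: (@continuous_dconj_poisson_sub R r theta r01).
have ab : - pi <= pi :> R by lra.
have := is_RS_integral_parts PhiM Phi_cont dg cg ab.
congr (is_RS_integral _ _ _ _ _).
have -> : Phi pi = Phi (- pi) by rewrite -[RHS]Phi_per; congr Phi; ring.
have -> : conj_poisson_kernel r (theta - pi) = conj_poisson_kernel r (theta - - pi).
  have -> : theta - - pi = theta - pi + pi *+ 2 by rewrite -mulr_natl; ring.
  by rewrite /conj_poisson_kernel sinD2pi cosD2pi.
have -> : \int[mu]_(s in `[- pi, pi]) (envelope Phi s * - dconj_poisson r (theta - s)) =
    \int[mu]_(s in `[- pi, pi]) (-1 * (f s * dconj_poisson r (theta - s))).
  by apply: eq_Rintegral => s _; rewrite -/f; ring.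
rewrite RintegralZl//; last first.
  apply: (integrable_envelopeM PhiM) => t _.
  exact: (@continuous_dconj_poisson_sub R r theta r01).
by rewrite /dconj_int; ring.
Qed.

Lemma is_RS_hilbert tau a b : a <= b ->
  (forall t, t \in `[a, b] -> 0 < chord2 (tau - t)) ->
  is_RS_integral (hilbert_kernel tau) Phi a b
    (cot_half (tau - b) * Phi b - cot_half (tau - a) * Phi a -
     \int[mu]_(t in `[a, b]) (f t * dcot (tau - t))).
Proof.
move=> ab H; apply: (is_RS_integral_parts PhiM Phi_cont _ _ ab) => t /H h.
  by apply: is_derive_hilbert_kernel; exact: sin_half_neq0.
exact: continuous_dcot_sub.
Qed.

Definition hilbert_trunc eps tau :=
  cot_half eps * (Phi (tau + eps) + Phi (tau - eps)) -
  \int[mu]_(u in `[- pi, pi]) (f (u + tau) * dcot_trunc eps u).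

(** Periodicity cancels the boundary terms at the ends of the window, so the result depends on [tau]
    alone. The free left end [a] covers both the period centred at [tau] and [-pi, pi]. *)
Lemma RS_hilbert_trunc tau (k : int) sigma eps a : 0 < eps <= pi ->
  sigma = tau + 2 * pi * k%:~R -> a <= sigma - eps -> sigma + eps <= a + 2 * pi ->
  [/\ RS_integrable (hilbert_kernel tau) Phi a (sigma - eps),
      RS_integrable (hilbert_kernel tau) Phi (sigma + eps) (a + 2 * pi) &
      RS_pv_trunc (hilbert_kernel tau) Phi a (a + 2 * pi) sigma eps = hilbert_trunc eps tau].
Proof.
move=> epi sE ae eb; have /andP[e0 e1] := epi; have pi0 := pi_gt0 R.
have tauE t : chord2 (tau - t) = chord2 (sigma - t).
  have -> : sigma - t = tau - t + 2 * pi * k%:~R by rewrite sE; ring.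
  by rewrite chord2_2piz.
have r1 t : t \in `[a, sigma - eps] -> 0 < chord2 (tau - t).
  rewrite in_itv/= => /andP[t1 t2]; rewrite tauE chord2_gt0// gtr0_norm; last lra.
  by apply/andP; split; lra.
have r2 t : t \in `[sigma + eps, a + 2 * pi] -> 0 < chord2 (tau - t).
  rewrite in_itv/= => /andP[t1 t2]; rewrite tauE chord2_gt0// ltr0_norm; last lra.
  by apply/andP; split; lra.
have I1 := is_RS_hilbert ae r1; have I2 := is_RS_hilbert eb r2.
split; [by eexists; exact: I1|by eexists; exact: I2|].
rewrite /RS_pv_trunc (RS_integralE ae I1) (RS_integralE eb I2) /hilbert_trunc.
have mf : measurable_fun setT f by exact: (measurable_envelope PhiM).
have fM t : `|f t| <= M by exact: (envelope_le PhiM).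
have fper : periodic f (2 * pi) by exact: periodic_envelope.
rewrite -(int_trunc mf fM fper epi sE ae eb) Phi_per.
have -> : tau - (a + 2 * pi) = tau - a + 2 * pi * (-1)%:~R by rewrite mulrN1z; ring.
have -> : tau - (sigma - eps) = eps + 2 * pi * (- k)%:~R by rewrite sE mulrNz; ring.
have -> : tau - (sigma + eps) = - eps + 2 * pi * (- k)%:~R by rewrite sE mulrNz; ring.
have -> : sigma - eps = tau - eps + 2 * pi * k%:~R by rewrite sE; ring.
have -> : sigma + eps = tau + eps + 2 * pi * k%:~R by rewrite sE; ring.
rewrite !cot_half_2piz cot_halfN !(periodic_int _ _ Phi_per); ring.
Qed.

End StieltjesIntegrals.

(** * Difference of the two integrals at a point of differentiability *)

Section Comparison.
Variable R : realType.
Notation mu := (@lebesgue_measure R).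

Lemma cot_half_bound : exists2 C : R, 0 <= C & forall d, 0 < d <= pi -> `|cot_half d| * d <= C.
Proof.
have pi0 := pi_gt0 R.
have [c /andP[c0 c1] H] := @sin_ge_linear R (pi / 2) ltac:(apply/andP; split; lra).
exists (2 / c); first by rewrite divr_ge0// ltW.
move=> d /andP[d0 dpi].
have h : c * (d / 2) <= sin (d / 2) by apply: H; apply/andP; split; lra.
have s0 : 0 < sin (d / 2) by apply: lt_le_trans h; rewrite mulr_gt0// divr_gt0.
rewrite /cot_half normrM normfV (gtr0_norm s0) mulrAC ler_pdivrMr// mulrAC ler_pdivlMr//.
have := cos_max (d / 2); have := normr_ge0 (cos (d / 2)); move: `|cos _| => x x0 x1.
have : x * (d * c) <= 1 * (d * c) by rewrite ler_wpM2r// mulr_ge0// ltW.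
lra.
Qed.

Lemma sin_slope0 e : 0 < e -> exists2 d : R, 0 < d & forall u, `|u| < d -> `|sin u - u| <= e * `|u|.
Proof.
move=> e0; have := is_derive_has_slope (is_derive_sin (0 : R)); rewrite cos0.
by move=> /(_ e e0)[d d0 H]; exists d => // u /H; rewrite add0r sin0 subr0 mul1r.
Qed.

Variables (Phi : R -> R) (M : R).
Hypothesis PhiM : forall x, `|Phi x| <= M.
Hypothesis Phi_per : periodic Phi (2 * pi).

Let f := envelope Phi.

(** The constant [f tau] leaves 2 cot (d / 2) [Phi tau], with d = 1 - r, where the truncation has
    cot (d / 2) times [Phi (tau + d) + Phi (tau - d)]. The difference involves a second difference
    of [Phi], which is o(d), against a cotangent that is O(1 / d). *)
Lemma dconj_int_hilbert_trunc_le (tau A kappa e : R) : has_slope Phi tau A -> 0 <= kappa -> 0 < e ->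
  exists2 d0, 0 < d0 & forall r phi : R, 0 < 1 - r < d0 -> `|phi| <= kappa * (1 - r) ->
    `|dconj_int f r (tau + phi) - hilbert_trunc Phi (1 - r) tau| <= e.
Proof.
move=> PhiA kap0 e0; have pi0 := pi_gt0 R.
have M0 : 0 <= M by exact: le_trans (PhiM 0).
have mf : measurable_fun setT f by exact: (measurable_envelope PhiM).
have fM t : `|f t| <= M by exact: (envelope_le PhiM).
have fper : periodic f (2 * pi) by exact: periodic_envelope.
have fA : has_slope f tau A by exact: (envelope_has_slope PhiM).
have ftau : f tau = Phi tau by exact: (envelope_eq PhiM (has_slope_continuous PhiA)).
have msin : measurable_fun setT (@sin R) by exact: continuous_measurable_fun (@continuous_sin R).
have mft : measurable_fun setT (fun u : R => f (u + tau)).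
  by apply: measurableT_comp => //; exact: measurable_funD.
pose rho u := f (u + tau) - f tau - A * sin u.
have mrho : measurable_fun setT rho.
  exact: measurable_funB (measurable_funB mft (measurable_cst _)) (measurable_funM (measurable_cst _) msin).
have rhoM u : `|rho u| <= M + M + `|A|.
  rewrite /rho (le_trans (ler_normB _ _))// lerD//.
    by rewrite (le_trans (ler_normB _ _))// lerD.
  by rewrite normrM ler_piMr// sin_max.
have rhoo z : 0 < z -> exists2 d, 0 < d & forall u, `|u - 0| < d -> `|rho u| <= z * `|u - 0|.
  move=> z0; have [d1 d10 H1] := fA (z / 2) ltac:(by rewrite divr_gt0).
  have A1 : 0 < `|A| + 1 by rewrite ltr_wpDl.
  have [d2 d20 H2] := @sin_slope0 (z / (2 * (`|A| + 1))) ltac:(by rewrite divr_gt0// mulr_gt0).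
  exists (Num.min d1 d2); first by rewrite lt_min d10.
  move=> u; rewrite subr0 lt_min => /andP[/H1 h1 /H2 h2].
  have -> : rho u = (f (tau + u) - f tau - A * u) - A * (sin u - u).
    by rewrite /rho (addrC u tau); move: (f (tau + u)) (sin u) => ? ?; ring.
  rewrite (le_trans (ler_normB _ _))// normrM.
  have h3 : `|A| * `|sin u - u| <= z / 2 * `|u|.
    apply: le_trans (ler_wpM2l (normr_ge0 A) h2) _.
    rewrite mulrA ler_wpM2r// mulrA ler_pdivrMr ?mulr_gt0//.
    rewrite (_ : z / 2 * (2 * (`|A| + 1)) = `|A| * z + z); last by field.
    by rewrite lerDl ltW.
  by rewrite (le_trans (lerD h1 h3))// -mulrDl -splitr.
have [C1 C10 Hc] := cot_half_bound.
have [C C0 HN] := dconj_poissonD_dcot_trunc_le kap0.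
have e3 : 0 < e / 3 by rewrite divr_gt0.
have npi : - pi <= 0 :> R by lra.
have [d1 d10 Hrho] := int_littleo_kernel npi (ltW pi0) C0 (measurable_funTS mrho)
  (fun t _ => rhoM t) rhoo e3.
(* Two expansion errors e1 * d meet the factor cot (d / 2), and 2 * e1 * (C1 + 1) = e / 3. *)
pose e1 := e / (6 * (C1 + 1)).
have C11 : 0 < C1 + 1 by rewrite ltr_wpDl.
have e10 : 0 < e1 by rewrite divr_gt0// mulr_gt0.
have [d2 d20 HPhi] := PhiA e1 e10.
pose B := 2 * pi * `|A| * kappa + 1.
have B0 : 0 < B by rewrite ltr_wpDl// !mulr_ge0// ltW.
(* [d1] serves the remainder [rho], [d2] the boundary terms, 1/2 the kernel bounds, and e / 3 / B
   the sine term, which is O(|phi|). *)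
exists (Num.min (Num.min d1 d2) (Num.min (1 / 2) (e / 3 / B))).
  by rewrite !lt_min d10 d20 !divr_gt0.
move=> r phi /andP[r1]; rewrite !lt_min -!andbA => /and4P[rd1 rd2 r12 rB] phik.
have r01 : 0 <= r < 1 by clear -Phi_per PhiM f r1 r12; apply/andP; split; lra.
have r121 : 1 / 2 <= r < 1 by clear -Phi_per PhiM f r1 r12; apply/andP; split; lra.
set d := 1 - r in r1 rd1 rd2 r12 rB phik *.
have pi2 := pi_ge2 R.
have dpi : 0 < d <= pi by clear -Phi_per PhiM f r1 r12 pi2; rewrite r1/=; lra.
have dpi' : 0 <= d <= pi by case/andP: dpi => ? ?; rewrite ltW.
have cd : 0 < chord2 d by apply: chord2_gt0; rewrite gtr0_norm// r1/=; clear -Phi_per PhiM f pi2 r12; lra.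
pose K u := dconj_poisson r (phi - u).
have cK : continuous K by exact: (@continuous_dconj_poisson_sub R r phi r01).
pose N u := K u + dcot_trunc d u.
have mK : measurable_fun setT K by exact: continuous_measurable_fun.
have mT : measurable_fun setT (dcot_trunc d) by exact: measurable_dcot_trunc.
have mN : measurable_fun setT N by exact: measurable_funD.
have [BK BK0 KB] := @bounded_itv_cont R (- pi) pi K (fun x _ => cK x).
have TB u : u \in `[- pi, pi] -> `|dcot_trunc d u| <= 2 / chord2 d.
  rewrite in_itv/= => /andP[u1 u2]; have un : `|u| <= pi by rewrite ler_norml u1.
  by rewrite -dcot_ptruncE//; exact: dcot_ptrunc_bound.
have ib (g h : R -> R) G H : measurable_fun setT g -> measurable_fun setT h ->
    (forall u, `|g u| <= G) -> (forall u, u \in `[- pi, pi] -> `|h u| <= H) ->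
    mu.-integrable `[- pi, pi] (EFin \o (fun u => g u * h u)).
  move=> mg mh gG hH; apply: (@integrable_itv_bounded _ _ _ _ (G * H)).
    by apply: measurable_funTS; exact: measurable_funM.
  by move=> u /hH ?; rewrite normrM ler_pM.
have split_int (g : R -> R) G : measurable_fun setT g -> (forall u, `|g u| <= G) ->
    \int[mu]_(u in `[- pi, pi]) (g u * N u) =
    \int[mu]_(u in `[- pi, pi]) (g u * K u) + \int[mu]_(u in `[- pi, pi]) (g u * dcot_trunc d u).
  move=> mg gG; rewrite -RintegralD//; last 2 first.
  - exact: (ib _ _ _ _ mg mK gG KB).
  - exact: (ib _ _ _ _ mg mT gG TB).
  by apply: eq_Rintegral => u _; rewrite /N mulrDr.
have NB u : u \in `[- pi, pi] -> `|N u| <= BK + 2 / chord2 d.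
  by move=> ui; rewrite (le_trans (ler_normD _ _))// lerD ?KB ?TB.
have m1 : measurable_fun setT (fun _ : R => 1 : R) by exact: measurable_cst.
have one1 : `|1 : R| <= 1 by rewrite normr1.
have int1 : \int[mu]_(u in `[- pi, pi]) (1 * N u) = 2 * cot_half d.
  rewrite (split_int (fun=> 1) 1 m1 (fun=> one1)).
  have -> : \int[mu]_(u in `[- pi, pi]) (1 * K u) =
      \int[mu]_(u in `[- pi, pi]) (harmonic 0 1 0 u * dconj_poisson r (phi - u)).
    by apply: eq_Rintegral => u _; rewrite /harmonic !mul0r cos0 mulr1 addr0.
  rewrite int_harmonic_dconj_poisson// !(mul0r, mulr0) add0r -int_dcot_trunc//.
  by apply: eq_Rintegral => u _; rewrite mul1r.
have int2 : \int[mu]_(u in `[- pi, pi]) (sin u * N u) = 2 * pi * r * sin phi.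
  rewrite (split_int _ 1 msin (fun u => sin_max u)).
  have -> : \int[mu]_(u in `[- pi, pi]) (sin u * K u) =
      \int[mu]_(u in `[- pi, pi]) (harmonic 1 0 1 u * dconj_poisson r (phi - u)).
    by apply: eq_Rintegral => u _; rewrite /harmonic !mul1r mul0r add0r.
  rewrite int_harmonic_dconj_poisson// int_sin_dcot_trunc// addr0.
  by rewrite /harmonic mul0r add0r !mul1r expr1; ring.
have int3 : `|\int[mu]_(u in `[- pi, pi]) (rho u * N u)| <= e / 3.
  apply: (Hrho d); [by rewrite r1|exact: measurable_funTS|].
  move=> t; rewrite in_itv/= => /andP[t1 t2]; rewrite subr0; apply: HN => //.
  by rewrite ler_norml t1.
(* Integrate f (u + tau) = f tau + A sin u + rho u against [N]; the first two integrals are [int1]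
   and [int2]. *)
have main : dconj_int f r (tau + phi) + \int[mu]_(u in `[- pi, pi]) (f (u + tau) * dcot_trunc d u) =
    f tau * (2 * cot_half d) + A * (2 * pi * r * sin phi) +
    \int[mu]_(u in `[- pi, pi]) (rho u * N u).
  have -> : dconj_int f r (tau + phi) = \int[mu]_(u in `[- pi, pi]) (f (u + tau) * K u).
    pose F t := f t * dconj_poisson r (tau + phi - t).
    have cKt : continuous (fun t => dconj_poisson r (tau + phi - t)).
      exact: (@continuous_dconj_poisson_sub R r (tau + phi) r01).
    have mF : measurable_fun setT F.
      exact: measurable_funM mf (continuous_measurable_fun cKt).
    have FM t : `|F t| <= M * (4 / (1 - r) ^+ 2).
      rewrite normrM ler_pM// (le_trans (dconj_poisson_bound _ r121))// ler_div_denom//.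
        by rewrite exprn_gt0// -/d.
      by rewrite lerDl mulr_ge0 ?chord2_ge0//; case/andP: r01.
    have Fper : periodic F (2 * pi).
      move=> t; rewrite /F fper; congr (_ * _).
      by rewrite -[RHS](dconj_poisson_2pi _ _ (-1)) mulrN1z; congr dconj_poisson; ring.
    rewrite /dconj_int -(int_pi_periodic_shift tau mF FM Fper).
    apply: eq_Rintegral => u _; rewrite /F /K; congr (_ * dconj_poisson _ _); ring.
  rewrite -(split_int _ M mft (fun u => fM _)).
  rewrite -int1 -int2.
  rewrite -RintegralZl//; last exact: (ib _ _ _ _ m1 mN (fun=> one1) NB).
  rewrite -RintegralZl//; last exact: (ib _ _ 1 _ msin mN (fun u => sin_max _) NB).
  rewrite -RintegralD//; last 2 first.
  - by apply: integrable_itvZ; exact: (ib _ _ _ _ m1 mN (fun=> one1) NB).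
  - by apply: integrable_itvZ; exact: (ib _ _ 1 _ msin mN (fun u => sin_max _) NB).
  rewrite -RintegralD//; last 2 first.
  - apply: integrable_itvD; apply: integrable_itvZ.
      exact: (ib _ _ _ _ m1 mN (fun=> one1) NB).
    exact: (ib _ _ 1 _ msin mN (fun u => sin_max _) NB).
  - exact: (ib _ _ _ _ mrho mN rhoM NB).
  by apply: eq_Rintegral => u _; rewrite /rho; move: (N u) (sin u) (f (u + tau)) => ? ? ?; ring.
have -> : dconj_int f r (tau + phi) - hilbert_trunc Phi d tau =
    A * (2 * pi * r * sin phi) + \int[mu]_(u in `[- pi, pi]) (rho u * N u) -
    cot_half d * ((Phi (tau + d) - Phi tau - A * d) + (Phi (tau - d) - Phi tau + A * d)).
  by rewrite /hilbert_trunc -/f; move: main; rewrite ftau; clear -Phi_per PhiM f; lra.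
have b1 : `|A * (2 * pi * r * sin phi)| <= e / 3.
  have sphi : `|sin phi| <= kappa * d by exact: le_trans (norm_sin_le phi) phik.
  have /andP[r0' /ltW r1'] := r01.
  rewrite !normrM (ger0_norm (ltW pi0)) (ger0_norm r0') (ger0_norm (ler0n _ 2)).
  apply: (@le_trans _ _ (`|A| * (2 * pi * 1 * (kappa * d)))).
    rewrite ler_wpM2l// ler_pM//; first by rewrite !mulr_ge0// ltW.
    by rewrite ler_wpM2l// mulr_ge0// ltW.
  move: rB; rewrite ltr_pdivlMr// /B; clear -Phi_per PhiM f r1; lra.
have b2 : `|cot_half d * ((Phi (tau + d) - Phi tau - A * d) + (Phi (tau - d) - Phi tau + A * d))| <= e / 3.
  have h1 : `|Phi (tau + d) - Phi tau - A * d| <= e1 * d.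
    by have := HPhi d; rewrite gtr0_norm//; apply.
  have h2 : `|Phi (tau - d) - Phi tau + A * d| <= e1 * d.
    by have := HPhi (- d); rewrite normrN gtr0_norm// mulrN opprK; apply.
  rewrite normrM; apply: (@le_trans _ _ (`|cot_half d| * (2 * (e1 * d)))).
    by rewrite ler_wpM2l// (le_trans (ler_normD _ _))// mulr_natl mulr2n lerD.
  have -> : `|cot_half d| * (2 * (e1 * d)) = `|cot_half d| * d * (2 * e1) by ring.
  apply: (@le_trans _ _ ((C1 + 1) * (2 * e1))).
    apply: ler_wpM2r; first by rewrite mulr_ge0// ltW.
    by rewrite ler_wpDr// Hc.
  by rewrite /e1 le_eqVlt; apply/orP; left; apply/eqP; field; rewrite lt0r_neq0.
rewrite (le_trans (ler_normB _ _))//.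
have := ler_normD (A * (2 * pi * r * sin phi)) (\int[mu]_(u in `[- pi, pi]) (rho u * N u)).
clear -Phi_per PhiM f b1 b2 int3; lra.
Qed.

End Comparison.

(** * Principal values and angular limits from the radial limit *)

Section PointwiseLimits.
Variable R : realType.
Notation mu := (@lebesgue_measure R).
Variables (Phi : R -> R) (M : R).
Hypothesis PhiM : forall x, `|Phi x| <= M.
Hypothesis Phi_per : periodic Phi (2 * pi).
Variables (tau A l : R).
Hypothesis PhiA : has_slope Phi tau A.
Hypothesis dconj_l : dconj_int (envelope Phi) r tau @[r --> (1 : R)^'-] --> l.

(** The comparison at phi = 0, with eps in the role of 1 - r, carries the radial limit over to the
    truncations. *)
Lemma hilbert_trunc_cvg : hilbert_trunc Phi eps tau @[eps --> (0 : R)^'+] --> l.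
Proof.
apply/cvgrPdist_le => e e0; have e20 : 0 < e / 2 by rewrite divr_gt0.
have [d0 d00 H] := dconj_int_hilbert_trunc_le PhiM Phi_per PhiA (lexx 0) e20.
move/cvgrPdist_le : dconj_l => /(_ _ e20)[d1 /= d10 H1].
exists (Num.min d0 d1); first by rewrite /= lt_min d00.
move=> eps /=; rewrite sub0r normrN => + eps0; rewrite (gtr0_norm eps0) lt_min => /andP[ed0 ed1].
have eE : 1 - (1 - eps) = eps by ring.
have := H (1 - eps) 0; rewrite eE addr0 normr0 mul0r eps0 ed0 lexx => /(_ isT isT) h.
have := H1 (1 - eps); rewrite /= eE (gtr0_norm eps0) => /(_ ed1) => /(_ ltac:(lra)) h1.
rewrite [e]splitr; set x := dconj_int _ _ _ in h h1.
by rewrite -(subrK x l) -addrA (le_trans (ler_normD _ _))// lerD.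
Qed.

(** The same truncation at 1 - r serves every [phi] of the angle, so it acts as the intermediate
    term. *)
Lemma dconj_int_nontangential kappa e : 0 <= kappa -> 0 < e ->
  exists2 d0, 0 < d0 & forall r phi : R, 0 < 1 - r < d0 -> `|phi| <= kappa * (1 - r) ->
    `|dconj_int (envelope Phi) r (tau + phi) - l| <= e.
Proof.
move=> kap0 e0; have e20 : 0 < e / 2 by rewrite divr_gt0.
have [d0 d00 H] := dconj_int_hilbert_trunc_le PhiM Phi_per PhiA kap0 e20.
move/cvgrPdist_le : hilbert_trunc_cvg => /(_ _ e20)[d1 /= d10 H1].
exists (Num.min d0 d1); first by rewrite lt_min d00.
move=> r phi /andP[r1]; rewrite lt_min => /andP[rd0 rd1] /H; rewrite r1 rd0 => /(_ isT) h.
have := H1 (1 - r); rewrite /= sub0r normrN (gtr0_norm r1) => /(_ rd1 r1) h1.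
rewrite [e]splitr; set x := hilbert_trunc _ _ _ in h h1.
by rewrite -(subrK x (dconj_int _ _ _)) -addrA (le_trans (ler_normD _ _))// lerD// distrC.
Qed.

Hypothesis Phi_cont : {ae mu, forall t, {for t, continuous Phi}}.

Lemma has_RS_pv_hilbert (k : int) sigma a : sigma = tau + 2 * pi * k%:~R ->
  a < sigma -> sigma < a + 2 * pi ->
  has_RS_pv (hilbert_kernel tau) Phi a (a + 2 * pi) sigma /\
  RS_pv (hilbert_kernel tau) Phi a (a + 2 * pi) sigma = l.
Proof.
move=> sE asig siga; have pi0 := pi_gt0 R.
pose d := Num.min pi (Num.min (sigma - a) (a + 2 * pi - sigma)).
have d0 : 0 < d by rewrite !lt_min pi0 !subr_gt0 asig.
have T : \forall eps \near (0 : R)^'+,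
    [/\ RS_integrable (hilbert_kernel tau) Phi a (sigma - eps),
      RS_integrable (hilbert_kernel tau) Phi (sigma + eps) (a + 2 * pi) &
      RS_pv_trunc (hilbert_kernel tau) Phi a (a + 2 * pi) sigma eps = hilbert_trunc Phi eps tau].
  exists d => // eps /=; rewrite sub0r normrN => + e0.
  rewrite (gtr0_norm e0) !lt_min => /and3P[e1 e2 e3].
  by apply: (RS_hilbert_trunc PhiM Phi_cont Phi_per _ sE); rewrite ?e0/=; lra.
have cv : RS_pv_trunc (hilbert_kernel tau) Phi a (a + 2 * pi) sigma eps @[eps --> 0^'+] --> l.
  apply: cvg_trans hilbert_trunc_cvg; apply: near_eq_cvg.
  by near=> eps; symmetry; have [] : [/\ RS_integrable (hilbert_kernel tau) Phi a (sigma - eps),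
      RS_integrable (hilbert_kernel tau) Phi (sigma + eps) (a + 2 * pi) &
      RS_pv_trunc (hilbert_kernel tau) Phi a (a + 2 * pi) sigma eps = hilbert_trunc Phi eps tau]
    by near: eps.
split; last exact: cvg_lim cv.
split; last by apply/cvg_ex; exists l.
by apply: filterS T => eps [].
Unshelve. all: by end_near. Qed.

End PointwiseLimits.

(** * Nontangential approach *)

Section Nontangential.
Local Open Scope complex_scope.
Variable R : realType.
Implicit Types (z zeta : R[i]^o) (tau phi rho d q : R).

Lemma normCE z : `|z| = (cmod z)%:C.
Proof. by rewrite /cmod normc_def. Qed.

Lemma cmod_ge0 z : 0 <= cmod z.
Proof. by rewrite /cmod normc_def sqrtr_ge0. Qed.

Lemma cmod_sqr z : cmod z ^+ 2 = complex.Re z ^+ 2 + complex.Im z ^+ 2.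
Proof. by rewrite /cmod normc_def/= sqr_sqrtr// addr_ge0// sqr_ge0. Qed.

Lemma unit_disc_cmod z : unit_disc z -> cmod z < 1.
Proof. by rewrite /unit_disc/= normCE -ltcR. Qed.

(** [carg] is a choice, so an argument has to be exhibited: [acos] of x / |z| with the sign of the
    imaginary part, or 0 when z = 0. *)
Lemma cargE z : z = (cmod z)%:C * expi (carg z).
Proof.
suff : exists theta, z = (cmod z)%:C * expi theta by move=> /getPex.
have z2 := cmod_sqr z; have z0 := cmod_ge0 z.
move: z2 z0; set q := cmod z => z2.
case: z @q z2 => x y q /= z2; rewrite le_eqVlt => /orP[/eqP q0|q0].
  exists 0; move: z2; rewrite -q0 expr0n/= => /esym/eqP.
  rewrite paddr_eq0 ?sqr_ge0// !sqrf_eq0 => /andP[/eqP -> /eqP ->].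
  by rewrite mul0r.
have y2 : (y / q) ^+ 2 = 1 - (x / q) ^+ 2.
  suff : (x / q) ^+ 2 + (y / q) ^+ 2 = 1 by lra.
  by rewrite !expr_div_n -mulrDl -z2 divff// expf_neq0// lt0r_neq0.
have x1 : -1 <= x / q <= 1.
  have : (x / q) ^+ 2 <= 1 by have := sqr_ge0 (y / q); lra.
  by rewrite -ler_norml -ler_sqrt// sqrtr_sqr sqrtr1.
have xE : x = q * (x / q) by rewrite mulrC divfK// lt0r_neq0.
have yE : y = q * (y / q) by rewrite mulrC divfK// lt0r_neq0.
have sE : sin (acos (x / q)) = `|y / q| by rewrite sin_acos// -y2 sqrtr_sqr.
have cE : cos (acos (x / q)) = x / q by have [] := acos_def x1.
have [y0|y0] := leP 0 (y / q).
  exists (acos (x / q)); apply/eqP; rewrite eq_complex /= !mul0r subr0 addr0.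
  by rewrite cE sE ger0_norm// -xE -yE !eqxx.
exists (- acos (x / q)); apply/eqP; rewrite eq_complex /= !mul0r subr0 addr0.
by rewrite cosN sinN cE sE ltr0_norm// opprK -xE -yE !eqxx.
Qed.

Lemma angle_reduce (x : R) : exists (k : int) (phi : R), x = phi + 2 * pi * k%:~R /\ `|phi| <= pi.
Proof.
have pi0 := pi_gt0 R; have p2 : 0 < 2 * pi :> R by rewrite mulr_gt0.
have /andP[] := floor_itv ((x + pi) / (2 * pi)).
rewrite ler_pdivlMr// ltr_pdivrMr// intrD; set k := Num.floor _ => h1 h2.
exists k, (x - 2 * pi * k%:~R); split; first by ring.
by rewrite ler_norml; apply/andP; split; lra.
Qed.

(** The denominator of the Poisson kernel is the squared distance from z to the boundary point. *)
Lemma cmod_sub_expi_sqr z tau phi (k : int) : carg z = tau + phi + 2 * pi * k%:~R ->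
  cmod (z - expi tau) ^+ 2 = (1 - cmod z) ^+ 2 + cmod z * chord2 phi.
Proof.
move=> cE; rewrite -poisson_denE [in LHS](cargE z) cE cmod_sqr.
have cosE : cos (tau + phi + 2 * pi * k%:~R) = cos (tau + phi).
  by apply: (@periodic_int _ (@cos R)) => t; rewrite mulr_natl cosD2pi.
have sinE : sin (tau + phi + 2 * pi * k%:~R) = sin (tau + phi).
  by apply: (@periodic_int _ (@sin R)) => t; rewrite mulr_natl sinD2pi.
rewrite /= cosE sinE !mul0r subr0 addr0; set q := cmod z.
have c1 := cos2Dsin2 tau; have c2 := cos2Dsin2 (tau + phi).
have -> : phi = tau + phi - tau by ring.
rewrite (_ : tau + (tau + phi - tau) = tau + phi); last by ring.
rewrite cosB; move: (cos (tau + phi)) (sin (tau + phi)) (cos tau) (sin tau) c1 c2.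
move=> a b c s c1 c2.
have -> : (q * a - c) ^+ 2 + (q * b - s) ^+ 2 =
  (c ^+ 2 + s ^+ 2) - 2 * q * (a * c + b * s) + q ^+ 2 * (a ^+ 2 + b ^+ 2) by ring.
by rewrite c1 c2 mulr1.
Qed.

(** Each ray of the angle stays in the disc up to length [d], which forces cos (phi - tau) <= - d /
    2 for all its directions. Hence |z|^2 <= 1 - rho d + rho^2 <= 1 - rho d / 2 for rho <= d / 2,
    and 1 - |z|^2 <= 2 (1 - |z|) gives the constant 4 / d. *)
Lemma angle_dist_le tau alpha beta d z : 0 < d ->
  angle (expi tau) alpha beta d `<=` @unit_disc R -> angle (expi tau) alpha beta d z ->
  cmod (z - expi tau) <= d / 2 -> cmod (z - expi tau) <= 4 / d * (1 - cmod z).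
Proof.
move=> d0 sub az; have z1 := unit_disc_cmod (sub _ az).
case: az z1 => rho [phi [/andP[rho0 rhod] phiab ->]] z1.
have -> : expi tau + rho%:C * expi phi - expi tau = rho%:C * expi phi by rewrite addrC addKr.
have E s : 0 < s -> cmod (expi tau + s%:C * expi phi) ^+ 2 = 1 + 2 * s * cos (phi - tau) + s ^+ 2.
  move=> s0; rewrite cmod_sqr /= !mul0r subr0 addr0 cosB.
  have c1 := cos2Dsin2 tau; have c2 := cos2Dsin2 phi.
  transitivity ((cos tau ^+ 2 + sin tau ^+ 2) + 2 * s * (cos phi * cos tau + sin phi * sin tau) +
    s ^+ 2 * (cos phi ^+ 2 + sin phi ^+ 2)); first by ring.
  by rewrite c1 c2 mulr1.
have cphi : cos (phi - tau) <= - d / 2.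
  apply/ler_addgt0Pl => e e0.
  (* A length below [d] but within 2 e of it; membership in the disc gives cos (phi - tau) < - s / 2
     <= - d / 2 + e. *)
  pose s := Num.max (d / 2) (d - 2 * e).
  have s0 : 0 < s by rewrite lt_max divr_gt0.
  have sd : s < d by rewrite gt_max; apply/andP; split; lra.
  have se : d - 2 * e <= s by rewrite le_max lexx orbT.
  have : @unit_disc R (expi tau + s%:C * expi phi) by apply: sub; exists s, phi; rewrite s0 sd.
  move=> /unit_disc_cmod s1; have := cmod_ge0 (expi tau + s%:C * expi phi).
  have := E s s0; move: (cmod _) s1 => q q1 qE q0.
  have : q ^+ 2 < 1 by rewrite expr_lt1.
  rewrite qE => h; have : s * (2 * cos (phi - tau) + s) < 0 by lra.
  rewrite pmulr_rlt0//; lra.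
have -> : cmod (rho%:C * expi phi) = rho.
  have := cmod_sqr (rho%:C * expi phi); rewrite /= !mul0r subr0 addr0 !exprMn -mulrDr cos2Dsin2 mulr1.
  by move/eqP; rewrite eqrXn2 ?cmod_ge0// ?ltW// => /eqP.
move=> rho2; have := E rho rho0; have := cmod_ge0 (expi tau + rho%:C * expi phi).
move: (cmod _) z1 => q q1 q0 qE.
rewrite mulrAC ler_pdivlMr//.
have : rho * (2 * cos (phi - tau) + d) <= 0 by rewrite pmulr_rle0//; lra.
have : (1 - q) * (1 - q) >= 0 by rewrite mulr_ge0//; lra.
have : rho * (d / 2 - rho) >= 0 by rewrite mulr_ge0//; lra.
have -> : (1 - q) * (1 - q) = 1 - 2 * q + q ^+ 2 by ring.
rewrite qE; lra.
Qed.

(** The squared distance to the vertex is at least |z| * [chord2 phi], hence at least c phi^2 / 2,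
    so |phi| is controlled by the distance and [angle_dist_le] applies. As 2 / c >= 1, it serves as
    a bound for its own square root. *)
Lemma angle_carg_le tau alpha beta d : 0 < d ->
  angle (expi tau) alpha beta d `<=` @unit_disc R ->
  exists2 kappa : R, 0 <= kappa & forall z, angle (expi tau) alpha beta d z ->
    cmod (z - expi tau) <= d / 2 -> 1 / 2 <= cmod z ->
    exists (k : int) phi, carg z = tau + phi + 2 * pi * k%:~R /\ `|phi| <= kappa * (1 - cmod z).
Proof.
move=> d0 sub; have pi0 := pi_gt0 R.
have [c /andP[c0 c1] Hc] := @chord2_ge R pi ltac:(apply/andP; split; lra).
exists (2 / c * (4 / d)); first by rewrite mulr_ge0// divr_ge0// ltW.
move=> z az zd z12; have z1 := unit_disc_cmod (sub _ az).
have [k [phi [cE phipi]]] := angle_reduce (carg z - tau).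
have {}cE : carg z = tau + phi + 2 * pi * k%:~R by rewrite -addrA -cE addrC subrK.
exists k, phi; split => //.
have := angle_dist_le d0 sub az zd; have := cmod_sub_expi_sqr cE.
have := cmod_ge0 (z - expi tau).
move: (cmod (z - _)) => x x0 xE xle.
have h1 := Hc _ phipi; have s0 := chord2_ge0 phi.
move: (cmod z) z1 z12 xE xle => q q1 q12 xE xle.
have h2 : q * chord2 phi >= 1 / 2 * chord2 phi by rewrite ler_wpM2r.
have h3 := sqr_ge0 (1 - q).
have h4 : c * phi ^+ 2 <= 2 * x ^+ 2 by lra.
have c2 : 1 <= 2 / c by rewrite ler_pdivlMr//; lra.
have h5 : phi ^+ 2 <= (2 / c * x) ^+ 2.
  have : phi ^+ 2 <= 2 / c * x ^+ 2 by rewrite mulrAC ler_pdivlMr//; lra.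
  move=> /le_trans; apply; rewrite exprMn ler_wpM2r ?sqr_ge0// expr2.
  by rewrite ler_peMl//; lra.
have : `|phi| <= 2 / c * x.
  have y0 : 0 <= 2 / c * x by apply: mulr_ge0 => //; lra.
  by rewrite -(@ler_pXn2r _ 2)// ?nnegrE// real_normK ?num_real.
move=> /le_trans; apply; rewrite -[leRHS]mulrA ler_wpM2l//; lra.
Qed.

End Nontangential.

(** * The Stieltjes integral along a nontangential path *)

Section NontangentialLimit.
Variable R : realType.
Notation mu := (@lebesgue_measure R).
Variables (Phi : R -> R) (M : R).
Hypothesis PhiM : forall x, `|Phi x| <= M.
Hypothesis Phi_per : periodic Phi (2 * pi).
Hypothesis Phi_cont : {ae mu, forall t, {for t, continuous Phi}}.
Variables (tau A l : R).
Hypothesis PhiA : has_slope Phi tau A.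
Hypothesis dconj_l : dconj_int (envelope Phi) r tau @[r --> (1 : R)^'-] --> l.

Lemma conj_poisson_stieltjes_nontangential (gamma : R -> R[i]^o) :
  nontangential_path gamma (expi tau) ->
  conj_poisson_stieltjes Phi (gamma t) @[t --> 1^'-] --> (2 * pi)^-1 * l.
Proof.
move=> [[_ gdisc gcvg] [alpha [beta [d [d0 sub gangle]]]]].
have pi0 := pi_gt0 R.
have [kappa kap0 Hk] := angle_carg_le d0 sub.
apply: cvgMl_tmp; apply/cvgrPdist_le => e e0.
have [d1 d10 H] := dconj_int_nontangential PhiM Phi_per PhiA dconj_l kap0 e0.
(* [d / 2] is the range of [angle_carg_le], [d1] that of the angular limit, and 1/2 keeps the
   modulus of [gamma t] above 1/2. *)
pose eta := Num.min (d / 2) (Num.min d1 (1 / 2)).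
have eta0 : 0 < eta by rewrite !lt_min d10 !divr_gt0.
have near_eta : \forall t \near (1 : R)^'-, cmod (gamma t - expi tau) < eta.
  have etaC : (0 : R[i]) < (eta%:C)%C by rewrite -[0]/((0%:C)%C) ltcR.
  move/cvgrPdist_lt : gcvg => /(_ _ etaC); apply: filterS => t.
  by rewrite distrC normCE ltcR.
have pos : \forall t \near (1 : R)^'-, 0 <= t < 1.
  near=> t; apply/andP; split; last by near: t; exact: nbhs_left_lt.
  by near: t; exact: nbhs_left_ge.
near=> t.
have t01 : 0 <= t < 1 by near: t.
have : cmod (gamma t - expi tau) < eta by near: t.
rewrite !lt_min => /and3P[g1 g2 g3].
have q1 := unit_disc_cmod (gdisc t t01).
have az : angle (expi tau) alpha beta d (gamma t).
  by apply: gangle => //; rewrite normCE ltcR; lra.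
have q2 : 1 - cmod (gamma t) <= cmod (gamma t - expi tau).
  rewrite lterBDr.
  have := ler_normB (gamma t) (gamma t - expi tau).
  rewrite subKr !normCE -rmorphD/= lecR addrC; apply: le_trans.
  have := cmod_sqr (expi tau); rewrite /= cos2Dsin2 => /eqP.
  by rewrite sqrp_eq1 ?cmod_ge0// => /eqP ->.
have [k [phi [cE phik]]] := Hk _ az (ltW g1) ltac:(lra).
have r01 : 0 <= cmod (gamma t) < 1 by rewrite cmod_ge0.
have npi : - pi <= pi :> R by lra.
rewrite (RS_integralE npi (is_RS_conj_poisson PhiM Phi_cont Phi_per (carg (gamma t)) r01)).
rewrite cE dconj_int_2pi distrC; apply: H => //.
by apply/andP; split; lra.
Unshelve. all: by end_near. Qed.

End NontangentialLimit.

Theorem theorem2 (R : realType) (Phi : R -> R)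
    (Phi_periodic : periodic Phi (2 * pi))
    (Phi_bounded : bounded_fun Phi)
    (Phi_derivable : {ae @lebesgue_measure R, forall t, derivable Phi t 1}) :
  (forall r theta : R, 0 <= r < 1 ->
     RS_integrable (fun t => conj_poisson_kernel r (theta - t))
       Phi (- pi) pi) /\
  {ae @lebesgue_measure R, forall tau,
    [/\ has_RS_pv (hilbert_kernel tau) Phi (tau - pi) (tau + pi) tau,
        (* sigma is the point of ]-pi, pi[ congruent to tau modulo 2 pi, at
           which the integrand is singular *)
        (forall (k : int) (sigma : R),
           sigma = tau + 2 * pi * k%:~R -> - pi < sigma < pi ->
           has_RS_pv (hilbert_kernel tau) Phi (- pi) pi sigma /\
           hilbert_stieltjes Phi tau =
             (2 * pi)^-1 * RS_pv (hilbert_kernel tau) Phi (- pi) pi sigma) &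
        forall gamma : R -> R[i]^o, nontangential_path gamma (expi tau) ->
          conj_poisson_stieltjes Phi (gamma t) @[t --> 1^'-]
            --> hilbert_stieltjes Phi tau]}.
Proof.
have pi0 := pi_gt0 R.
have [M PhiM] : exists M, forall x, `|Phi x| <= M.
  have [B [_ H]] := Phi_bounded; exists (B + 1) => x.
  by apply: (H (B + 1)) => //; rewrite ltrDl.
have slope := aeS (@derivable_has_slope R Phi) Phi_derivable.
have Phi_cont : {ae @lebesgue_measure R, forall t, {for t, continuous Phi}}.
  by apply: aeS slope => t [A]; exact: has_slope_continuous.
split.
  by move=> r theta r01; eexists; exact: (is_RS_conj_poisson PhiM Phi_cont Phi_periodic).
have env_slope : {ae @lebesgue_measure R, forall x, exists A, has_slope (envelope Phi) x A}.
  by apply: aeS slope => x [A PhiA]; exists A; exact: (envelope_has_slope PhiM).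
have lim := dconj_int_cvg (measurable_envelope PhiM) (envelope_le PhiM)
  (periodic_envelope Phi_periodic) env_slope.
apply: aeS (aeI slope lim) => tau [[A PhiA] /cvg_ex[/= l dconj_l]].
(* Used twice: on the period centred at [tau], with k = 0, and on [-pi, pi] with the singularity at
   [sigma]. Both principal values are the same [l]. *)
have pv := has_RS_pv_hilbert PhiM Phi_periodic PhiA dconj_l Phi_cont.
have pv0 : has_RS_pv (hilbert_kernel tau) Phi (tau - pi) (tau + pi) tau /\
    hilbert_stieltjes Phi tau = (2 * pi)^-1 * l.
  have [] := pv 0 tau (tau - pi); [by rewrite mulr0 addr0|lra|lra|].
  rewrite (_ : tau - pi + 2 * pi = tau + pi); last by ring.
  by rewrite /hilbert_stieltjes => h ->.
have [pv1 hE] := pv0; rewrite hE; split => //.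
  move=> k sigma sE /andP[s1 s2]; have [] := pv k sigma (- pi) sE s1; first lra.
  by rewrite (_ : - pi + 2 * pi = pi)//; [move=> h ->|ring].
move=> gamma.
exact: (conj_poisson_stieltjes_nontangential PhiM Phi_periodic Phi_cont PhiA dconj_l).
Qed.
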